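(* Let $T\ge1$, $\nu>0$, $\ell>0$, $\sigma_u>0$, $\sigma_x>0$. Let $\mathcal{U}$ be a Gaussian process on $\mathbb{R}^T\times\mathbb{R}^T$ with stationary isotropic Mat\'ern covariance $k_u([x,y],[v,w])=\sigma_u^2\,h_{\mathrm{Mat}}(\|[x-v,y-w]\|_2;\ell,\nu)$, let $\mathcal{F}(x,y)=\mathcal{U}(x,y)-\mathcal{U}(y,x)$ with $\mathbb{E}[\mathcal{F}(x,y)]=0$ for all $x,y$, and let the attributes be i.i.d. Gaussian with covariance $\sigma_x^2I$, drawn independently of $\mathcal{F}$. Let $r=\sigma_x/\ell$, let $\rho(r,\nu)$ be the shared-endpoint correlation, and let $V\sim\mathrm{Gamma}^{-1}(\nu,\nu)$ and $$\tilde\rho(r,\nu)=\frac{\mathbb{E}\left[(1+2r^2V)^{-T/2}\right]-\mathbb{E}\left[(1+4r^2V)^{-T/2}\right]}{1-\mathbb{E}\left[(1+4r^2V)^{-T/2}\right]}.$$ Then $\rho(r,\nu)>\tilde\rho(r,\nu)$, and in the limit $r\to0$: (i) if $\nu\in(0,1)$: $\displaystyle \tilde\rho(r,\nu)\simeq\left(1-2^{-\nu}\right)\left[1-\frac{2^{1-\nu}-1}{2^\nu-1}\Gamma(\nu)(2\nu)^{1-\nu}r^{2(1-\nu)}\right]=(1-2^{-\nu})-\mathcal{O}(r^{2(1-\nu)})$; (ii) if $\nu=1$: $\displaystyle \tilde\rho(r,\nu)\simeq\frac12\left[1-\frac12|\log_2(r)|^{-1}\right]=\frac12-\mathcal{O}(|\log_2(r)|^{-1})$;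 (iii) if $\nu\in(1,2)$: $\displaystyle \tilde\rho(r,\nu)\simeq\frac12\left[1-\frac{(2\nu)^{\nu-1}}{\Gamma(\nu)}\left[2^{\nu-1}-1\right]\frac{\nu(T-2)+2}{T}r^{2(\nu-1)}\right]=\frac12-\mathcal{O}(r^{2(\nu-1)})$. The lower bound $\tilde\rho$ is asymptotically accurate for $\rho$ when $\nu\in[1,2)$, i.e. $\rho(r,\nu)\simeq\tilde\rho(r,\nu)$. (iv) If $\nu>2$: $\displaystyle \rho(r,\nu)\simeq\frac12\left[1-\frac{T-1}{2}\frac{\nu}{\nu-2}r^2\right]=\frac12-\mathcal{O}(r^2)$.
   Context: Let $X,Y,W$ be i.i.d. draws from the attribute distribution $\pi_X$, independent of the random skew-symmetric function $\mathcal{F}$. The variance and the shared-endpoint correlation are $$\sigma^2=\mathbb{E}_{\mathcal{F}}\left[\mathrm{Var}_{X,Y}(\mathcal{F}(X,Y)\mid\mathcal{F})\right],\qquad \rho=\frac{1}{\sigma^2}\,\mathbb{E}_{\mathcal{F}}\left[\mathrm{Cov}_{X,Y,W}(\mathcal{F}(X,Y),\mathcal{F}(X,W)\mid\mathcal{F})\right].$$ The Mat\'ern function is $$h_{\mathrm{Mat}}(s;\ell,\nu)=\frac{2^{1-\nu}}{\Gamma(\nu)}\left(\frac{\sqrt{2\nu}\,s}{\ell}\right)^{\nu}K_\nu\left(\frac{\sqrt{2\nu}\,s}{\ell}\right)\quad(s>0),\qquad h_{\mathrm{Mat}}(0;\ell,\nu)=1,$$ with $K_\nu$ the modified Bessel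 function of the second kind. The distribution $\mathrm{Gamma}^{-1}(\nu,\nu)$ has density $\frac{\nu^\nu}{\Gamma(\nu)}v^{-(\nu+1)}e^{-\nu/v}$ on $(0,\infty)$. The relation $f(r)\simeq g(r)$ means $f(r)/g(r)\to1$ as $r\to0$. In each displayed line, the final expression states that the quantity on the far left equals the given constant up to an error of the given order; the quantity depends only on $r,\nu,T$, with $\nu,T$ fixed. *)

(* Defs.v *)
From HB Require Import structures.
From mathcomp Require Import all_boot all_order all_algebra.
From mathcomp Require Import all_classical all_reals all_analysis.

Set Implicit Arguments.
Unset Strict Implicit.
Unset Printing Implicit Defensive.

Import Order.TTheory GRing.Theory Num.Theory.
Import numFieldNormedType.Exports.

Local Open Scope classical_set_scope.
Local Open Scope ring_scope.

Definition gamma_fun {R : realType} (nu : R) : R :=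
  \int[lebesgue_measure]_(t in `]0, +oo[) (t `^ (nu - 1) * expR (- t)).

Definition cosh {R : realType} (t : R) : R := (expR t + expR (- t)) / 2.

(* Modified Bessel function of the second kind, for z > 0:
   K_nu(z) = \int_0^oo exp(- z cosh t) cosh(nu t) dt. *)
Definition besselK {R : realType} (nu z : R) : R :=
  \int[lebesgue_measure]_(t in `]0, +oo[) (expR (- (z * cosh t)) * cosh (nu * t)).

Definition matern {R : realType} (s ell nu : R) : R :=
  if s == 0 then 1 else
  2 `^ (1 - nu) / gamma_fun nu
  * (Num.sqrt (2 * nu) * s / ell) `^ nu
  * besselK nu (Num.sqrt (2 * nu) * s / ell).

Definition inv_gamma_density {R : realType} (a b v : R) : R :=
  b `^ a / gamma_fun a * v `^ (- (a + 1)) * expR (- (b / v)).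

(* The density lives on (0, +oo) only. *)
Definition has_inv_gamma_law {R : realType} {d} {Omega : measurableType d}
    (P : probability Omega R) (V : {RV P >-> R}) (a b : R) : Prop :=
  forall A : set R, measurable A ->
    distribution P V A =
    (\int[lebesgue_measure]_(v in A `&` `]0%R, +oo[) (inv_gamma_density a b v)%:E)%E.

(* Normal law with mean m and variance v, allowing the degenerate case v = 0
   (the library's normal_prob is parameterized by a nonzero standard deviation). *)
Definition normal_law {R : realType} (m v : R) : set R -> \bar R :=
  if v == 0 then \d_m else normal_prob m (Num.sqrt v).

(* Every finite linear combination is normal, with the mean and the variance
   dictated by the mean function m and the covariance function k. *)
Definition gaussian_process {R : realType} {d} {Omega : measurableType d}
    (P : probability Omega R) {S : Type} (U : S -> Omega -> R)
    (m : S -> R) (k : S -> S -> R) : Prop :=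
  (forall s, measurable_fun setT (U s)) /\
  forall (n : nat) (s : 'I_n -> S) (a : 'I_n -> R) (A : set R), measurable A ->
    P ((fun w => \sum_(i < n) a i * U (s i) w) @^-1` A) =
    normal_law (\sum_(i < n) a i * m (s i))
      (\sum_(i < n) \sum_(j < n) a i * a j * k (s i) (s j)) A.

(* R^T is T.-tuple R, with the sigma-algebra generated by the coordinates. *)

(* N(mu, s2 I) on R^T: the coordinates are jointly Gaussian. *)
Definition isotropic_gaussian {R : realType} {T : nat}
    (piX : probability (T.-tuple R) R) (mu : 'I_T -> R) (s2 : R) : Prop :=
  gaussian_process piX (fun (i : 'I_T) (x : T.-tuple R) => tnth x i) mu
    (fun i j => if i == j then s2 else 0).

(* The Euclidean norm of the concatenated vector [x - v, y - w] in R^(2T). *)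
Definition pair_dist {R : realType} {T : nat}
    (p q : T.-tuple R * T.-tuple R) : R :=
  Num.sqrt (\sum_(i < T) (tnth p.1 i - tnth q.1 i) ^+ 2
          + \sum_(i < T) (tnth p.2 i - tnth q.2 i) ^+ 2).

Definition matern_kernel {R : realType} (T : nat) (sigma_u ell nu : R)
    (p q : T.-tuple R * T.-tuple R) : R :=
  sigma_u ^+ 2 * matern (pair_dist p q) ell nu.

Definition skew_field {R : realType} {X Omega : Type} (U : X * X -> Omega -> R)
  (x y : X) (w : Omega) : R := U (x, y) w - U (y, x) w.

Section correlation.
Context {R : realType} {d d'} {Omega : measurableType d} {X : measurableType d'}.
Variables (P : probability Omega R) (piX : probability X R).
Variable (F : X -> X -> Omega -> R).
Local Open Scope ereal_scope.

(* The attributes are independent of the random function F, so conditioning on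
   F is the same as freezing w and integrating over the i.i.d. attributes. *)
Definition cond_variance (w : Omega) : \bar R :=
  variance (piX \x piX) (fun z : X * X => F z.1 z.2 w).

Definition cond_covariance (w : Omega) : \bar R :=
  covariance (piX \x (piX \x piX))
    (fun z : X * (X * X) => F z.1 z.2.1 w) (fun z : X * (X * X) => F z.1 z.2.2 w).

Definition total_variance : R := fine (\int[P]_w cond_variance w).

Definition shared_endpoint_correlation : R :=
  (fine (\int[P]_w cond_covariance w) / total_variance)%R.

End correlation.

Definition rho_lower {R : realType} {d} {Omega : measurableType d}
    (P : probability Omega R) (V : {RV P >-> R}) (T : nat) (r : R) : R :=
  let M (c : R) :=
    fine ('E_P[(fun w => (1 + c * r ^+ 2 * V w) `^ (- (T%:R / 2)))%R])%E in
  (M 2 - M 4) / (1 - M 4).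

(* The scale parameter is positive, hence the one-sided limit at 0. *)
Definition asymp_sim {R : realType} (f g : R -> R) : Prop :=
  (fun r => f r / g r) @ 0^'+ --> (1 : R).

Definition log2 {R : realType} (x : R) : R := ln x / ln 2.

(* Main.v *)
Require Import Defs.
From HB Require Import structures.
From mathcomp Require Import all_boot all_order all_algebra.
From mathcomp Require Import all_classical all_reals all_analysis.
From mathcomp Require Import measurable_realfun ring lra.

Set Implicit Arguments.
Unset Strict Implicit.
Unset Printing Implicit Defensive.

Import Order.TTheory GRing.Theory Num.Theory.
Import numFieldNormedType.Exports.

Local Open Scope classical_set_scope.
Local Open Scope ring_scope.

(* The Matern kernel is a scale mixture of Gaussian ones: writing V = exp t, the
   Bessel integral gives h_Mat(s; ell, nu) = E[exp(- s^2 V / (2 ell^2))] with V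
   inverse gamma. Gaussian integrals over the attributes then yield, with
   x = r^2 and p(y) = (1 + y)^(-T/2),
     sigma^2 = 2 sigma_u^2 (1 - E[p(4xV)]),
     rho = (E[p(2xV)] - E[p(3xV) p(xV)]) / (1 - E[p(4xV)]).
   Since (1 + 3y)(1 + y) > 1 + 4y, rho exceeds rho tilde.

   The numerators of rho tilde - 1/2 and of rho - rho tilde are expectations of
   second-order differences of p, hence O(E[min(1, (xV)^2)]), while the
   denominator B(4x) = 1 - E[p(4xV)] is bounded below by x, x ln(1/x) or x^nu,
   according to the tail of V. This gives the rates for nu >= 1. For nu < 1,
   B(x) = L x^nu + O(x), and rho tilde = 1 - B(2x) / B(4x).

   The corrections in brackets tend to 0, so each equivalence only needs the
   limits of its two sides. *)

(** The attribute law is known only through the laws of linear combinations of coordinates, and no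
    density on R^T is at hand. Every Gaussian integral is therefore derived from one-dimensional
    cosine integrals: Stein's identity gives the characteristic function of the standard normal, and
    [exp (- a z^2 / 2)] is itself an average of cosines. Centering is an issue too, since the
    integrability of a frozen path of the field is not known beforehand; skew-symmetry makes the
    positive and negative parts have equal integrals, which settles the conditional mean even if
    both are infinite. The mixing variable is handled through [t = ln V]: multiplying [V] by [x]
    translates [t] by [ln x], so powers of [x] come out of integrals over the line by translation.
    The three lower bounds on [B] come from three ranges of [V]: of order 1 (giving [x]), of order
    [1/x] (giving [x^nu]), and everything in between, where for [nu = 1] each unit of [t]
    contributes equally (giving [x ln (1/x)]). *)

Section density.
Context {R : realType}.
Notation leb := (@lebesgue_measure R).
Variable q : R -> R.
Hypothesis q_ge0 : forall x, 0 <= q x.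
Hypothesis mq : measurable_fun setT q.

(** [P] is absolutely continuous with respect to [leb], and its Radon-Nikodym derivative agrees with
    [q] almost everywhere because both have the same integral over every measurable set. *)
Lemma integral_density (P : {finite_measure set (measurableTypeR R) -> \bar R})
    (f : R -> \bar R) :
  (forall A, measurable A -> P A = \int[leb]_(x in A) (q x)%:E)%E ->
  measurable_fun [set: R] f -> (forall x, 0 <= f x)%E ->
  (\int[P]_x f x = \int[leb]_x (f x * (q x)%:E))%E.
Proof.
move=> Pq mf f0.
have dom : P `<< leb.
  apply/null_content_dominatesP => A mA A0; rewrite Pq//.
  by apply: null_set_integral => //; exact/measurable_EFinP/measurable_funTS.
rewrite -(Radon_Nikodym_SigmaFinite.change_of_variables dom)//.
apply: ae_eq_integral => //.
- apply: emeasurable_funM => //.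
  by apply: (measurable_int leb); exact: Radon_Nikodym_SigmaFinite.f_integrable.
- by apply: emeasurable_funM => //; exact/measurable_EFinP.
- apply: ae_eqe_mul2l => /=.
  apply: integral_ae_eq => //.
  + exact: Radon_Nikodym_SigmaFinite.f_integrable.
  + exact/measurable_EFinP.
  + by move=> E _ mE; rewrite -Radon_Nikodym_SigmaFinite.f_integral// Pq.
Qed.

Lemma density_probability : (\int[leb]_x (q x)%:E = 1)%E ->
  exists P : probability (measurableTypeR R) R,
    forall A, measurable A -> (P A = \int[leb]_(x in A) (q x)%:E)%E.
Proof.
move=> q1.
pose m := fun A : set (measurableTypeR R) => (\int[leb]_(x in A) (q x)%:E)%E.
have m0 : m set0 = 0%E by rewrite /m integral_set0.
have mge0 A : (0 <= m A)%E by apply: integral_ge0 => x _; rewrite lee_fin.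
have ms : semi_sigma_additive m.
  move=> F mF tF mUF; rewrite /m; apply: cvg_toP.
    apply: ereal_nondecreasing_is_cvgn => i j ij.
    apply: lee_sum_nneg_natr => // k _ _; exact: mge0.
  rewrite ge0_integral_bigcup//=.
  - exact/measurable_EFinP/measurable_funTS.
  - by move=> x _; rewrite lee_fin.
pose m' := isMeasure.Build _ _ _ m m0 mge0 ms.
pose M : measure (measurableTypeR R) R := HB.pack m m'.
pose p' := @Measure_isProbability.Build _ _ R M q1.
pose P : probability (measurableTypeR R) R := HB.pack m m' p'.
by exists P.
Qed.

End density.

(** * Substitutions in Lebesgue integrals *)

Section lebesgue_substitution.
Context {R : realType}.
Notation leb := (@lebesgue_measure R).

(** The translated measure gives half-open intervals the same length, and this characterizes
    Lebesgue measure. *)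
Lemma lebesgue_measureD (a : R) (A : set R) : measurable A ->
  pushforward leb (fun x : measurableTypeR R => x + a : measurableTypeR R) A = leb A.
Proof.
move=> mA.
have mD : measurable_fun [set: measurableTypeR R] (fun x : measurableTypeR R => x + a : measurableTypeR R).
  exact: measurable_funD.
pose fD : {mfun measurableTypeR R >-> measurableTypeR R} := HB.pack (fun x : measurableTypeR R => x + a : measurableTypeR R) (isMeasurableFun.Build _ _ _ _ _ mD).
apply/esym.
apply: (@lebesgue_measure_unique _ (pushforward leb fD)) => //= _ [[b c]] _ <-.
rewrite /pushforward/= (_ : _ @^-1` _ = `](b - a)%R, (c - a)%R]%classic).
  rewrite !lebesgue_measure_itv/= !lte_fin ltrD2r.
  by case: ifPn => // _; congr (_%:E); ring.
by apply/seteqP; split => x /=; rewrite !in_itv/= ltrBlDr lerBrDr.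
Qed.

Lemma ge0_integral_shift (a : R) (f : R -> \bar R) :
  measurable_fun setT f -> (forall x, 0 <= f x)%E ->
  (\int[leb]_x f (x + a)%R = \int[leb]_x f x)%E.
Proof.
move=> mf f0.
have mD : measurable_fun [set: measurableTypeR R] (fun x : measurableTypeR R => x + a : measurableTypeR R).
  exact: measurable_funD.
have := @ge0_integral_pushforward _ _ _ _ _ _ mD leb setT f measurableT mf
   (fun y _ => f0 y).
rewrite preimage_setT => <-.
by apply: eq_measure_integral => //= A mA _; exact: lebesgue_measureD.
Qed.

Lemma ge0_integral_oppr (f : R -> \bar R) :
  measurable_fun setT f -> (forall x, 0 <= f x)%E ->
  (\int[leb]_x f (- x)%R = \int[leb]_x f x)%E.
Proof.
move=> mf f0.
have mN : measurable_fun [set: measurableTypeR R] (-%R : _ -> measurableTypeR R).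
  exact: oppr_measurable.
have := @ge0_integral_pushforward _ _ _ _ _ _ mN leb setT f measurableT mf
   (fun y _ => f0 y).
rewrite preimage_setT => <-.
by apply: eq_measure_integral => //= A mA _; exact: lebesgue_measureN.
Qed.

(** Substitution on the compact intervals [E n] and [I n], then monotone convergence on both sides.
    This is the passage from [V] to [ln V]. *)
Lemma ge0_integral_expR_subst (f : R -> R) :
  (forall x, 0 < x -> {for x, continuous f}) -> (forall x, 0 < x -> 0 <= f x) ->
  (\int[leb]_(x in `]0%R, +oo[) (f x)%:E =
   \int[leb]_t (f (expR t) * expR t)%:E)%E.
Proof.
move=> cf f0.
pose E n : set R := `[expR (- n%:R), expR n%:R]%classic.
pose I n : set R := `[- (n%:R : R), n%:R]%classic.
have EU : `]0%R, +oo[%classic = \bigcup_n E n :> set R.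
  apply/seteqP; split => [x/=|x [n _]/=]; rewrite !in_itv/= ?andbT; last first.
    rewrite /E/= in_itv/= => /andP[h _]; apply: (lt_le_trans _ h); exact: expR_gt0.
  move=> x0; have [n xn] : exists n : nat, `|ln x| <= n%:R.
    exists (Num.bound `|ln x|); apply: ltW; exact: archi_boundP.
  exists n => //; rewrite /E/= in_itv/= -[X in _ <= X <= _](lnK (x := x))// !ler_expR.
  by rewrite -ler_norml.
have IU : setT = \bigcup_n I n.
  apply/seteqP; split => // x _.
  exists (Num.bound `|x|) => //; rewrite /I/= in_itv/= -ler_norml.
  apply: ltW; exact: archi_boundP.
have mf n : measurable_fun (E n) f.
  apply: (@subspace_continuous_measurable_fun _ _ _ (measurable_itv _)).
  apply: continuous_in_subspaceT => x; rewrite inE/= in_itv/= => /andP[x0 _].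
  apply: cf; apply: (lt_le_trans _ x0); exact: expR_gt0.
have mg : measurable_fun setT (fun t => f (expR t) * expR t).
  apply: continuous_measurable_fun => t; apply: cvgM; last exact: continuous_expR.
  apply: (continuous_comp (f := expR)); first exact: continuous_expR.
  by apply: cf; exact: expR_gt0.
have Esub m n : (m <= n)%N -> (E m `<=` E n).
  move=> mn x; rewrite /E/= !in_itv/= => /andP[a b]; apply/andP; split.
    by apply: le_trans a; rewrite ler_expR lerN2 ler_nat.
  by apply: le_trans b _; rewrite ler_expR ler_nat.
have Isub m n : (m <= n)%N -> (I m `<=` I n).
  move=> mn x; rewrite /I/= !in_itv/= => /andP[a b]; apply/andP; split.
    by apply: le_trans a; rewrite lerN2 ler_nat.
  by apply: le_trans b _; rewrite ler_nat.
have h1 : (\int[leb]_(x in E n) (f x)%:E)%E @[n --> \oo] -->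
    (\int[leb]_(x in \bigcup_n E n) (f x)%:E)%E.
  apply: ge0_nondecreasing_set_cvg_integral.
  - by move=> m n mn; rewrite subsetEset; exact: Esub.
  - by move=> n; rewrite /E; exact: measurable_itv.
  - by move=> n; apply/measurable_EFinP; exact: mf.
  - move=> n x; rewrite /E/= in_itv/= => /andP[x0 _]; rewrite lee_fin.
    by apply: f0; apply: (lt_le_trans _ x0); exact: expR_gt0.
have h2 : (\int[leb]_(t in I n) (f (expR t) * expR t)%:E)%E @[n --> \oo] -->
    (\int[leb]_(t in \bigcup_n I n) (f (expR t) * expR t)%:E)%E.
  apply: ge0_nondecreasing_set_cvg_integral.
  - by move=> m n mn; rewrite subsetEset; exact: Isub.
  - by move=> n; rewrite /I; exact: measurable_itv.
  - by move=> n; apply/measurable_EFinP; exact: measurable_funTS.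
  - by move=> n x _; rewrite lee_fin mulr_ge0 ?expR_ge0// f0// expR_gt0.
rewrite EU IU.
apply: (cvg_unique _ h1) => //; apply: cvg_trans h2; apply: near_eq_cvg.
have dexp : ((@expR R)^`())%classic = expR.
  by apply/funext => x; rewrite derive1E derive_val.
near=> n.
rewrite /E (@integration_by_substitution_increasing _ expR)//.
- by apply: eq_integral => x _; rewrite dexp.
- by rewrite ge0_cp.
- by move=> x y _ _; rewrite ltr_expR.
- by rewrite dexp => x _; exact: continuous_expR.
- by rewrite dexp; apply/cvg_ex; eexists; apply: cvg_at_right_filter; exact: continuous_expR.
- by rewrite dexp; apply/cvg_ex; eexists; apply: cvg_at_left_filter; exact: continuous_expR.
- split => [x _||]; first exact: derivable_expR.
    by apply: cvg_at_right_filter; exact: continuous_expR.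
  by apply: cvg_at_left_filter; exact: continuous_expR.
- apply: continuous_in_subspaceT => x; rewrite inE/= in_itv/= => /andP[x0 _].
  by apply: cf; apply: (lt_le_trans _ x0); exact: expR_gt0.
Unshelve. all: end_near. Qed.

(** Half of the integral is [1/b] times the total mass of the exponential law. These two-sided
    exponentials dominate the integrands met in the variable [t]. *)
Lemma integral_expR_abs_lty (b : R) : 0 < b ->
  (\int[leb]_x (expR (- (b * `|x|)))%:E < +oo)%E.
Proof.
move=> b0.
rewrite ge0_symfun_integralT; first last.
- by move=> x /=; rewrite normrN.
- move=> x; apply: (continuous_comp (f := fun x => - (b * `|x|)) (g := expR)).
    apply: (@continuousN _ R^o); apply: continuousM; first exact: cst_continuous.
    exact: norm_continuous.
  exact: continuous_expR.
- by move=> x; exact: expR_ge0.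
rewrite -set_itvcy.
rewrite (_ : (\int[leb]_(x in _) _ = (b^-1)%:E)%E) -?EFinM ?ltry//.
have h := integral_exponential_pdf b0.
transitivity (\int[leb]_(x in `[0%R, +oo[) ((b^-1)%:E * (exponential_pdf b x)%:E))%E.
  apply: eq_integral => x; rewrite inE/= in_itv/= andbT => x0.
  rewrite exponential_pdfE// ger0_norm// -EFinM mulrA mulVf ?gt_eqF// mul1r.
  by rewrite mulNr.
rewrite ge0_integralZl//=; first last.
- by rewrite lee_fin invr_ge0 ltW.
- by move=> x _; rewrite lee_fin exponential_pdf_ge0// ltW.
- by apply/measurable_EFinP/measurable_funTS; exact: measurable_exponential_pdf.
rewrite [X in (_ * X)%E](_ : _ = 1%E) ?mule1//.
rewrite -h integral_mkcond; apply: eq_integral => x _; rewrite patchE.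
case: ifPn => // /negP; rewrite inE/= in_itv/= andbT => /negP; rewrite -ltNge => x0.
by rewrite lt0_exponential_pdf.
Qed.

End lebesgue_substitution.

(** * Bounded measurable functions *)

(** A class closed under the ring operations and integrable for every probability: integrals can be
    split and exchanged in [R] rather than in the extended reals. *)
Definition bounded_measurable {d} {T : measurableType d} {R : realType}
  (f : T -> R) := measurable_fun setT f /\ exists M, forall x, `|f x| <= M.

Section bounded_measurable.
Context {d} {T : measurableType d} {R : realType}.
Implicit Types f g : T -> R.

Lemma bm_measurable f : bounded_measurable f -> measurable_fun setT f.
Proof. by case. Qed.

Lemma bm_cst (c : R) : bounded_measurable (fun _ : T => c).
Proof. by split; [exact: measurable_cst|exists `|c|]. Qed.

Lemma bmD f g : bounded_measurable f -> bounded_measurable g ->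
  bounded_measurable (fun x => f x + g x).
Proof.
move=> [mf [M fM]] [mg [N gN]]; split; first exact: measurable_funD.
by exists (M + N) => x; rewrite (le_trans (ler_normD _ _))// lerD.
Qed.

Lemma bmM f g : bounded_measurable f -> bounded_measurable g ->
  bounded_measurable (fun x => f x * g x).
Proof.
move=> [mf [M fM]] [mg [N gN]]; split; first exact: measurable_funM.
by exists (M * N) => x; rewrite normrM ler_pM.
Qed.

Lemma bmN f : bounded_measurable f -> bounded_measurable (fun x => - f x).
Proof.
move=> [mf [M fM]]; split; first exact: measurableT_comp.
by exists M => x; rewrite normrN.
Qed.

Lemma bmB f g : bounded_measurable f -> bounded_measurable g ->
  bounded_measurable (fun x => f x - g x).
Proof. by move=> ? /bmN; exact: bmD. Qed.

Lemma bm_comp (h : R -> R) f : bounded_measurable h -> measurable_fun setT f ->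
  bounded_measurable (fun x => h (f x)).
Proof.
move=> [mh [M hM]] mf; split; first exact: measurableT_comp.
by exists M => x.
Qed.

Lemma bm_expRN f : measurable_fun setT f -> (forall x, 0 <= f x) ->
  bounded_measurable (fun x => expR (- f x)).
Proof.
move=> mf f0; split; first by do 2 apply: measurableT_comp => //.
by exists 1 => x; rewrite ger0_norm ?expR_ge0// expR_le1 oppr_le0.
Qed.

Lemma bm_integrable (P : probability T R) f : bounded_measurable f ->
  P.-integrable setT (EFin \o f).
Proof.
move=> [mf [M fM]]; apply: measurable_bounded_integrable => //.
  by rewrite -ge0_fin_numE// fin_num_measure.
by exists M; split; [exact: num_real|move=> N MN x _ /=; rewrite (le_trans (fM x))// ltW].
Qed.

Lemma bm_EFin_Rintegral (P : probability T R) f : bounded_measurable f ->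
  (\int[P]_x (f x)%:E)%E = (\int[P]_x f x)%R%:E.
Proof.
by move=> bf; rewrite /Rintegral fineK//; apply: integrable_fin_num => //; exact: bm_integrable.
Qed.

Lemma bm_RintegralD (P : probability T R) f g : bounded_measurable f -> bounded_measurable g ->
  \int[P]_x (f x + g x) = \int[P]_x f x + \int[P]_x g x.
Proof. by move=> bf bg; rewrite RintegralD//; exact: bm_integrable. Qed.

Lemma bm_RintegralB (P : probability T R) f g : bounded_measurable f -> bounded_measurable g ->
  \int[P]_x (f x - g x) = \int[P]_x f x - \int[P]_x g x.
Proof. by move=> bf bg; rewrite RintegralB//; exact: bm_integrable. Qed.

Lemma bm_RintegralZ (P : probability T R) f c : bounded_measurable f ->
  \int[P]_x (c * f x) = c * \int[P]_x f x.
Proof. by move=> bf; rewrite RintegralZl//; exact: bm_integrable. Qed.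

Lemma bm_Rintegral_cst (P : probability T R) (c : R) : \int[P]_x c = c.
Proof. by rewrite Rintegral_cst// [X in fine X](probability_setT P) mulr1. Qed.

Lemma bm_le_Rintegral (P : probability T R) f g : bounded_measurable f -> bounded_measurable g ->
  (forall x, f x <= g x) -> \int[P]_x f x <= \int[P]_x g x.
Proof. by move=> bf bg fg; apply: le_Rintegral => //; exact: bm_integrable. Qed.

End bounded_measurable.

Section bounded_fubini.
Context {d1 d2} {T1 : measurableType d1} {T2 : measurableType d2} {R : realType}.
Variables (P1 : probability T1 R) (P2 : probability T2 R).
Variable f : T1 * T2 -> R.
Hypothesis bf : bounded_measurable f.

Lemma bm_pair1 x : bounded_measurable (fun y => f (x, y)).
Proof.
have [mf [M fM]] := bf; split; last by exists M.
by apply: measurableT_comp => //; exact: pair1_measurable.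
Qed.

Lemma bm_pair2 y : bounded_measurable (fun x => f (x, y)).
Proof.
have [mf [M fM]] := bf; split; last by exists M.
by apply: measurableT_comp => //; exact: pair2_measurable.
Qed.

Lemma bm_Rintegral_pair1 : bounded_measurable (fun x => \int[P2]_y f (x, y)).
Proof.
have [mf [M fM]] := bf; split.
  have h : measurable_fun setT (fubini_F P2 (EFin \o f)).
    exact: (measurable_fubini_F (m1 := P1) (bm_integrable (P1 \x P2)%E bf)).
  by apply: (measurableT_comp _ h).
exists M => x; rewrite ler_norml; apply/andP; split.
  rewrite -[leLHS](bm_Rintegral_cst P2); apply: bm_le_Rintegral; [exact: bm_cst|exact: bm_pair1|].
  by move=> y; have := fM (x, y); rewrite ler_norml => /andP[].
rewrite -[leRHS](bm_Rintegral_cst P2); apply: bm_le_Rintegral; [exact: bm_pair1|exact: bm_cst|].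
by move=> y; have := fM (x, y); rewrite ler_norml => /andP[].
Qed.

Lemma bm_Rintegral_prod1 :
  \int[(P1 \x P2)%E]_z f z = \int[P1]_x \int[P2]_y f (x, y).
Proof.
rewrite /Rintegral; congr fine.
rewrite -(integral12_prod_meas1 (bm_integrable (P1 \x P2)%E bf)).
apply: eq_integral => x _; rewrite /fubini_F.
by rewrite -[in RHS]/(Rintegral P2 setT (fun y => f (x, y))) -bm_EFin_Rintegral//; exact: bm_pair1.
Qed.

Lemma bm_Rintegral_prod2 :
  \int[(P1 \x P2)%E]_z f z = \int[P2]_y \int[P1]_x f (x, y).
Proof.
rewrite /Rintegral; congr fine.
rewrite -(integral21_prod_meas1 (bm_integrable (P1 \x P2)%E bf)).
apply: eq_integral => x _; rewrite /fubini_G.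
by rewrite -[in RHS]/(Rintegral P1 setT (fun y => f (y, x))) -bm_EFin_Rintegral//; exact: bm_pair2.
Qed.

End bounded_fubini.

(** * Normal laws *)

Section standard_normal.
Context {R : realType}.
Notation leb := (@lebesgue_measure R).
Notation gam := (@normal_prob R 0 1).

Lemma ge0_integral_normal_prob (m s : R) (f : R -> \bar R) :
  measurable_fun setT f -> (forall x, 0 <= f x)%E ->
  (\int[normal_prob m s]_x f x = \int[leb]_x (f x * (normal_pdf m s x)%:E))%E.
Proof.
move=> mf f0.
apply: (@integral_density R (normal_pdf m s)) => //; exact: measurable_normal_pdf.
Qed.

Lemma normal_pdf01E (x : R) :
  normal_pdf 0 1 x = normal_peak 1 * expR (- (x ^+ 2 / 2)).
Proof.
rewrite normal_pdfE ?oner_neq0// /normal_fun subr0 expr1n.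
by rewrite mulNr.
Qed.

(** With [y = |x|], this is [- y^2 / 2 + 2 y <= 2], that is [(y - 2)^2 >= 0]. It makes growth of
    order [expR |x|] harmless against the normal density. *)
Lemma normal_pdf01_le (x : R) :
  normal_pdf 0 1 x * expR `|x| <= normal_peak 1 * expR 2 * expR (- `|x|).
Proof.
rewrite normal_pdf01E -2!mulrA ler_wpM2l ?normal_peak_ge0// -!expRD ler_expR.
rewrite -(real_normK (num_real x)); set y := `|x|; have := sqr_ge0 (y - 2); nra.
Qed.

Lemma integrable_expR_abs : leb.-integrable setT
  (fun x : R => (normal_peak 1 * expR 2 * expR (- `|x|))%:E).
Proof.
have ha : measurable_fun setT (fun x : R => expR (- `|x|)).
  by do 3 apply: measurableT_comp => //.
apply/integrableP; split.
  by apply/measurable_EFinP; apply: measurable_funM.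
under eq_integral => x _.
  rewrite gee0_abs ?lee_fin ?mulr_ge0 ?expR_ge0 ?normal_peak_ge0//.
  rewrite EFinM.
  over.
rewrite ge0_integralZl//=; first last.
- by rewrite lee_fin ?mulr_ge0 ?expR_ge0 ?normal_peak_ge0.
- exact/measurable_EFinP.
rewrite lte_mul_pinfty ?lee_fin ?mulr_ge0 ?expR_ge0 ?normal_peak_ge0//.
have := @integral_expR_abs_lty R 1 ltr01.
by under eq_integral do rewrite mul1r.
Qed.

Lemma integrable_normal_pdf01 (f : R -> R) (C : R) : measurable_fun setT f ->
  (forall x, `|f x| <= C * expR `|x|) ->
  leb.-integrable setT (fun x => (f x * normal_pdf 0 1 x)%:E).
Proof.
move=> mf fC.
have C0 : 0 <= C.
  by have := fC 0; rewrite normr0 expR0 mulr1; apply: le_trans.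
apply: (@le_integrable _ _ _ leb setT measurableT _ (fun x => (C%:E * (normal_peak 1 * expR 2 * expR (- `|x|))%:E)%E)) => //.
- by apply/measurable_EFinP; apply: measurable_funM => //; exact: measurable_normal_pdf.
- move=> x _; rewrite -EFinM lee_fin [leRHS]ger0_norm; last first.
    by rewrite !mulr_ge0 ?expR_ge0 ?normal_peak_ge0.
  rewrite normrM (ger0_norm (normal_pdf_ge0 _ _ _)).
  apply: (@le_trans _ _ (C * expR `|x| * normal_pdf 0 1 x)).
    by rewrite ler_wpM2r// normal_pdf_ge0.
  by rewrite -mulrA ler_wpM2l// mulrC normal_pdf01_le.
- by apply: integrableZl => //; exact: integrable_expR_abs.
Qed.

Lemma normal01_integrable (f : R -> R) (C : R) : measurable_fun setT f ->
  (forall x, `|f x| <= C * expR `|x|) -> gam.-integrable setT (EFin \o f).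
Proof.
move=> mf fC; apply/integrableP; split; first exact/measurable_EFinP.
rewrite ge0_integral_normal_prob//; last first.
  by apply/measurable_EFinP; exact: measurableT_comp.
have /integrableP[_] := integrable_normal_pdf01 mf fC.
congr (_ < _)%E; apply: eq_integral => x _.
by rewrite /= normrM EFinM (ger0_norm (normal_pdf_ge0 _ _ _)).
Qed.

Lemma Rintegral_normal01 (f : R -> R) (C : R) : measurable_fun setT f ->
  (forall x, `|f x| <= C * expR `|x|) ->
  \int[gam]_x f x = \int[leb]_x (f x * normal_pdf 0 1 x).
Proof.
move=> mf fC; rewrite /Rintegral; congr fine.
rewrite integralE [in RHS]integralE.
rewrite !ge0_integral_normal_prob//; first last.
- by apply: measurable_funepos; exact/measurable_EFinP.
- by apply: measurable_funeneg; exact/measurable_EFinP.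
congr (_ - _)%E; apply: eq_integral => x _.
  rewrite !funeposE -!EFin_max -EFinM maxr_pMl ?mul0r//.
  exact: normal_pdf_ge0.
rewrite !funenegE -!EFinN -!EFin_max -EFinM maxr_pMl ?mul0r ?mulNr//.
exact: normal_pdf_ge0.
Qed.

Lemma is_derive_normal_pdf01 (x : R) :
  is_derive x 1 (@normal_pdf R 0 1) (- x * normal_pdf 0 1 x).
Proof.
rewrite (_ : normal_pdf 0 1 = (fun x => normal_peak 1 * expR (- (x ^+ 2 / 2)))); last first.
  by apply/funext => y; exact: normal_pdf01E.
apply: is_derive_eq.
rewrite /= !scaler1; rewrite /GRing.scale/=.
by field.
Qed.

(** Stein's identity: the integrand times the density [phi] is the derivative of [u * phi], which
    vanishes at both infinities. The growth bounds justify passing from symmetric intervals to the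
    whole line by dominated convergence. *)
Lemma stein (u u' : R -> R) (C : R) :
  (forall x : R, is_derive x (1 : R) u (u' x)) -> continuous u' ->
  (forall x, `|u x| <= C * expR `|x|) ->
  (forall x, `|u' x - x * u x| <= C * expR `|x|) ->
  \int[gam]_x (u' x - x * u x) = 0.
Proof.
move=> du cu' uC hC.
pose phi := @normal_pdf R 0 1.
have cphi : continuous phi.
  by apply: continuous_normal_pdf; exact: oner_neq0.
have cu : continuous u.
  move=> x; apply/differentiable_continuous/derivable1_diffP.
  by have := du x => -[].
have ch : continuous (fun x => u' x - x * u x).
  move=> x; apply: cvgB; first exact: cu'.
  by apply: cvgM; [exact: cvg_id|exact: cu].
have mh : measurable_fun setT (fun x => u' x - x * u x).
  exact: continuous_measurable_fun.
rewrite (Rintegral_normal01 mh hC) /Rintegral.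
(* The successor keeps the interval nondegenerate, as the fundamental theorem of calculus
   requires. *)
pose I n : set R := `[- (n.+1%:R : R), n.+1%:R]%classic.
pose h x := (u' x - x * u x) * phi x.
pose H x := u x * phi x.
have cch : continuous h.
  by move=> x; apply: cvgM; [exact: ch|exact: cphi].
have mhphi : measurable_fun setT h by exact: continuous_measurable_fun.
have dH x : is_derive x (1 : R) H (h x).
  have := is_derive_normal_pdf01 x; have := du x => du' dp.
  by apply: is_derive_eq; rewrite /h /GRing.scale/= -/phi; ring.
have C0 : 0 <= C.
  by have := uC 0; rewrite normr0 expR0 mulr1; apply: le_trans.
have l1 : (\int[leb]_x (h x * \1_(I n) x)%:E)%E @[n --> \oo] --> (\int[leb]_x (h x)%:E)%E.
  have ih := integrable_normal_pdf01 mh hC.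
  apply: (@dominated_cvg _ _ _ leb setT measurableT _ _ (fun x => `|h x|%:E)) => //.
  - move=> n; apply/measurable_EFinP; apply: measurable_funM => //; apply: measurable_indic; rewrite /I; exact: measurable_itv.
  - move=> x _; apply: cvg_near_cst; near=> n.
    rewrite indicE mem_set ?mulr1// /I/= in_itv/= -ler_norml.
    apply: ltW; apply: lt_le_trans (archi_boundP (normr_ge0 x)) _.
    by rewrite ler_nat ltnW// ltnS; near: n; exact: nbhs_infty_ge.
  - by apply: (integrable_abse ih).
  - move=> n x _; rewrite abse_EFin lee_fin normrM.
    rewrite ler_piMr// indicE; case: (_ \in _); by rewrite ?normr1 ?normr0.
have l2 : (\int[leb]_x (h x * \1_(I n) x)%:E)%E @[n --> \oo] --> 0%E.
  rewrite (_ : (fun n => _) = (fun n => (H n.+1%:R - H (- n.+1%:R))%:E)); last first.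
    apply/funext => n.
    transitivity (\int[leb]_(x in I n) (h x)%:E)%E.
      rewrite [RHS]integral_mkcond; apply: eq_integral => x _.
      rewrite patchE indicE; case: ifPn => _; by rewrite ?mulr1 ?mulr0.
    have dd x : derivable H x 1 by have := dH x => -[].
    have cH : continuous H.
      by move=> x; exact/differentiable_continuous/derivable1_diffP.
    rewrite /I (@continuous_FTC2 _ h H)//.
    - by rewrite gtrN.
    - by apply: continuous_subspaceT.
    - split=> [x _||]; first exact: dd.
      + by apply: cvg_at_right_filter; exact: cH.
      + by apply: cvg_at_left_filter; exact: cH.
    - by move=> x _; rewrite derive1E; have := dH x => -[].
  apply: cvg_EFin; first exact: nearW.
  apply: norm_cvg0.
  have Hb x : `|H x| <= C * (normal_peak 1 * expR 2) * expR (- `|x|).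
    rewrite /H normrM (ger0_norm (normal_pdf_ge0 _ _ _)).
    apply: (@le_trans _ _ (C * expR `|x| * phi x)).
      by rewrite ler_wpM2r// normal_pdf_ge0.
    by rewrite -!mulrA ler_wpM2l// mulrC mulrA normal_pdf01_le.
  apply: (@squeeze_cvgr _ _ _ _ (cst 0) (fun n => 2 * (C * (normal_peak 1 * expR 2)) * expR (- n.+1%:R))).
  - apply: nearW => n; rewrite normr_ge0/=.
    apply: le_trans (ler_normB _ _) _.
    apply: le_trans (lerD (Hb _) (Hb _)) _.
    by rewrite normrN ger0_norm//; lra.
  - exact: cvg_cst.
  - rewrite -[X in _ --> X](mulr0 (2 * (C * (normal_peak 1 * expR 2)))).
    apply: cvgM; first exact: cvg_cst.
    rewrite (_ : (fun n => _) = (fun n => expR (- (n.+1%:R : R)))) //.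
    have := @cvgn_expR R; rewrite -(cvg_shiftS (fun n => expR (- (n%:R : R)))).
    by [].
by rewrite (cvg_unique _ l1 l2).
Unshelve. all: end_near. Qed.

End standard_normal.

Section normal_moments.
Context {R : realType}.
Notation leb := (@lebesgue_measure R).
Notation gam := (@normal_prob R 0 1).

Lemma bm_cosD (t th : R) : bounded_measurable (fun x : R => cos (t * x + th)).
Proof.
apply: (@bm_comp _ _ _ cos).
  split; last by exists 1; exact: cos_max.
  by apply: continuous_measurable_fun; exact: continuous_cos.
by apply: measurable_funD => //; exact: measurable_funM.
Qed.

Lemma expR_ge1_abs (x : R) : 1 <= expR `|x|.
Proof. by rewrite -[leLHS]expR0 ler_expR. Qed.

Lemma expR_ge_abs (x : R) : `|x| <= expR `|x|.
Proof. by have := expR_ge1Dx `|x|; lra. Qed.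

Lemma normal01_integrable_abs : gam.-integrable setT (EFin \o (fun x : R => `|x|)).
Proof.
apply: (@normal01_integrable _ _ 1); first exact: measurableT_comp.
by move=> x; rewrite normr_id mul1r expR_ge_abs.
Qed.

(** The characteristic function, with a phase [th] so that cosine and sine are treated at once.
    Differentiating in [t] under the integral and applying Stein's identity to [u = sin (t x + th)]
    gives [phi' = - t phi]; hence [phi t * expR (t^2 / 2)] is constant, equal to its value [cos th]
    at 0. *)
Lemma normal01_cos (t th : R) :
  \int[gam]_x cos (t * x + th) = cos th * expR (- (t ^+ 2 / 2)).
Proof.
pose phi (t : R) := \int[gam]_x cos (t * x + th).
have dcos (t' x : R) : is_derive t' 1 (fun t => cos (t * x + th)) (- (x * sin (t' * x + th))).
  by apply: is_derive_eq; rewrite /GRing.scale/=; ring.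
have ei (a : R) : \int[gam]_x (- (x * sin (a * x + th))) = - a * phi a.
  have msin : measurable_fun setT (fun x : R => sin (a * x + th)).
    apply: continuous_measurable_fun => x; apply: (continuous_comp (f := fun x => a * x + th)); last exact: continuous_sin.
    by apply: cvgD; [apply: cvgM; [exact: cvg_cst|exact: cvg_id]|exact: cvg_cst].
  have := @stein R (fun x => sin (a * x + th)) (fun x => a * cos (a * x + th)) (`|a| + 1).
  have du (x : R) : is_derive x (1 : R) (fun x => sin (a * x + th)) (a * cos (a * x + th)).
    by apply: is_derive_eq; rewrite /GRing.scale/=; ring.
  move=> /(_ du) H.
  have c1 : continuous (fun x => a * cos (a * x + th)).
    move=> x; apply: cvgM; first exact: cvg_cst.
    apply: (continuous_comp (f := fun x => a * x + th)); last exact: continuous_cos.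
    by apply: cvgD; [apply: cvgM; [exact: cvg_cst|exact: cvg_id]|exact: cvg_cst].
  have {}H := H c1.
  have h1 (x : R) : `|sin (a * x + th)| <= (`|a| + 1) * expR `|x|.
    have := sin_max (a * x + th); have := expR_ge1_abs x; have := normr_ge0 a; nra.
  have h2 (x : R) : `|a * cos (a * x + th) - x * sin (a * x + th)| <= (`|a| + 1) * expR `|x|.
    apply: le_trans (ler_normB _ _) _; rewrite !normrM.
    have := sin_max (a * x + th); have := cos_max (a * x + th).
    have := expR_ge1_abs x; have := normr_ge0 a; have := expR_ge_abs x.
    have := normr_ge0 x; have := normr_ge0 (sin (a * x + th)); have := normr_ge0 (cos (a * x + th)).
    move: `|a| `|x| `|sin _| `|cos _| (expR _) => A X S C E; nra.
  have {H h1 h2} := H h1 h2.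
  have i1 : gam.-integrable setT (EFin \o (fun x => a * cos (a * x + th))).
    by apply: bm_integrable; apply: bmM; [exact: bm_cst|exact: bm_cosD].
  have i2 : gam.-integrable setT (EFin \o (fun x => x * sin (a * x + th))).
    apply: (@normal01_integrable _ _ 1); first exact: measurable_funM.
    move=> x; rewrite mul1r normrM; have := sin_max (a * x + th); have := expR_ge_abs x.
    have := normr_ge0 x; have := normr_ge0 (sin (a * x + th)); nra.
  rewrite RintegralB// bm_RintegralZ; last exact: bm_cosD.
  move=> H.
  transitivity (\int[gam]_x (-1 * (x * sin (a * x + th)))).
    by apply: eq_Rintegral => x _; rewrite mulN1r.
  by rewrite RintegralZl//; rewrite -/(phi a) in H; move: H; set u := Rintegral _ _ _ => H; lra.
have dphi a : is_derive a (1 : R) phi (- a * phi a).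
  have dI : `](a - 1), (a + 1)[%classic a by rewrite /= in_itv/=; lra.
  have intf x : `](a - 1), (a + 1)[%classic x -> gam.-integrable setT (EFin \o (fun y => cos (x * y + th))).
    by move=> _; apply: bm_integrable; exact: bm_cosD.
  have der (x y : R) : `](a - 1), (a + 1)[%classic x -> setT y -> derivable (fun t : R => cos (t * y + th)) x 1.
    by move=> _ _; have := dcos x y => -[].
  have pE (x y : R) : partial1of2 (fun t y : R => cos (t * y + th)) x y = - (y * sin (x * y + th)).
    by rewrite partial1of2E; have := dcos x y => -[].
  have ub (x y : R) : `](a - 1), (a + 1)[%classic x -> setT y ->
      `|partial1of2 (fun t y : R => cos (t * y + th)) x y| <= `|y|.
    move=> _ _; rewrite pE normrN normrM; have := sin_max (x * y + th).
    by move=> h; rewrite ler_piMr.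
  apply: DeriveDef.
    exact: (derivable_under_integral measurableT dI intf der (fun y => normr_ge0 y)
      normal01_integrable_abs ub).
  rewrite -derive1E (differentiation_under_integral measurableT dI intf der (fun y => normr_ge0 y)
      normal01_integrable_abs ub).
  by rewrite -ei; apply: eq_Rintegral => x _; rewrite pE.
have dpsi (a : R) : is_derive a (1 : R) (fun a => phi a * expR (a ^+ 2 / 2)) 0.
  have := dphi a => dp.
  by apply: is_derive_eq; rewrite /GRing.scale/=; field.
have := is_derive_0_is_cst t 0 dpsi.
rewrite expr0n/= mul0r expR0 mulr1 {2}/phi.
under eq_Rintegral do rewrite mul0r add0r.
rewrite bm_Rintegral_cst => <-.
by rewrite -mulrA -expRD addrN expR0 mulr1.
Qed.

(** Stein's identity for [u = 1]. *)
Lemma normal01_mean : \int[gam]_x x = 0.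
Proof.
have c0 : continuous (fun _ : R => 0 : R) by move=> x; exact: cvg_cst.
have h1 (x : R) : `|(1 : R)| <= 1 * expR `|x| by rewrite normr1 mul1r expR_ge1_abs.
have h2 (x : R) : `|0 - x * 1| <= 1 * expR `|x|.
  by rewrite sub0r normrN mulr1 mul1r expR_ge_abs.
have := @stein R (fun=> 1) (fun=> 0) 1 (fun x => is_derive_cst _ _ _) c0 h1 h2.
under eq_Rintegral do rewrite sub0r mulr1 -mulN1r.
rewrite RintegralZl//; first lra.
apply: (@normal01_integrable _ _ 1) => // x.
by rewrite mul1r expR_ge_abs.
Qed.

Lemma expR_ge_sqr (x : R) : x ^+ 2 <= 2 * expR `|x|.
Proof.
rewrite -(real_normK (num_real x)).
have := @expR_ge1Dxn _ `|x| 1 (normr_ge0 x).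
by rewrite (_ : (2`!)%:R = 2 :> R)//; lra.
Qed.

Lemma normal01_integrable_id : gam.-integrable setT (EFin \o (fun x : R => x)).
Proof.
apply: (@normal01_integrable _ _ 1) => // x.
by rewrite mul1r expR_ge_abs.
Qed.

Lemma normal01_integrable_sqr : gam.-integrable setT (EFin \o (fun x : R => x ^+ 2)).
Proof.
apply: (@normal01_integrable _ _ 2) => [|x]; first exact: measurable_funX.
by rewrite ger0_norm ?sqr_ge0// expR_ge_sqr.
Qed.

(** Stein's identity for [u = id]. *)
Lemma normal01_sqr : \int[gam]_x x ^+ 2 = 1.
Proof.
have c0 : continuous (fun _ : R => 1 : R) by move=> x; exact: cvg_cst.
have h1 (x : R) : `|x| <= 3 * expR `|x|.
  by have := expR_ge_abs x; have := expR_ge0 `|x|; lra.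
have h2 (x : R) : `|1 - x * x| <= 3 * expR `|x|.
  apply: le_trans (ler_normB _ _) _; rewrite normr1 -expr2 ger0_norm ?sqr_ge0//.
  by have := expR_ge_sqr x; have := expR_ge1_abs x; lra.
have := @stein R id (fun=> 1) 3 (fun x => is_derive_id _ _) c0 h1 h2.
rewrite RintegralB//=; last 2 first.
- by apply: bm_integrable; exact: bm_cst.
- by have := normal01_integrable_sqr.
by rewrite bm_Rintegral_cst; under eq_Rintegral do rewrite -expr2; lra.
Qed.

Lemma normal01_affine_sqr (m s : R) :
  (\int[gam]_x ((m + s * x) ^+ 2)%:E = (s ^+ 2 + m ^+ 2)%:E)%E.
Proof.
have i1 : gam.-integrable setT (EFin \o (fun x : R => s ^+ 2 * x ^+ 2)).
  by have := integrableZl measurableT (s ^+ 2) normal01_integrable_sqr.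
have i2 : gam.-integrable setT (EFin \o (fun x : R => 2 * m * s * x)).
  by have := integrableZl measurableT (2 * m * s) normal01_integrable_id.
have i3 : gam.-integrable setT (EFin \o (fun _ : R => m ^+ 2)).
  by apply: bm_integrable; exact: bm_cst.
have i12 : gam.-integrable setT (EFin \o (fun x : R => s ^+ 2 * x ^+ 2 + 2 * m * s * x)).
  by have := integrableD measurableT i1 i2.
have i123 : gam.-integrable setT (EFin \o (fun x : R => s ^+ 2 * x ^+ 2 + 2 * m * s * x + m ^+ 2)).
  by have := integrableD measurableT i12 i3.
transitivity (\int[gam]_x (s ^+ 2 * x ^+ 2 + 2 * m * s * x + m ^+ 2)%:E)%E.
  by apply: eq_integral => x _; congr (_%:E); ring.
rewrite -[LHS]fineK; last exact: integrable_fin_num.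
rewrite -/(Rintegral _ _ _) RintegralD// RintegralD//.
rewrite (RintegralZl _ measurableT normal01_integrable_sqr).
rewrite (RintegralZl _ measurableT normal01_integrable_id).
rewrite normal01_sqr normal01_mean bm_Rintegral_cst.
by congr (_%:E); ring.
Qed.

(** The exponential times the standard density is [s] times the centered normal density of variance
    [s^2 = 1 / (1 + b)]. *)
Lemma normal01_expRN_sqr (b : R) : 0 <= b ->
  \int[gam]_x expR (- (b * x ^+ 2 / 2)) = (Num.sqrt (1 + b))^-1.
Proof.
move=> b0; set s := (Num.sqrt (1 + b))^-1.
have s0 : 0 < s by rewrite invr_gt0 sqrtr_gt0; lra.
have bm : bounded_measurable (fun x : R => expR (- (b * x ^+ 2 / 2))).
  apply: bm_expRN.
    by apply: measurable_funM => //; apply: measurable_funM => //; exact: measurable_funX.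
  by move=> x; rewrite divr_ge0// mulr_ge0// sqr_ge0.
rewrite (@Rintegral_normal01 _ _ 1 (bm_measurable bm)); last first.
  move=> x; rewrite mul1r ger0_norm ?expR_ge0// ler_expR.
  by rewrite (@le_trans _ _ 0)// oppr_le0 divr_ge0// mulr_ge0// sqr_ge0.
have s2 : s ^+ 2 = (1 + b)^-1.
  by rewrite exprVn sqr_sqrtr//; lra.
transitivity (\int[leb]_x (s * normal_pdf 0 s x)).
  apply: eq_Rintegral => x _.
  rewrite normal_pdf01E normal_pdfE ?gt_eqF// /normal_fun subr0 mulrCA -expRD mulrA.
  congr (_ * expR _); last first.
    by rewrite s2 -mulr_natr; field; rewrite gt_eqF//; lra.
  rewrite /normal_peak expr1n mul1r -mulrnAr sqrtrM ?sqr_ge0// sqrtr_sqr gtr0_norm//.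
  by rewrite invfM mulrA divff ?gt_eqF// mul1r.
rewrite RintegralZl//; last exact: integrable_normal_pdf.
by rewrite /Rintegral integral_normal_pdf mulr1.
Qed.

Lemma normal_prob_affine (m s : R) (f : R -> R) : 0 < s -> continuous f ->
  (forall x, 0 <= f x) ->
  (\int[normal_prob m s]_x (f x)%:E = \int[gam]_x (f (m + s * x))%:E)%E.
Proof.
move=> s0 cf f0.
have mf : measurable_fun setT f by exact: continuous_measurable_fun.
have cF : continuous (fun x : R => m + s * x).
  by move=> x; apply: cvgD; [exact: cvg_cst|apply: cvgM; [exact: cvg_cst|exact: cvg_id]].
have dF : (fun x : R => m + s * x)^`()%classic = cst s.
  apply/funext => x; rewrite derive1E.
  suff : is_derive x (1 : R) (fun x : R => m + s * x) s by case.
  by apply: is_derive_eq; rewrite /GRing.scale/=; ring.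
have m1 : measurable_fun setT (fun x : R => (f x)%:E) by exact/measurable_EFinP.
have m2 : measurable_fun setT (fun x : R => (f (m + s * x))%:E).
  apply/measurable_EFinP; apply: measurableT_comp => //.
  exact: continuous_measurable_fun.
have p1 x : (0%R <= (f x)%:E)%E by rewrite lee_fin.
rewrite (ge0_integral_normal_prob m s m1 p1) (ge0_integral_normal_prob 0 1 m2 (fun x => p1 _)).
under eq_integral do rewrite -EFinM.
rewrite (@increasing_ge0_integration_by_substitutionT _ (fun x : R => m + s * x)).
- apply: eq_integral => x _; rewrite dF/= -EFinM -mulrA; congr ((_ * _)%:E).
  rewrite normal_pdf01E normal_pdfE ?gt_eqF// /normal_fun; rewrite [LHS]mulrAC.
  have -> : normal_peak s * s = normal_peak 1.
    rewrite /normal_peak expr1n mul1r -mulrnAr sqrtrM ?sqr_ge0// sqrtr_sqr gtr0_norm//.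
    by rewrite invfM mulrAC mulVf ?gt_eqF// mul1r.
  congr (_ * expR _).
  by rewrite -mulr_natr; field; rewrite gt_eqF.
- by move=> x y xy; rewrite ltrD2l ltr_pM2l.
- by rewrite dF => x; exact: cvg_cst.
- by rewrite dF; exact: is_cvg_cst.
- by rewrite dF; exact: is_cvg_cst.
- move=> x; suff : is_derive x (1 : R) (fun x : R => m + s * x) s by case.
  by apply: is_derive_eq; rewrite /GRing.scale/=; ring.
- under eq_cvg do rewrite addrC. apply: (cvg_comp (fun x => s * x) (fun y => y + m)); last exact: cvg_addrr_Ny.
  exact: gt0_cvgMrNy.
- under eq_cvg do rewrite addrC. apply: (cvg_comp (fun x => s * x) (fun y => y + m)); last exact: cvg_addrr.
  exact: gt0_cvgMry.
- by move=> x; apply: cvgM; [exact: cf|apply: continuous_normal_pdf; rewrite gt_eqF].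
- by move=> x; rewrite mulr_ge0// normal_pdf_ge0.
Qed.

End normal_moments.

Section normal_law.
Context {R : realType} {d} {Omega : measurableType d} (P : probability Omega R).
Notation gam := (@normal_prob R 0 1).
Variables (Z : Omega -> R) (m v : R).
Hypothesis mZ : measurable_fun setT Z.
Hypothesis v0 : 0 <= v.
Hypothesis lawZ : forall A : set R, measurable A -> P (Z @^-1` A) = normal_law m v A.

(** Representing [Z] as an affine image of a standard normal puts the Dirac case [v = 0] and the
    case [v > 0] under one formula, so that all moments reduce to [gam]. *)
Lemma ge0_integral_normal_law (f : R -> R) : continuous f -> (forall x, 0 <= f x) ->
  (\int[P]_w (f (Z w))%:E = \int[gam]_x (f (m + Num.sqrt v * x))%:E)%E.
Proof.
move=> cf f0.
have mf : measurable_fun setT (EFin \o f).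
  by apply/measurable_EFinP; exact: continuous_measurable_fun.
have mZ' : measurable_fun [set: Omega] (Z : Omega -> measurableTypeR R) by [].
have f0' (y : measurableTypeR R) : y \in [set: measurableTypeR R] -> (0 <= (EFin \o f) y)%E.
  by move=> _; rewrite lee_fin.
have := @ge0_integral_pushforward _ _ _ _ _ _ mZ' P setT _ measurableT mf f0'.
rewrite preimage_setT => <-.
have [v00|vn0] := eqVneq v 0.
  transitivity (\int[@dirac _ (measurableTypeR R) m R]_y (EFin \o f) y)%E.
    apply: eq_measure_integral => A mA _.
    by have h := lawZ mA; rewrite /normal_law v00 eqxx in h; exact: h.
  rewrite integral_dirac// diracT mul1e v00 sqrtr0.
  rewrite -[LHS]mule1 -(@probability_setT _ _ R gam) -integral_cst//.
  by apply: eq_integral => x _; rewrite /= mul0r addr0.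
have sv0 : 0 < Num.sqrt v by rewrite sqrtr_gt0 lt_neqAle eq_sym vn0.
rewrite -(normal_prob_affine m sv0 cf f0).
apply: eq_measure_integral => A mA _.
by have h := lawZ mA; rewrite /normal_law (negbTE vn0) in h; exact: h.
Qed.

Lemma normal_law_cos (th : R) :
  \int[P]_w cos (Z w + th) = cos (m + th) * expR (- (v / 2)).
Proof.
have bZ : bounded_measurable (fun w => cos (Z w + th)).
  apply: (@bm_comp _ _ _ (fun x => cos (x + th))) => //.
  by have := @bm_cosD R 1 th; under eq_fun do rewrite mul1r.
(* The transfer to [gam] is stated for nonnegative functions; adding 1 to the cosine makes it
   applicable, and the constant cancels at the end. *)
have cc : continuous (fun x : R => 1 + cos (x + th)).
  move=> x; apply: cvgD; first exact: cvg_cst.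
  apply: (continuous_comp (f := fun x => x + th)); last exact: continuous_cos.
  by apply: cvgD; [exact: cvg_id|exact: cvg_cst].
have c0 (x : R) : 0 <= 1 + cos (x + th).
  by have := cos_max (x + th); rewrite ler_norml => /andP[]; lra.
have := ge0_integral_normal_law cc c0.
rewrite bm_EFin_Rintegral; last by apply: bmD => //; exact: bm_cst.
rewrite bm_RintegralD//; last exact: bm_cst.
have bg : bounded_measurable (fun x : R => cos (Num.sqrt v * x + (m + th))) by exact: bm_cosD.
under [in RHS]eq_integral => x _.
  rewrite (_ : m + _ + th = Num.sqrt v * x + (m + th)); last ring.
  over.
rewrite bm_EFin_Rintegral; last by apply: bmD => //; exact: bm_cst.
rewrite bm_RintegralD//; last exact: bm_cst.
by rewrite !bm_Rintegral_cst normal01_cos sqr_sqrtr// => -[] /addrI.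
Qed.

Lemma normal_law_sqrD (c : R) :
  (\int[P]_w ((Z w + c) ^+ 2)%:E = (v + (m + c) ^+ 2)%:E)%E.
Proof.
have cc : continuous (fun x : R => (x + c) ^+ 2).
  move=> x; apply: (continuous_comp (f := fun x => x + c) (g := fun y => y ^+ 2)); last exact: exprn_continuous.
  by apply: cvgD; [exact: cvg_id|exact: cvg_cst].
rewrite (ge0_integral_normal_law cc (fun x => sqr_ge0 _)).
under eq_integral do rewrite addrAC.
by rewrite normal01_affine_sqr sqr_sqrtr.
Qed.

Lemma normal_law_sqr_integrable : P.-integrable setT (EFin \o (fun w => Z w ^+ 2)).
Proof.
apply/integrableP; split.
  by apply/measurable_EFinP; exact: measurable_funX.
under eq_integral => w _.
  rewrite /= ger0_norm ?sqr_ge0// -[Z w]addr0.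
  over.
by rewrite normal_law_sqrD ltry.
Qed.

Lemma normal_law_integrable : P.-integrable setT (EFin \o Z).
Proof.
apply: (@le_integrable _ _ _ P setT measurableT _ (fun w => (Z w ^+ 2 + 1)%:E)).
- exact/measurable_EFinP.
- move=> w _; rewrite /= lee_fin [leRHS]ger0_norm ?addr_ge0 ?sqr_ge0//.
  by rewrite -(real_normK (num_real (Z w))); have := sqr_ge0 (`|Z w| - 1); nra.
- have := integrableD measurableT normal_law_sqr_integrable (bm_integrable P (bm_cst 1)).
  by [].
Qed.

(** The mean is read off from the second moments of [Z] and [Z + 1], which are integrals of
    nonnegative functions: their difference is [2 E[Z] + 1]. *)
Lemma normal_law_mean : (\int[P]_w (Z w)%:E = m%:E)%E.
Proof.
have iZ := normal_law_integrable; have iZ2 := normal_law_sqr_integrable.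
have i2 : P.-integrable setT (EFin \o (fun w => 2 * Z w)).
  by have := integrableZl measurableT 2 iZ.
have i1 := bm_integrable P (bm_cst (1 : R)).
have i3 : P.-integrable setT (EFin \o (fun w => 2 * Z w + 1)).
  by have := integrableD measurableT i2 i1.
have e1 : \int[P]_w (Z w ^+ 2 + (2 * Z w + 1)) = v + (m + 1) ^+ 2.
  rewrite -[RHS]/(fine (v + (m + 1) ^+ 2)%:E) -normal_law_sqrD /Rintegral; congr fine.
  by apply: eq_integral => w _; congr (_%:E); ring.
have e0 : \int[P]_w (Z w ^+ 2) = v + m ^+ 2.
  rewrite -[m]addr0 -[RHS]/(fine (v + (m + 0) ^+ 2)%:E) -normal_law_sqrD /Rintegral; congr fine.
  by apply: eq_integral => w _; rewrite addr0.
move: e1; rewrite RintegralD// RintegralD// RintegralZl// bm_Rintegral_cst e0 => e1.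
rewrite -[LHS]fineK; last exact: integrable_fin_num.
by congr (_%:E); rewrite -/(Rintegral P setT Z); move: e1; set u := Rintegral _ _ _; nra.
Qed.

End normal_law.

(** * Exponentials of Gaussian quadratic forms *)

Section gaussian_quadratic_form.
Context {R : realType} {d} {Omega : measurableType d} (P : probability Omega R).
Notation gam := (@normal_prob R 0 1).
Variables (a v : nat -> R) (Z : nat -> Omega -> R).
Hypothesis a_ge0 : forall i, 0 <= a i.
Hypothesis v_ge0 : forall i, 0 <= v i.
Hypothesis mZ : forall i, measurable_fun setT (Z i).

Lemma measurable_lin (n : nat) (g : nat -> R) :
  measurable_fun setT (fun x => \sum_(i < n) g i * Z i x).
Proof.
by apply: measurable_sum => i; apply: measurable_funM.
Qed.

Lemma bm_cos (f : Omega -> R) : measurable_fun setT f ->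
  bounded_measurable (fun x => cos (f x)).
Proof.
move=> mf; have := bm_comp (@bm_cosD R 1 0) mf.
by under eq_fun do rewrite mul1r addr0.
Qed.

(* [exp (- a z^2 / 2)] is the average of [cos (sqrt a z t)] over a standard
   normal [t], so one coordinate at a time can be moved inside the exponential. *)
Lemma Rintegral_expR_quadratic (n : nat) (w : Omega -> R) (A : R) :
  bounded_measurable w ->
  (forall g : nat -> R, \int[P]_x (w x * cos (\sum_(i < n) g i * Z i x)) =
    A * expR (- ((\sum_(i < n) g i ^+ 2 * v i) / 2))) ->
  \int[P]_x (w x * expR (- ((\sum_(i < n) a i * Z i x ^+ 2) / 2))) =
    A * \prod_(i < n) (Num.sqrt (1 + a i * v i))^-1.
Proof.
elim: n w A => [|n IH] w A bw H.
  have := H (fun=> 0); rewrite !big_ord0 mul0r oppr0 expR0 !mulr1 => <-.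
  by apply: eq_Rintegral => x _; rewrite !big_ord0 cos0 mul0r oppr0 expR0.
have bZ : bounded_measurable (fun x => expR (- (a n * Z n x ^+ 2 / 2))).
  apply: bm_expRN => [|x]; last by rewrite divr_ge0// mulr_ge0// sqr_ge0.
  by apply: measurable_funM => //; apply: measurable_funM => //; exact: measurable_funX.
(* The weight absorbs coordinate [n]. It remains to establish the cosine hypothesis for the new
   weight, with one coordinate fewer. *)
have := IH (fun x => w x * expR (- (a n * Z n x ^+ 2 / 2))) (A * (Num.sqrt (1 + a n * v n))^-1) (bmM bw bZ).
move=> IH'; transitivity (A * (Num.sqrt (1 + a n * v n))^-1 * \prod_(i < n) (Num.sqrt (1 + a i * v i))^-1); last first.
  by rewrite big_ord_recr/=; ring.
rewrite -IH'.
- apply: eq_Rintegral => x _; rewrite big_ord_recr/= mulrDl opprD expRD; ring.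
- move=> g.
  pose s := Num.sqrt (a n).
  pose f (z : Omega * R) := w z.1 * cos (s * Z n z.1 * z.2 + \sum_(i < n) g i * Z i z.1).
  have mf1 : measurable_fun [set: Omega * measurableTypeR R]
     (fun z => s * Z n z.1 * z.2 + \sum_(i < n) g i * Z i z.1).
    apply: measurable_funD.
      apply: measurable_funM => //.
      by apply: measurable_funM => //; apply: measurableT_comp => //.
    exact: (measurableT_comp (measurable_lin n g)).
  have bf : @bounded_measurable _ (Omega * measurableTypeR R)%type R f.
    apply: bmM.
      by have [mw [M hM]] := bw; split; [exact: measurableT_comp|exists M].
    have := bm_comp (@bm_cosD R 1 0) mf1.
    by under eq_fun do rewrite mul1r addr0.
  transitivity (\int[P]_x \int[gam]_t f (x, t)).
    apply: eq_Rintegral => x _; rewrite /f/= bm_RintegralZ; last exact: bm_cosD.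
    by rewrite normal01_cos exprMn sqr_sqrtr//; ring.
  rewrite -(bm_Rintegral_prod1 P gam bf) (bm_Rintegral_prod2 P gam bf).
  transitivity (\int[gam]_t ((A * expR (- ((\sum_(i < n) g i ^+ 2 * v i) / 2))) *
      expR (- ((a n * v n) * t ^+ 2 / 2)))).
    apply: eq_Rintegral => t _.
    (* For fixed [t], the frequency [s * t] acts as the coefficient of [Z n], so the hypothesis on
       [n + 1] coordinates applies. *)
    have := H (fun i => if (i < n)%N then g i else s * t).
    rewrite /f/=.
    under eq_Rintegral => x _.
      rewrite big_ord_recr/= ltnn.
      under eq_bigr => i _ do rewrite ltn_ord.
      over.
    rewrite big_ord_recr/= ltnn.
    under [in RHS]eq_bigr => i _ do rewrite ltn_ord.
    move=> h; transitivity (\int[P]_x (w x * cos (\sum_(i < n) g i * Z i x + s * t * Z n x))).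
      by apply: eq_Rintegral => x _; congr (_ * cos _); ring.
    by rewrite h exprMn sqr_sqrtr// -mulrA -expRD; congr (_ * expR _); field.
  rewrite bm_RintegralZ ?normal01_expRN_sqr ?mulr_ge0//; first ring.
  apply: bm_expRN => [|x]; last by rewrite divr_ge0// mulr_ge0 ?sqr_ge0// mulr_ge0.
  by apply: measurable_funM => //; apply: measurable_funM => //; exact: measurable_funX.
Qed.

End gaussian_quadratic_form.

(** * Gaussian processes *)

Section gaussian_process.
Context {R : realType} {d} {Omega : measurableType d} (P : probability Omega R).
Context {S : Type} (U : S -> Omega -> R) (m : S -> R) (k : S -> S -> R).
Hypothesis gp : gaussian_process P U m k.

(* Otherwise [Num.sqrt] would return the junk value 0 and [normal_law] the
   uniform law on [0, 1], which a variable and its opposite cannot share. *)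
Lemma gaussian_process_psd (n : nat) (s : 'I_n -> S) (a : 'I_n -> R) :
  0 <= \sum_(i < n) \sum_(j < n) a i * a j * k (s i) (s j).
Proof.
have [//|vlt0] := leP 0 (\sum_(i < n) \sum_(j < n) a i * a j * k (s i) (s j)).
have [_ law] := gp.
pose A : set R := `]0, +oo[%classic.
have mA : measurable A by rewrite /A; exact: measurable_itv.
have u (mm v : R) : v < 0 -> normal_law mm v A = 1%E.
  move=> v0; rewrite /normal_law lt_eqF// (ltr0_sqrtr v0) /normal_prob.
  rewrite /normal_pdf eqxx integral_indic//.
  rewrite (_ : _ `&` _ = `]0, 1]%classic); last first.
    apply/seteqP; split => x /=; rewrite /A/= !in_itv/= ?andbT.
      by move=> [/andP[_ ->] ->].
    by move=> /andP[h ->]; rewrite h ltW.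
  by rewrite [LHS]lebesgue_measure_itv/= lte_fin ltr01 oppr0 adde0.
have mS (b : 'I_n -> R) : measurable_fun setT (fun w => \sum_(i < n) b i * U (s i) w).
  by apply: measurable_sum => i; apply: measurable_funM => //; have [] := gp.
have h1 := law n s a A mA.
have h2 := law n s (fun i => - a i) A mA.
rewrite u// in h1.
rewrite u in h2; last first.
  by under eq_bigr do under eq_bigr do rewrite mulrNN.
have d12 : [disjoint (fun w => \sum_(i < n) a i * U (s i) w) @^-1` A &
     (fun w => \sum_(i < n) - a i * U (s i) w) @^-1` A].
  apply/disj_setPS => w [] /=; rewrite /A/= !in_itv/= !andbT => w1.
  under eq_bigr do rewrite mulNr.
  by rewrite sumrN oppr_gt0 => w2; have := lt_trans w1 w2; rewrite ltxx.
have mm1 : measurable ((fun w => \sum_(i < n) a i * U (s i) w) @^-1` A).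
  by rewrite -[X in measurable X]setTI; exact: mS.
have mm2 : measurable ((fun w => \sum_(i < n) - a i * U (s i) w) @^-1` A).
  by rewrite -[X in measurable X]setTI; exact: mS.
have := probability_le1 P (measurableU _ _ mm1 mm2).
rewrite measureU//; last exact/disj_set2P.
rewrite [X in (X + _ <= _)%E]h1 [X in (_ + X <= _)%E]h2 -EFinD lee_fin; lra.
Qed.

Lemma gaussian_process_integrable_sqr (n : nat) (s : 'I_n -> S) (a : 'I_n -> R) :
  P.-integrable setT (EFin \o (fun w => (\sum_(i < n) a i * U (s i) w) ^+ 2)).
Proof.
have [mU law] := gp.
have mS : measurable_fun setT (fun w => \sum_(i < n) a i * U (s i) w).
  by apply: measurable_sum => i; apply: measurable_funM.
exact: (normal_law_sqr_integrable mS (gaussian_process_psd s a) (law n s a)).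
Qed.

Lemma gaussian_process_sqr (n : nat) (s : 'I_n -> S) (a : 'I_n -> R) :
  (\int[P]_w ((\sum_(i < n) a i * U (s i) w) ^+ 2)%:E =
  (\sum_(i < n) \sum_(j < n) a i * a j * k (s i) (s j) + (\sum_(i < n) a i * m (s i)) ^+ 2)%:E)%E.
Proof.
have [mU law] := gp.
have mS : measurable_fun setT (fun w => \sum_(i < n) a i * U (s i) w).
  by apply: measurable_sum => i; apply: measurable_funM.
have := normal_law_sqrD mS (gaussian_process_psd s a) (law n s a) 0.
by under eq_integral do rewrite addr0; rewrite addr0.
Qed.

Lemma gaussian_process_mean (n : nat) (s : 'I_n -> S) (a : 'I_n -> R) :
  (\int[P]_w (\sum_(i < n) a i * U (s i) w)%:E = (\sum_(i < n) a i * m (s i))%:E)%E.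
Proof.
have [mU law] := gp.
have mS : measurable_fun setT (fun w => \sum_(i < n) a i * U (s i) w).
  by apply: measurable_sum => i; apply: measurable_funM.
exact: (normal_law_mean mS (gaussian_process_psd s a) (law n s a)).
Qed.

End gaussian_process.

(** The radicand of [pair_dist] is a sum of two such terms, and the Gaussian mixture is expressed in
    the squared distance. *)
Definition sqdist {R : realType} {T : nat} (x y : T.-tuple R) : R :=
  \sum_(i < T) (tnth x i - tnth y i) ^+ 2.

(* Keeps the canonical probability structure of the nested product, which is
   not inferred on concrete carriers. *)
Definition triple {d} {X : measurableType d} {R : realType} (P : probability X R) :
  probability (X * (X * X))%type R := (P \x (P \x P))%E.

Lemma bm_Rintegral_triple {d} {X : measurableType d} {R : realType}
    (P : probability X R) (f : X * (X * X) -> R) : bounded_measurable f ->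
  \int[triple P]_z f z = \int[P]_x \int[(P \x P)%E]_z f (x, z).
Proof. exact: bm_Rintegral_prod1. Qed.

(** * Gaussian integrals of squared distances *)

Section isotropic_gaussian.
Context {R : realType} {T : nat} (piX : probability (T.-tuple R) R).
Variables (mu : 'I_T -> R) (s2 : R).
Hypothesis s2_ge0 : 0 <= s2.
Hypothesis iso : isotropic_gaussian piX mu s2.

(** Coordinates are indexed by [nat], the format of [Rintegral_expR_quadratic]; beyond [T] the
    default value 0 is still measurable. *)
Let crd (i : nat) (x : T.-tuple R) : R := nth 0 x i.

Let mcrd i : measurable_fun setT (crd i).
Proof.
have [iT|Ti] := ltnP i T.
  rewrite (_ : crd i = (fun x => tnth x (Ordinal iT))); first exact: measurable_tnth.
  by apply/funext => x; rewrite (tnth_nth 0).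
rewrite (_ : crd i = (fun x => 0)); first exact: measurable_cst.
by apply/funext => x; rewrite /crd nth_default// size_tuple.
Qed.

Let crdE (i : 'I_T) x : crd i x = tnth x i.
Proof. by rewrite (tnth_nth 0). Qed.

Let lin (g : nat -> R) (x : T.-tuple R) := \sum_(i < T) g i * crd i x.

Let mlin g : measurable_fun setT (lin g).
Proof. by apply: measurable_sum => i; exact: measurable_funM. Qed.

Let lmu (g : nat -> R) := \sum_(i < T) g i * mu i.
Let sq (g : nat -> R) := \sum_(i < T) g i ^+ 2.

Lemma isotropic_cos (g : nat -> R) (th : R) :
  \int[piX]_x cos (lin g x + th) = cos (lmu g + th) * expR (- (s2 * sq g / 2)).
Proof.
have [mX law] := iso.
pose s (i : 'I_T) := i; pose a (i : 'I_T) := g i.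
have ps := gaussian_process_psd iso s a.
have mS : measurable_fun setT (fun w : T.-tuple R => \sum_(i < T) a i * tnth w (s i)).
  by apply: measurable_sum => i; apply: measurable_funM.
have := normal_law_cos mS ps (law T s a) th.
rewrite (_ : \sum_(i < T) \sum_(j < T) _ = s2 * sq g); last first.
  rewrite /sq mulr_sumr; apply: eq_bigr => i _.
  rewrite (bigD1 i)//= eqxx big1 ?addr0; first by rewrite /a; ring.
  by move=> j ji; rewrite /s eq_sym (negbTE ji) mulr0.
rewrite -/(lmu g) => <-; apply: eq_Rintegral => x _; congr (cos (_ + _)).
by apply: eq_bigr => i _; rewrite crdE.
Qed.

Local Notation Q2 := (piX \x piX)%E.
Local Notation Q3 := (triple piX).

Lemma lmuD g h : lmu (fun i => g i + h i) = lmu g + lmu h.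
Proof. by rewrite /lmu -big_split; apply: eq_bigr => i _; rewrite mulrDl. Qed.

Lemma isotropic_cos2 (g h : nat -> R) (th : R) :
  \int[Q2]_z cos (lin g z.1 + lin h z.2 + th) =
  cos (lmu g + lmu h + th) * expR (- (s2 * (sq g + sq h) / 2)).
Proof.
rewrite (@bm_Rintegral_prod1 _ _ _ _ _ piX piX (fun z => cos (lin g z.1 + lin h z.2 + th))); last first.
  apply: bm_cos; apply: measurable_funD => //; apply: measurable_funD.
    exact: (measurableT_comp (mlin g)).
  exact: (measurableT_comp (mlin h)).
transitivity (\int[piX]_x (expR (- (s2 * sq h / 2)) * cos (lin g x + (lmu h + th)))).
  apply: eq_Rintegral => x _ /=.
  under eq_Rintegral do rewrite (addrC (lin g x)) -addrA.
  by rewrite isotropic_cos mulrC addrCA.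
rewrite bm_RintegralZ; last by apply: bm_cos; exact: measurable_funD.
by rewrite isotropic_cos mulrCA -expRD addrA; congr (_ * expR _); field.
Qed.

(** Coefficients that add up to zero cancel the contribution of the mean [mu] to the phase, as
    happens for functions of differences of attributes; only the variances survive. *)
Lemma isotropic_cos3 (f g h : nat -> R) :
  (forall i, f i + g i + h i = 0) ->
  \int[Q3]_z cos (lin f z.1 + lin g z.2.1 + lin h z.2.2) =
  expR (- (s2 * (sq f + sq g + sq h) / 2)).
Proof.
move=> fgh.
rewrite (@bm_Rintegral_triple _ _ _ piX (fun z => cos (lin f z.1 + lin g z.2.1 + lin h z.2.2))); last first.
  apply: bm_cos; apply: measurable_funD; first apply: measurable_funD.
  - exact: (measurableT_comp (mlin f)).
  - by apply: (measurableT_comp (mlin g)); apply: measurableT_comp.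
  - by apply: (measurableT_comp (mlin h)); apply: measurableT_comp.
transitivity (\int[piX]_x (expR (- (s2 * (sq g + sq h) / 2)) * cos (lin f x + (lmu g + lmu h)))).
  apply: eq_Rintegral => x _ /=.
  under eq_Rintegral do rewrite -addrA addrC.
  by rewrite isotropic_cos2 mulrC (addrC (lin f x)).
rewrite bm_RintegralZ; last by apply: bm_cos; exact: measurable_funD.
rewrite isotropic_cos addrA -!lmuD.
rewrite [X in cos X](_ : _ = 0); last by rewrite /lmu big1// => i _; rewrite fgh mul0r.
by rewrite cos0 mul1r -expRD; congr expR; field.
Qed.

Let mcrd1 i : measurable_fun [set: T.-tuple R * T.-tuple R] (fun z => crd i z.1).
Proof. exact: (measurableT_comp (mcrd i)). Qed.
Let mcrd2 i : measurable_fun [set: T.-tuple R * T.-tuple R] (fun z => crd i z.2).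
Proof. exact: (measurableT_comp (mcrd i)). Qed.

(** The [T] coordinate differences behave as independent centered normals of variance [2 * s2], each
    weighted by [a = 2 * A] in the quadratic form. *)
Lemma Rintegral_expR_sqdist (A : R) : 0 <= A ->
  \int[Q2]_z expR (- (A * @sqdist R T z.1 z.2)) = Num.sqrt (1 + 4 * A * s2) ^- T.
Proof.
move=> A0.
pose Z (i : nat) (z : T.-tuple R * T.-tuple R) := crd i z.1 - crd i z.2.
have mZ i : measurable_fun setT (Z i) by apply: measurable_funB.
have a0 (i : nat) : 0 <= 2 * A by rewrite mulr_ge0.
have v0 (i : nat) : 0 <= 2 * s2 by rewrite mulr_ge0.
have := @Rintegral_expR_quadratic R _ _ Q2 _ _ Z a0 v0 mZ T (fun=> 1) 1 (bm_cst 1).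
have -> : \prod_(i < T) (Num.sqrt (1 + 2 * A * (2 * s2)))^-1 = Num.sqrt (1 + 4 * A * s2) ^- T.
  by rewrite prodr_const card_ord exprVn; congr ((Num.sqrt _ ^+ _)^-1); ring.
rewrite mul1r => <-; last first.
  move=> g; under eq_Rintegral do rewrite mul1r.
  have := isotropic_cos2 g (fun i => - g i) 0.
  rewrite [X in cos X](_ : _ = 0); last first.
    rewrite addr0 /lmu -big_split/= big1// => i _; by ring.
  rewrite cos0 !mul1r => h.
  transitivity (\int[Q2]_z cos (lin g z.1 + lin (fun i => - g i) z.2 + 0)).
    apply: eq_Rintegral => z _; congr cos; rewrite addr0 /lin -big_split.
    by apply: eq_bigr => i _; rewrite /Z/=; ring.
  rewrite h; congr (expR (- (_ / 2))); rewrite /sq -big_split mulr_sumr.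
  by apply: eq_bigr => i _ /=; ring.
apply: eq_Rintegral => z _; rewrite mul1r; congr (expR (- _)).
rewrite /sqdist mulr_sumr mulr_suml; apply: eq_bigr => i _.
by rewrite /Z !crdE; field.
Qed.

Lemma measurable_sqdist : measurable_fun [set: T.-tuple R * T.-tuple R]
  (fun z => @sqdist R T z.1 z.2).
Proof.
rewrite (_ : (fun z => _) = (fun z : T.-tuple R * T.-tuple R => \sum_(i < T) (crd i z.1 - crd i z.2) ^+ 2)).
  by apply: measurable_sum => i; apply: measurable_funX; exact: measurable_funB.
by apply/funext => z; apply: eq_bigr => i _; rewrite !crdE.
Qed.

Lemma sqdist_ge0 (x y : T.-tuple R) : 0 <= sqdist x y.
Proof. by apply: sumr_ge0 => i _; exact: sqr_ge0. Qed.

Lemma Rintegral3_expR_sqdist (A : R) : 0 <= A ->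
  \int[Q3]_z expR (- (A * @sqdist R T z.2.1 z.2.2)) = Num.sqrt (1 + 4 * A * s2) ^- T.
Proof.
move=> A0.
rewrite (@bm_Rintegral_triple _ _ _ piX (fun z => expR (- (A * @sqdist R T z.2.1 z.2.2)))); last first.
  apply: bm_expRN => [|z]; last by rewrite mulr_ge0// sqdist_ge0.
  by apply: measurable_funM => //; apply: (measurableT_comp measurable_sqdist).
under eq_Rintegral do rewrite /= Rintegral_expR_sqdist//.
by rewrite bm_Rintegral_cst.
Qed.

(* The two differences are decorrelated by their sum and difference:
   [|x - w|^2 + |y - x|^2 = (|2 x - y - w|^2 + |y - w|^2) / 2]. *)
Lemma Rintegral3_expR_sqdistD (A : R) : 0 <= A ->
  \int[Q3]_z expR (- (A * (@sqdist R T z.1 z.2.2 + @sqdist R T z.2.1 z.1))) =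
  Num.sqrt (1 + 6 * A * s2) ^- T * Num.sqrt (1 + 2 * A * s2) ^- T.
Proof.
move=> A0.
(* The first [T] forms are coordinates of [2 x - y - w], of variance [(4 + 1 + 1) * s2]; the last
   [T] are coordinates of [y - w], of variance [2 * s2]. The factor 1/2 of the identity is the one
   in the quadratic form, so each weight is [A]. *)
pose Z (i : nat) (z : T.-tuple R * (T.-tuple R * T.-tuple R)) :=
  if (i < T)%N then 2 * crd i z.1 - crd i z.2.1 - crd i z.2.2
  else crd (i - T) z.2.1 - crd (i - T) z.2.2.
pose v (i : nat) := if (i < T)%N then 6 * s2 else 2 * s2.
have mZ i : measurable_fun setT (Z i).
  rewrite /Z; case: (i < T)%N; repeat apply: measurable_funB => //.
  - by apply: measurable_funM => //; apply: (measurableT_comp (mcrd i)).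
  - by apply: (measurableT_comp (mcrd1 i)).
  - by apply: (measurableT_comp (mcrd2 i)).
  - by apply: (measurableT_comp (mcrd1 _)).
  - by apply: (measurableT_comp (mcrd2 _)).
have a0 (i : nat) : 0 <= A by [].
have v0 (i : nat) : 0 <= v i by rewrite /v; case: ifP => _; rewrite mulr_ge0.
have := @Rintegral_expR_quadratic R _ _ Q3 _ _ Z a0 v0 mZ (T + T) (fun=> 1) 1 (bm_cst 1).
have -> : \prod_(i < T + T) (Num.sqrt (1 + A * v i))^-1 =
    Num.sqrt (1 + 6 * A * s2) ^- T * Num.sqrt (1 + 2 * A * s2) ^- T.
  rewrite big_split_ord /=; congr (_ * _).
    under eq_bigr => i _ do rewrite /v ltn_ord.
    by rewrite prodr_const card_ord exprVn; congr ((Num.sqrt _ ^+ _)^-1); ring.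
  under eq_bigr => i _ do rewrite /v ltnNge leq_addr/=.
  by rewrite prodr_const card_ord exprVn; congr ((Num.sqrt _ ^+ _)^-1); ring.
rewrite mul1r => <-; last first.
  move=> g; under eq_Rintegral do rewrite mul1r.
  pose g' (i : nat) := g (T + i)%N.
  have := @isotropic_cos3 (fun i => 2 * g i) (fun i => - g i + g' i) (fun i => - g i - g' i).
  rewrite mul1r => /(_ _) h.
  transitivity (\int[Q3]_z cos (lin (fun i => 2 * g i) z.1 + lin (fun i => - g i + g' i) z.2.1 + lin (fun i => - g i - g' i) z.2.2)).
    apply: eq_Rintegral => z _; congr cos; rewrite /lin big_split_ord/= -!big_split/=.
    by apply: eq_bigr => i _; rewrite /Z/= ltn_ord ltnNge leq_addr/= addKn /g'; ring.
  rewrite h; last by move=> i; ring.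
  congr (expR (- (_ / 2))); rewrite /sq big_split_ord/= -!big_split/= mulr_sumr.
  by apply: eq_bigr => i _ /=; rewrite /v ltn_ord ltnNge leq_addr/= /g'; ring.
apply: eq_Rintegral => z _; rewrite mul1r; congr (expR (- _)).
rewrite /sqdist big_split_ord/= -!big_split/= mulr_sumr mulr_suml; apply: eq_bigr => i _ /=.
by rewrite /Z ltn_ord ltnNge leq_addr/= addKn !crdE; field.
Qed.

End isotropic_gaussian.

(** * Skew-symmetric random functions *)

Section skew_mean.
Context {d1 d2} {X : measurableType d1} {Y : measurableType d2} {R : realType}.
Local Open Scope ereal_scope.

Lemma ge0_integral_fst (P : probability X R) (Q : probability Y R) (g : X -> \bar R) :
  measurable_fun setT g -> (forall x, 0 <= g x) ->
  \int[P \x Q]_z g z.1 = \int[P]_x g x.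
Proof.
move=> mg g0; rewrite (fubini_tonelli1 (fun z : X * Y => g z.1))//.
  apply: eq_integral => x _; rewrite /fubini_F/= integral_cst//.
  by rewrite [X in _ * X]probability_setT mule1.
exact: (measurableT_comp mg).
Qed.

Lemma ge0_integral_snd (P : probability X R) (Q : probability Y R) (g : Y -> \bar R) :
  measurable_fun setT g -> (forall x, 0 <= g x) ->
  \int[P \x Q]_z g z.2 = \int[Q]_x g x.
Proof.
move=> mg g0; rewrite (fubini_tonelli2 (fun z : X * Y => g z.2))//.
  apply: eq_integral => x _; rewrite /fubini_G/= integral_cst//.
  by rewrite [X in _ * X]probability_setT mule1.
exact: (measurableT_comp mg).
Qed.

End skew_mean.

Section skew_mean_expectation.
Context {d} {X : measurableType d} {R : realType} (P : probability X R).
Variable f : X * X -> R.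
Hypothesis mf : measurable_fun setT f.
Hypothesis skew : forall x y, f (y, x) = - f (x, y).
Local Open Scope ereal_scope.

Let fp := (EFin \o f)^\+.
Let fn := (EFin \o f)^\-.

Let mfE : measurable_fun setT (EFin \o f). Proof. exact/measurable_EFinP. Qed.
Let mfp : measurable_fun setT fp. Proof. exact: measurable_funepos. Qed.
Let mfn : measurable_fun setT fn. Proof. exact: measurable_funeneg. Qed.
Let fp0 z : 0 <= fp z. Proof. exact: funepos_ge0. Qed.
Let fn0 z : 0 <= fn z. Proof. exact: funeneg_ge0. Qed.

(** Exchanging the two arguments turns the positive part into the negative one, and by Tonelli the
    product measure does not see the exchange. *)
Lemma skew_funepos_funeneg : \int[P \x P]_z fn z = \int[P \x P]_z fp z.
Proof.
rewrite (fubini_tonelli1 (m1 := P) (m2 := P) _ mfn fn0) (fubini_tonelli2 (m1 := P) (m2 := P) _ mfp fp0).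
apply: eq_integral => x _; apply: eq_integral => y _.
by rewrite /fn /fp funeposE funenegE /= (skew x y).
Qed.

(** For [a = +oo] the difference is infinite and [fine] sends it to 0. The conditional mean is thus
    0 for every outcome, integrable or not. *)
Lemma fine_subee (a : \bar R) : 0 <= a -> fine (a - a) = 0%R.
Proof. by case: a => [r| |] //= _; rewrite subrr. Qed.

Lemma skew_expectation : fine 'E_(P \x P)[f] = 0%R.
Proof.
rewrite unlock integralE -/fp -/fn skew_funepos_funeneg fine_subee//.
by apply: integral_ge0 => z _.
Qed.

Lemma integral_triple1 (g : X * X -> \bar R) : measurable_fun setT g -> (forall z, 0 <= g z) ->
  \int[triple P]_z g (z.1, z.2.1) = \int[P \x P]_z g z.
Proof.
move=> mg g0.
have mg' : measurable_fun [set: X * (X * X)] (fun z => g (z.1, z.2.1)).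
  apply: measurableT_comp => //.
  by apply: measurable_fun_pair => //; apply: measurableT_comp.
rewrite /triple (fubini_tonelli1 _ mg')// (fubini_tonelli1 _ mg)//.
apply: eq_integral => x _; rewrite /fubini_F/=.
apply: (ge0_integral_fst P P (g := fun y => g (x, y))) => //.
by apply: measurableT_comp => //; exact: pair1_measurable.
Qed.

Lemma integral_triple2 (g : X * X -> \bar R) : measurable_fun setT g -> (forall z, 0 <= g z) ->
  \int[triple P]_z g (z.1, z.2.2) = \int[P \x P]_z g z.
Proof.
move=> mg g0.
have mg' : measurable_fun [set: X * (X * X)] (fun z => g (z.1, z.2.2)).
  apply: measurableT_comp => //.
  by apply: measurable_fun_pair => //; apply: measurableT_comp.
rewrite /triple (fubini_tonelli1 _ mg')// (fubini_tonelli1 _ mg)//.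
apply: eq_integral => x _; rewrite /fubini_F/=.
apply: (ge0_integral_snd P P (g := fun y => g (x, y))) => //.
by apply: measurableT_comp => //; exact: pair1_measurable.
Qed.

Lemma skew_expectation_triple1 : fine 'E_(triple P)[fun z => f (z.1, z.2.1)] = 0%R.
Proof.
rewrite unlock integralE.
rewrite (_ : (fun w : X * (X * X) => _)^\+ = fun z => fp (z.1, z.2.1)); last first.
  by apply/funext => z; rewrite /fp !funeposE.
rewrite (_ : (fun w : X * (X * X) => _)^\- = fun z => fn (z.1, z.2.1)); last first.
  by apply/funext => z; rewrite /fn !funenegE.
rewrite !integral_triple1// skew_funepos_funeneg fine_subee//.
by apply: integral_ge0 => z _.
Qed.

Lemma skew_expectation_triple2 : fine 'E_(triple P)[fun z => f (z.1, z.2.2)] = 0%R.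
Proof.
rewrite unlock integralE.
rewrite (_ : (fun w : X * (X * X) => _)^\+ = fun z => fp (z.1, z.2.2)); last first.
  by apply/funext => z; rewrite /fp !funeposE.
rewrite (_ : (fun w : X * (X * X) => _)^\- = fun z => fn (z.1, z.2.2)); last first.
  by apply/funext => z; rewrite /fn !funenegE.
rewrite !integral_triple2// skew_funepos_funeneg fine_subee//.
by apply: integral_ge0 => z _.
Qed.

End skew_mean_expectation.

Section skew_correlation.
Context {R : realType} {d d'} {Omega : measurableType d} {X : measurableType d'}.
Variables (P : probability Omega R) (piX : probability X R).
Variable (F : X -> X -> Omega -> R).
Hypothesis mF : measurable_fun setT (fun p : Omega * (X * X) => F p.2.1 p.2.2 p.1).
Hypothesis skew : forall x y w, F y x w = - F x y w.

Let mFw w : measurable_fun setT (fun z : X * X => F z.1 z.2 w).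
Proof.
have := measurableT_comp mF (@pair1_measurable _ _ Omega (X * X)%type w).
by [].
Qed.

Let mF1 : measurable_fun setT (fun p : Omega * (X * (X * X)) => F p.2.1 p.2.2.1 p.1).
Proof.
apply: (measurableT_comp (f := fun p : Omega * (X * X) => F p.2.1 p.2.2 p.1) (g := fun p : Omega * (X * (X * X)) => (p.1, (p.2.1, p.2.2.1)))) => //.
apply: measurable_fun_pair => //; apply: measurable_fun_pair.
  by apply: measurableT_comp.
by apply: measurableT_comp => //; apply: measurableT_comp.
Qed.

Let mF2 : measurable_fun setT (fun p : Omega * (X * (X * X)) => F p.2.1 p.2.2.2 p.1).
Proof.
apply: (measurableT_comp (f := fun p : Omega * (X * X) => F p.2.1 p.2.2 p.1) (g := fun p : Omega * (X * (X * X)) => (p.1, (p.2.1, p.2.2.2)))) => //.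
apply: measurable_fun_pair => //; apply: measurable_fun_pair.
  by apply: measurableT_comp.
by apply: measurableT_comp => //; apply: measurableT_comp.
Qed.

Lemma skew_cond_variance w :
  cond_variance piX F w = (\int[(piX \x piX)]_z ((F z.1 z.2 w) ^+ 2)%:E)%E.
Proof.
rewrite /cond_variance /variance unlock.
rewrite (skew_expectation piX (mFw w)) => [|x y]; last exact: skew.
rewrite unlock; apply: eq_integral => z _; congr (_%:E).
by rewrite /= !fctE /= subr0 expr2.
Qed.

Lemma skew_cond_covariance w : cond_covariance piX F w =
  (\int[triple piX]_z (F z.1 z.2.1 w * F z.1 z.2.2 w)%:E)%E.
Proof.
rewrite /cond_covariance unlock -/(triple piX).
rewrite (skew_expectation_triple1 piX (mFw w)) => [|x y]; last exact: skew.
rewrite (skew_expectation_triple2 piX (mFw w)) => [|x y]; last exact: skew.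
rewrite unlock; apply: eq_integral => z _; congr (_%:E).
by rewrite /= !fctE /= !subr0.
Qed.

Variables (V : X * X -> R) (C : X * (X * X) -> R).
Hypothesis bV : bounded_measurable V.
Hypothesis EV : forall x y, (\int[P]_w ((F x y w) ^+ 2)%:E = (V (x, y))%:E)%E.
Hypothesis EC : forall x y y', (\int[P]_w (F x y w * F x y' w)%:E = (C (x, (y, y')))%:E)%E.

(** The conditional mean vanishes, so the conditional variance is a second moment and Tonelli
    exchanges the two integrations. *)
Lemma total_varianceE : total_variance P piX F = \int[(piX \x piX)%E]_z V z.
Proof.
rewrite /total_variance.
under eq_integral do rewrite skew_cond_variance.
have mF2' : measurable_fun setT (fun p : Omega * (X * X) => ((F p.2.1 p.2.2 p.1) ^+ 2)%:E).
  by apply/measurable_EFinP; apply: measurable_funX.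
have F0 (p : Omega * (X * X)) : (0 <= ((F p.2.1 p.2.2 p.1) ^+ 2)%:E)%E.
  by rewrite lee_fin sqr_ge0.
pose Q2 : probability (X * X)%type R := (piX \x piX)%E.
have e := fubini_tonelli (m1 := P) (m2 := Q2) _ mF2' F0.
rewrite /Rintegral; congr fine; etransitivity; first exact: e.
by apply: eq_integral => -[x y] _; rewrite -EV.
Qed.

(** The product has no sign, so Fubini requires integrability: [|a b| <= a^2 + b^2] bounds the inner
    integral of the absolute value by two values of the bounded function [V]. *)
Lemma integral_cond_covarianceE :
  fine (\int[P]_w cond_covariance piX F w)%E = \int[triple piX]_z C z.
Proof.
under eq_integral do rewrite skew_cond_covariance.
have mFF : measurable_fun setT (fun p : Omega * (X * (X * X)) => (F p.2.1 p.2.2.1 p.1 * F p.2.1 p.2.2.2 p.1)%:E).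
  by apply/measurable_EFinP; exact: (measurable_funM mF1 mF2).
have [mV [M VM]] := bV.
have mV1 : measurable_fun [set: X * (X * X)] (fun z => V (z.1, z.2.1)).
  apply: measurableT_comp => //.
  by apply: measurable_fun_pair => //; apply: measurableT_comp.
have mV2 : measurable_fun [set: X * (X * X)] (fun z => V (z.1, z.2.2)).
  apply: measurableT_comp => //.
  by apply: measurable_fun_pair => //; apply: measurableT_comp.
have mFx x y : measurable_fun setT (F x y).
  have := measurableT_comp mF (@pair2_measurable _ _ Omega (X * X)%type (x, y)).
  by [].
have iFF : (P \x triple piX)%E.-integrable setT (fun p => (F p.2.1 p.2.2.1 p.1 * F p.2.1 p.2.2.2 p.1)%:E).
  pose g z := (\int[P]_w `|(F z.1 z.2.1 w * F z.1 z.2.2 w)%:E|)%E.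
  have [_] := integrable21ltyP P (triple piX) mFF; apply.
  have g0 z : setT z -> (0 <= g z)%E by move=> _; apply: integral_ge0 => w _; exact: abse_ge0.
  have mg : measurable_fun setT g.
    have mabs : measurable_fun setT (fun p : Omega * (X * (X * X)) => `|(F p.2.1 p.2.2.1 p.1 * F p.2.1 p.2.2.2 p.1)%:E|)%E.
      exact: (measurableT_comp _ mFF).
    exact: (measurable_fun_fubini_tonelli_G (m1 := P) _ mabs (fun=> abse_ge0 _)).
  have mVV : measurable_fun [set: X * (X * X)] (fun z => (V (z.1, z.2.1) + V (z.1, z.2.2))%:E).
    by apply/measurable_EFinP; exact: measurable_funD.
  have gV z : setT z -> (g z <= (V (z.1, z.2.1) + V (z.1, z.2.2))%:E)%E.
    move: z => [x [y y']] _; rewrite EFinD -!EV -ge0_integralD//.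
    + apply: ge0_le_integral => //.
      * by apply: measurableT_comp => //; apply/measurable_EFinP; exact: measurable_funM.
      * by apply/measurable_EFinP; apply: measurable_funD; apply: measurable_funX.
      * move=> w _; rewrite -EFinD lee_fin.
        rewrite ler_norml; apply/andP.
        have := sqr_ge0 (F x y w + F x y' w); have := sqr_ge0 (F x y w - F x y' w).
        have := sqr_ge0 (F x y w); have := sqr_ge0 (F x y' w).
        by move: (F x y w) (F x y' w) => a b; split; nra.
    + by move=> w _; rewrite lee_fin sqr_ge0.
    + by apply/measurable_EFinP; apply: measurable_funX.
    + by move=> w _; rewrite lee_fin sqr_ge0.
    + by apply/measurable_EFinP; apply: measurable_funX.
  have := @ge0_le_integral _ _ _ (triple piX) setT measurableT _ _ g0 mg mVV gV.
  move=> h; apply: (le_lt_trans h).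
  rewrite bm_EFin_Rintegral ?ltry//.
  by apply: bmD; split=> //; exists M.
rewrite (Fubini iFF) /Rintegral; congr fine.
by apply: eq_integral => -[x [y y']] _ /=; rewrite EC.
Qed.

End skew_correlation.

Section sqdist.
Context {R : realType} {T : nat}.
Implicit Types x y : T.-tuple R.

Lemma sqdistxx x : sqdist x x = 0.
Proof. by rewrite /sqdist big1// => i _; rewrite subrr expr0n. Qed.

Lemma sqdistC x y : sqdist x y = sqdist y x.
Proof. by apply: eq_bigr => i _; rewrite -sqrrN opprB. Qed.

End sqdist.

(* The variance of [F (x, y) + c F (x, y')], [F] being the skew part of a field
   whose covariance [k] depends only on the distance. *)
Lemma skew_kernel_sum {R : realType} {T : nat}
    (k : T.-tuple R * T.-tuple R -> T.-tuple R * T.-tuple R -> R) (h : R -> R)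
    (s : R) (x y y' : T.-tuple R) (c : R) :
  (forall x y v w, k (x, y) (v, w) = s * h (sqdist x v + sqdist y w)) -> h 0 = 1 ->
  let a (i : 'I_4) := nth 0 [:: 1; -1; c; - c] i in
  let p (i : 'I_4) := nth (x, y) [:: (x, y); (y, x); (x, y'); (y', x)] i in
  \sum_(i < 4) \sum_(j < 4) a i * a j * k (p i) (p j) =
  2 * s * (1 - h (2 * sqdist x y) + c ^+ 2 * (1 - h (2 * sqdist x y')) +
   2 * c * (h (sqdist y y') - h (sqdist x y' + sqdist y x))).
Proof.
move=> kE h0 a p.
rewrite !big_ord_recl !big_ord0 /a /p /= /bump/= !kE !sqdistxx !addr0 !add0r.
rewrite (sqdistC y x) (sqdistC y' x) (sqdistC y' y) h0.
rewrite (addrC (sqdist x y) (sqdist x y')) (_ : sqdist x y + sqdist x y = 2 * sqdist x y); last ring.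
rewrite (_ : sqdist x y' + sqdist x y' = 2 * sqdist x y'); last ring.
by ring.
Qed.

(** * Correlation of the skew part of a Matern field *)

Section skew_matern_field.
Context {R : realType} {d} {Omega : measurableType d} (P : probability Omega R).
Context {T : nat} (U : T.-tuple R * T.-tuple R -> Omega -> R).
Variables (m : T.-tuple R * T.-tuple R -> R) (sigma_u ell nu : R).
Hypothesis gp : gaussian_process P U m (@matern_kernel R T sigma_u ell nu).
Hypothesis meanF : forall x y, 'E_P[skew_field U x y]%E = 0%E.

Local Notation H q := (matern (Num.sqrt q) ell nu).
Local Notation F := (skew_field U).
Local Notation D := (@sqdist R T).

Lemma matern0 : H 0 = 1.
Proof. by rewrite /matern sqrtr0 eqxx. Qed.

Lemma matern_kernelE x y v w :
  @matern_kernel R T sigma_u ell nu (x, y) (v, w) = sigma_u ^+ 2 * H (D x v + D y w).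
Proof. by []. Qed.

(** The centering of [F] says this much about the mean of [U]; it is enough to cancel the means in
    linear combinations of values of [F]. *)
Lemma skew_mean_sym x y : m (x, y) = m (y, x).
Proof.
have := gaussian_process_mean gp (fun i : 'I_2 => nth (x, y) [:: (x, y); (y, x)] i)
  (fun i : 'I_2 => nth 0 [:: 1; -1] i).
rewrite !big_ord_recl big_ord0 /= /bump/=.
under eq_integral => w _.
  rewrite !big_ord_recl big_ord0 /= /bump/= mul1r mulN1r addr0 -/(skew_field U x y w).
  over.
have := meanF x y; rewrite unlock => -> [] /eqP; rewrite mul1r mulN1r addr0 eq_sym subr_eq0.
by move/eqP.
Qed.

Let var x y y' (c : R) : R := 2 * sigma_u ^+ 2 *
  (1 - H (2 * D x y) + c ^+ 2 * (1 - H (2 * D x y')) +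
   2 * c * (H (D y y') - H (D x y' + D y x))).

Let sF (x y y' : T.-tuple R) (i : 'I_4) := nth (x, y) [:: (x, y); (y, x); (x, y'); (y', x)] i.
Let aF (c : R) (i : 'I_4) := nth 0 [:: 1; -1; c; - c] i.

Let sumF x y y' c w : \sum_(i < 4) aF c i * U (sF x y y' i) w = F x y w + c * F x y' w.
Proof.
rewrite !big_ord_recl big_ord0 /aF /sF /= /bump/= /skew_field; ring.
Qed.

Lemma skew_field_sqrD x y y' c :
  (\int[P]_w ((F x y w + c * F x y' w) ^+ 2)%:E = (var x y y' c)%:E)%E.
Proof.
have := gaussian_process_sqr gp (sF x y y') (aF c).
under eq_integral => w _ do rewrite sumF.
move=> ->; congr (_%:E).
rewrite (_ : \sum_(i < 4) aF c i * m _ = 0); last first.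
  rewrite !big_ord_recl big_ord0 /aF /sF /= /bump/= (skew_mean_sym y x) (skew_mean_sym y' x); ring.
rewrite expr0n addr0.
exact: (skew_kernel_sum (h := fun q => H q) x y y' c matern_kernelE matern0).
Qed.

Lemma skew_field_sqr_integrable x y y' c :
  P.-integrable setT (EFin \o (fun w => (F x y w + c * F x y' w) ^+ 2)).
Proof.
have := gaussian_process_integrable_sqr gp (sF x y y') (aF c).
by rewrite (_ : (fun w => _ ^+ 2) = (fun w => (F x y w + c * F x y' w) ^+ 2))//; apply/funext => w; rewrite sumF.
Qed.

Lemma skew_field_sqr x y :
  (\int[P]_w ((F x y w) ^+ 2)%:E = (2 * sigma_u ^+ 2 * (1 - H (2 * D x y)))%:E)%E.
Proof.
have := skew_field_sqrD x y y 0.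
under eq_integral do rewrite mul0r addr0.
move=> ->; congr (_%:E); rewrite /var.
by move: (H (2 * D x y)) (H (D y y)) (H (D x y + D y x)) => h1 h2 h3; ring.
Qed.

(** Polarization: half of the second moment of the sum (the case [c = 1]) minus the two separate
    ones. *)
Lemma skew_field_cov x y y' :
  (\int[P]_w (F x y w * F x y' w)%:E =
   (2 * sigma_u ^+ 2 * (H (D y y') - H (D x y' + D y x)))%:E)%E.
Proof.
have i1 := skew_field_sqr_integrable x y y' 1.
have i2 : P.-integrable setT (EFin \o (fun w => (F x y w) ^+ 2)).
  have := skew_field_sqr_integrable x y y 0.
  by under [in X in EFin \o X]eq_fun do rewrite mul0r addr0.
have i3 : P.-integrable setT (EFin \o (fun w => (F x y' w) ^+ 2)).
  have := skew_field_sqr_integrable x y' y' 0.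
  by under [in X in EFin \o X]eq_fun do rewrite mul0r addr0.
have i12 : P.-integrable setT (EFin \o (fun w => (F x y w + 1 * F x y' w) ^+ 2 - (F x y w) ^+ 2)).
  by have := integrableB measurableT i1 i2.
have i123 : P.-integrable setT (EFin \o (fun w => (F x y w + 1 * F x y' w) ^+ 2 - (F x y w) ^+ 2 - (F x y' w) ^+ 2)).
  by have := integrableB measurableT i12 i3.
have i4 : P.-integrable setT (EFin \o (fun w => 2^-1 * ((F x y w + 1 * F x y' w) ^+ 2 - (F x y w) ^+ 2 - (F x y' w) ^+ 2))).
  by have := integrableZl measurableT 2^-1 i123.
transitivity (\int[P]_w (2^-1 * ((F x y w + 1 * F x y' w) ^+ 2 - (F x y w) ^+ 2 - (F x y' w) ^+ 2))%:E)%E.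
  by apply: eq_integral => w _; congr (_%:E); field.
rewrite -[LHS]fineK; last exact: (integrable_fin_num measurableT i4).
congr (_%:E); rewrite -/(Rintegral P setT _) RintegralZl// RintegralB// RintegralB//.
rewrite /Rintegral (skew_field_sqrD x y y' 1) !skew_field_sqr /= /var.
by move: (H (2 * D x y)) (H (2 * D x y')) (H (D y y')) (H (D x y' + D y x)) => h1 h2 h3 h4; field.
Qed.

Variables (piX : probability (T.-tuple R) R) (mu : 'I_T -> R) (sigma_x : R).
Variable (ka : probability (measurableTypeR R) R).
Hypothesis ell0 : 0 < ell.
Hypothesis mU : measurable_fun setT
  (fun p : Omega * (T.-tuple R * T.-tuple R) => U p.2 p.1).
Hypothesis iso : isotropic_gaussian piX mu (sigma_x ^+ 2).
Hypothesis mixture : forall q, 0 <= q ->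
  H q = \int[ka]_t expR (- (q * (expR t / (2 * ell ^+ 2)))).

Lemma measurable_skew_field : measurable_fun setT
  (fun p : Omega * (T.-tuple R * T.-tuple R) => F p.2.1 p.2.2 p.1).
Proof.
apply: measurable_funB.
  rewrite (_ : (fun x => _) = (fun p : Omega * (T.-tuple R * T.-tuple R) => U p.2 p.1))//.
  by apply/funext => -[w [x y]].
apply: (measurableT_comp (f := fun p : Omega * (T.-tuple R * T.-tuple R) => U p.2 p.1)
   (g := fun p : Omega * (T.-tuple R * T.-tuple R) => (p.1, (p.2.2, p.2.1)))) => //.
by apply: measurable_fun_pair => //; apply: measurable_fun_pair; apply: measurableT_comp.
Qed.

Let c (t : R) := expR t / (2 * ell ^+ 2).
Let c0 t : 0 <= c t. Proof. by rewrite divr_ge0 ?expR_ge0// mulr_ge0// sqr_ge0. Qed.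
Let mc : measurable_fun setT c. Proof. exact: measurable_funM. Qed.

Lemma bm_mixture {d1} {Y : measurableType d1} (q : Y -> R) :
  measurable_fun setT q -> (forall y, 0 <= q y) ->
  bounded_measurable (fun z : Y * measurableTypeR R => expR (- (q z.1 * c z.2))).
Proof.
move=> mq q0; apply: bm_expRN => [|z]; last exact: mulr_ge0.
by apply: measurable_funM; [exact: (measurableT_comp mq)|exact: (measurableT_comp mc)].
Qed.

Lemma bm_matern {d1} {Y : measurableType d1} (Q : probability Y R) (q : Y -> R) :
  measurable_fun setT q -> (forall y, 0 <= q y) ->
  bounded_measurable (fun y => H (q y)).
Proof.
move=> mq q0.
have := bm_Rintegral_pair1 Q ka (bm_mixture mq q0).
by rewrite (_ : (fun y => H (q y)) = (fun x => \int[ka]_y expR (- (q x * c y)))) //; apply/funext => y; rewrite mixture.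
Qed.

(** Integrating over the attributes first, at a fixed mixing scale [t], leaves only Gaussian
    integrals. *)
Lemma Rintegral_matern {d1} {Y : measurableType d1} (Q : probability Y R) (q : Y -> R) :
  measurable_fun setT q -> (forall y, 0 <= q y) ->
  \int[Q]_y H (q y) = \int[ka]_t \int[Q]_y expR (- (c t * q y)).
Proof.
move=> mq q0; have bq := bm_mixture mq q0.
transitivity (\int[Q]_y \int[ka]_t expR (- (q y * c t))).
  by apply: eq_Rintegral => y _; rewrite mixture.
rewrite -(bm_Rintegral_prod1 Q ka bq) (bm_Rintegral_prod2 Q ka bq).
by apply: eq_Rintegral => t _; apply: eq_Rintegral => y _; rewrite mulrC.
Qed.

Let r := sigma_x / ell.

(** Here [sigma_x] and [ell] merge into the ratio [r]. The values [k = 8, 4, 6, 2] produced by the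
    Gaussian integrals give the factors 4, 2, 3, 1. *)
Let cE (k : R) t : k * c t * sigma_x ^+ 2 = k / 2 * r ^+ 2 * expR t.
Proof. by rewrite /c /r; field; rewrite gt_eqF. Qed.

Lemma total_variance_matern : total_variance P piX F = 2 * sigma_u ^+ 2 *
  (1 - \int[ka]_t (Num.sqrt (1 + 4 * r ^+ 2 * expR t) ^- T)).
Proof.
pose V (z : T.-tuple R * T.-tuple R) := 2 * sigma_u ^+ 2 * (1 - H (2 * D z.1 z.2)).
have mD : measurable_fun setT (fun z : T.-tuple R * T.-tuple R => 2 * D z.1 z.2).
  by apply: measurable_funM => //; exact: measurable_sqdist.
have D0 (z : T.-tuple R * T.-tuple R) : 0 <= 2 * D z.1 z.2.
  by rewrite mulr_ge0// sqdist_ge0.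
have bH := bm_matern (piX \x piX)%E mD D0.
rewrite (@total_varianceE _ _ _ _ _ P piX F measurable_skew_field _ V); last 2 first.
- by move=> x y w; rewrite /skew_field opprB.
- by move=> x y; rewrite skew_field_sqr.
rewrite /V bm_RintegralZ; last by apply: bmB => //; exact: bm_cst.
rewrite bm_RintegralB//; last exact: bm_cst.
rewrite bm_Rintegral_cst; congr (_ * (_ - _)).
rewrite Rintegral_matern//; apply: eq_Rintegral => t _.
under eq_Rintegral do rewrite mulrA.
rewrite (Rintegral_expR_sqdist (sqr_ge0 _) iso); last by rewrite mulr_ge0.
rewrite (_ : 4 * (c t * 2) * sigma_x ^+ 2 = 8 * c t * sigma_x ^+ 2); last ring.
by rewrite cE; congr (Num.sqrt _ ^- T); field.
Qed.

Lemma integral_cond_covariance_matern :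
  fine (\int[P]_w cond_covariance piX F w)%E = 2 * sigma_u ^+ 2 *
  (\int[ka]_t (Num.sqrt (1 + 2 * r ^+ 2 * expR t) ^- T) -
   \int[ka]_t (Num.sqrt (1 + 3 * r ^+ 2 * expR t) ^- T *
               Num.sqrt (1 + r ^+ 2 * expR t) ^- T)).
Proof.
pose V (z : T.-tuple R * T.-tuple R) := 2 * sigma_u ^+ 2 * (1 - H (2 * D z.1 z.2)).
pose C (z : T.-tuple R * (T.-tuple R * T.-tuple R)) :=
  2 * sigma_u ^+ 2 * (H (D z.2.1 z.2.2) - H (D z.1 z.2.2 + D z.2.1 z.1)).
have mD : measurable_fun setT (fun z : T.-tuple R * T.-tuple R => 2 * D z.1 z.2).
  by apply: measurable_funM => //; exact: measurable_sqdist.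
have D0 (z : T.-tuple R * T.-tuple R) : 0 <= 2 * D z.1 z.2.
  by rewrite mulr_ge0// sqdist_ge0.
have bH := bm_matern (piX \x piX)%E mD D0.
have bV : bounded_measurable V.
  by apply: bmM; [exact: bm_cst|apply: bmB => //; exact: bm_cst].
have m1 : measurable_fun setT (fun z : T.-tuple R * (T.-tuple R * T.-tuple R) => D z.2.1 z.2.2).
  exact: (measurableT_comp (@measurable_sqdist R T)).
have m2 : measurable_fun setT (fun z : T.-tuple R * (T.-tuple R * T.-tuple R) => D z.1 z.2.2 + D z.2.1 z.1).
  apply: measurable_funD.
    apply: (measurableT_comp (f := fun z : T.-tuple R * T.-tuple R => D z.1 z.2) (g := fun z : T.-tuple R * (T.-tuple R * T.-tuple R) => (z.1, z.2.2))).
      exact: measurable_sqdist.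
    by apply: measurable_fun_pair => //; apply: measurableT_comp.
  apply: (measurableT_comp (f := fun z : T.-tuple R * T.-tuple R => D z.1 z.2) (g := fun z : T.-tuple R * (T.-tuple R * T.-tuple R) => (z.2.1, z.1))).
    exact: measurable_sqdist.
  by apply: measurable_fun_pair => //; apply: measurableT_comp.
have p1 (z : T.-tuple R * (T.-tuple R * T.-tuple R)) : 0 <= D z.2.1 z.2.2 by exact: sqdist_ge0.
have p2 (z : T.-tuple R * (T.-tuple R * T.-tuple R)) : 0 <= D z.1 z.2.2 + D z.2.1 z.1.
  by rewrite addr_ge0// sqdist_ge0.
have bH1 := bm_matern (triple piX) m1 p1.
have bH2 := bm_matern (triple piX) m2 p2.
rewrite (@integral_cond_covarianceE _ _ _ _ _ P piX F measurable_skew_field _ V C bV); first last.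
- by move=> x y y'; rewrite skew_field_cov.
- by move=> x y; rewrite skew_field_sqr.
- by move=> x y w; rewrite /skew_field opprB.
rewrite /C bm_RintegralZ; last exact: bmB.
rewrite bm_RintegralB//; congr (_ * (_ - _)).
  rewrite Rintegral_matern//; apply: eq_Rintegral => t _.
  rewrite (Rintegral3_expR_sqdist (sqr_ge0 _) iso)// cE.
  by congr (Num.sqrt _ ^- T); field.
rewrite Rintegral_matern//; apply: eq_Rintegral => t _.
rewrite (Rintegral3_expR_sqdistD (sqr_ge0 _) iso)// !cE.
by congr (Num.sqrt _ ^- T * Num.sqrt _ ^- T); field.
Qed.

End skew_matern_field.

(** * Inverse gamma law and Matern kernels *)

Section inverse_gamma.
Context {R : realType}.
Notation leb := (@lebesgue_measure R).
Variable nu : R.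
Hypothesis nu0 : 0 < nu.

Lemma ge0_integral_ge_itv (f : R -> R) (a b k : R) : a <= b -> 0 <= k ->
  measurable_fun setT f -> (forall x, 0 <= f x) -> (forall x, a <= x <= b -> k <= f x) ->
  ((k * (b - a))%:E <= \int[leb]_x (f x)%:E)%E.
Proof.
move=> ab k0 mf f0 kf.
have -> : ((k * (b - a))%:E = \int[leb]_(x in `[a, b]) (cst k%:E x))%E.
  rewrite integral_cst; last exact: measurable_itv.
  rewrite [X in (_ * X)%E]lebesgue_measure_itv/= lte_fin.
  move: ab; rewrite le_eqVlt => /predU1P[->|ab]; first by rewrite ltxx subrr mulr0 mule0.
  by rewrite ab -EFinB -EFinM.
rewrite integral_mkcond; apply: ge0_le_integral => //.
- by move=> x _; apply: erestrict_ge0 => y _; rewrite lee_fin.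
- apply/(measurable_restrictT _ _).1 => //.
- exact/measurable_EFinP.
- move=> x _; rewrite patchE; case: ifPn; last by rewrite lee_fin.
  by rewrite inE/= in_itv/= => xab; rewrite lee_fin kf.
Qed.

(** The integrand of the Gamma function after the substitution [x = expR t], Jacobian included. *)
Let G (t : R) := expR (nu * t) * expR (- expR t).

Let mG : measurable_fun setT G.
Proof.
apply: measurable_funM; first by apply: measurableT_comp => //; exact: measurable_funM.
by do 2 apply: measurableT_comp => //.
Qed.

Lemma integral_exp_abs_bound_lty (f : R -> R) (C b : R) : 0 < b -> 0 <= C ->
  measurable_fun setT f -> (forall t, 0 <= f t) ->
  (forall t, f t <= C * expR (- (b * `|t|))) ->
  (\int[leb]_t (f t)%:E < +oo)%E.
Proof.
move=> b0 C0 mf f0 fC.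
have me : measurable_fun setT (fun t : R => expR (- (b * `|t|))).
  by do 2 apply: measurableT_comp => //; apply: measurable_funM => //; exact: measurableT_comp.
apply: (@le_lt_trans _ _ (\int[leb]_t (C%:E * (expR (- (b * `|t|)))%:E))%E).
  apply: ge0_le_integral => //.
  - by move=> t _; rewrite lee_fin.
  - exact/measurable_EFinP.
  - by apply: emeasurable_funM => //; exact/measurable_EFinP.
  - by move=> t _; rewrite -EFinM lee_fin.
rewrite ge0_integralZl//; first last.
- exact/measurable_EFinP.
by rewrite lte_mul_pinfty ?lee_fin//; exact: integral_expR_abs_lty.
Qed.

Let G_lty : (\int[leb]_t (G t)%:E < +oo)%E.
Proof.
have m0 : 0 < Num.min nu 1 by rewrite lt_min nu0 ltr01.
(* For [t >= 0], [expR t >= t^2 / 2] and [(nu + 1) t - t^2 / 2 <= (nu + 1)^2 / 2], which leaves a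
   decay of rate 1; for [t < 0] the factor [expR (nu * t)] decays at rate [nu]. *)
apply: (@integral_exp_abs_bound_lty _ (expR ((nu + 1) ^+ 2 / 2)) (Num.min nu 1)) => //.
  by move=> t; rewrite /G mulr_ge0 ?expR_ge0.
move=> t; rewrite /G -!expRD ler_expR.
have [t0|t0] := leP 0 t.
  have := @expR_ge1Dxn _ t 1 t0; rewrite (_ : 2`!%:R = 2 :> R)//.
  have : Num.min nu 1 * `|t| <= t by rewrite ger0_norm// ler_piMl// ge_min lexx orbT.
  have := sqr_ge0 (nu + 1 - t); move: (expR t) (Num.min nu 1 * `|t|) => e k; nra.
have : Num.min nu 1 * `|t| <= - (nu * t).
  have tn : 0 <= - t by rewrite oppr_ge0 ltW.
  by rewrite ltr0_norm// -[leRHS]mulrN ler_wpM2r// ge_min lexx.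
have := expR_ge0 t; have := sqr_ge0 (nu + 1); move: (expR t) (Num.min nu 1 * `|t|) => e k; lra.
Qed.

Lemma powR_expR (t a : R) : expR t `^ a = expR (a * t).
Proof. by rewrite -expRM mulrC. Qed.

Lemma continuous_powR_pos (a : R) (x : R) : 0 < x -> {for x, continuous (fun y : R => y `^ a)}.
Proof.
move=> x0; apply/differentiable_continuous/derivable1_diffP.
by apply: derivable_powR; rewrite in_itv/= x0.
Qed.

(** Also certifies that [gamma_fun nu] is a genuine integral and not the value 0 that [fine] gives
    to an infinite one. *)
Lemma gamma_fun_EFin : (\int[leb]_t (G t)%:E = (gamma_fun nu)%:E)%E.
Proof.
rewrite /gamma_fun /Rintegral.
rewrite (_ : (\int[leb]_(x in `]0%R, +oo[) (x `^ (nu - 1) * expR (- x))%:E = \int[leb]_t (G t)%:E)%E); last first.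
  rewrite ge0_integral_expR_subst.
  - apply: eq_integral => t _; congr (_%:E); rewrite powR_expR /G.
    transitivity (expR ((nu - 1) * t + t) * expR (- expR t)); first by rewrite expRD; ring.
    by congr (expR _ * _); ring.
  - move=> x x0; apply: cvgM; first exact: continuous_powR_pos.
    by apply: (continuous_comp (f := -%R) (g := expR)); [apply: cvgN; exact: cvg_id|exact: continuous_expR].
  - by move=> x x0; rewrite mulr_ge0 ?expR_ge0 ?powR_ge0.
have G0 : (0 <= \int[leb]_t (G t)%:E)%E.
  by apply: integral_ge0 => t _; rewrite lee_fin mulr_ge0 ?expR_ge0.
apply/esym; rewrite fineK// ge0_fin_numE//; exact: G_lty.
Qed.

Lemma gamma_fun_gt0 : 0 < gamma_fun nu.
Proof.
rewrite -lte_fin -gamma_fun_EFin.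
apply: (@lt_le_trans _ _ (expR (- expR 1) * (1 - 0))%:E).
  by rewrite lte_fin subr0 mulr1 expR_gt0.
apply: ge0_integral_ge_itv => //.
  by move=> x; rewrite mulr_ge0 ?expR_ge0.
move=> x /andP[x0 x1]; rewrite /G -[leLHS]mul1r ler_pM ?ler_expR ?expR_ge0//.
  by rewrite -[leLHS]expR0 ler_expR mulr_ge0// ltW.
by rewrite lerN2 ler_expR.
Qed.

(** Normalizing constant of the law of [ln V]. That law has tail [expR (- nu t)] on the right, which
    governs all the rates, and a doubly exponential one on the left. *)
Definition log_inv_gamma_const : R := nu `^ nu / gamma_fun nu.
Definition log_inv_gamma_density (t : R) : R :=
  log_inv_gamma_const * expR (- (nu * t)) * expR (- (nu * expR (- t))).

Local Notation K := log_inv_gamma_const.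
Local Notation q := log_inv_gamma_density.

Lemma log_inv_gamma_const_gt0 : 0 < K.
Proof. by rewrite divr_gt0 ?gamma_fun_gt0// powR_gt0. Qed.

Lemma log_inv_gamma_density_ge0 t : 0 <= q t.
Proof.
by rewrite /q mulr_ge0 ?expR_ge0// mulr_ge0 ?expR_ge0// ltW ?log_inv_gamma_const_gt0.
Qed.

Lemma continuous_log_inv_gamma_density : continuous q.
Proof.
move=> t; apply: cvgM.
  apply: cvgM; first exact: cvg_cst.
  apply: (continuous_comp (f := fun t => - (nu * t)) (g := expR)); last exact: continuous_expR.
  by apply: cvgN; apply: cvgM; [exact: cvg_cst|exact: cvg_id].
apply: (continuous_comp (f := fun t => - (nu * expR (- t))) (g := expR)); last exact: continuous_expR.
apply: cvgN; apply: cvgM; first exact: cvg_cst.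
apply: (continuous_comp (f := -%R) (g := expR)); last exact: continuous_expR.
by apply: cvgN; exact: cvg_id.
Qed.

Lemma measurable_log_inv_gamma_density : measurable_fun setT q.
Proof. apply: continuous_measurable_fun; exact: continuous_log_inv_gamma_density. Qed.

Lemma inv_gamma_densityE t : inv_gamma_density nu nu (expR t) * expR t = q t.
Proof.
rewrite /inv_gamma_density powR_expR -expRN /q -/log_inv_gamma_const.
transitivity (K * expR (- (nu + 1) * t + t) * expR (- (nu * expR (- t)))).
  by rewrite expRD; ring.
by congr (_ * expR _ * _); ring.
Qed.

(** Reflecting [t] and then translating by [- ln nu] absorbs the factor [nu] of the inner
    exponential and leaves the Gamma integrand [G]. *)
Lemma integral_log_inv_gamma_density : (\int[leb]_t (q t)%:E = 1)%E.
Proof.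
have mq := measurable_log_inv_gamma_density.
have mqE : measurable_fun setT (fun t => (q t)%:E) by exact/measurable_EFinP.
have q0E t : (0 <= (q t)%:E)%E by rewrite lee_fin log_inv_gamma_density_ge0.
rewrite -(ge0_integral_oppr mqE q0E).
have mqN : measurable_fun setT (fun t : R => (q (- t))%:E).
  by apply/measurable_EFinP; apply: measurableT_comp.
rewrite -(ge0_integral_shift (- ln nu) mqN (fun t => q0E (- t))).
transitivity (\int[leb]_t ((K / nu `^ nu)%:E * (G t)%:E))%E.
  apply: eq_integral => t _; rewrite -EFinM; congr (_%:E).
  rewrite /q opprK expRD [X in nu * (_ * X)]expRN lnK// mulrCA divff ?gt_eqF// mulr1.
  rewrite /G -/K mulrN opprK mulrDr expRD mulrN.
  have -> : expR (- (nu * ln nu)) = (nu `^ nu)^-1 by rewrite expRN /powR gt_eqF.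
  ring.
rewrite ge0_integralZl//; first last.
- by rewrite lee_fin divr_ge0 ?powR_ge0// ltW// log_inv_gamma_const_gt0.
- by move=> t _; rewrite lee_fin mulr_ge0 ?expR_ge0.
- exact/measurable_EFinP.
rewrite gamma_fun_EFin -EFinM /K; congr (_%:E); field.
by rewrite !gt_eqF ?gamma_fun_gt0 ?powR_gt0.
Qed.

End inverse_gamma.

(** * Matern kernels as Gaussian mixtures *)

Section log_inv_gamma_law.
Context {R : realType}.
Notation leb := (@lebesgue_measure R).
Variable nu : R.
Hypothesis nu0 : 0 < nu.
Local Notation q := (log_inv_gamma_density nu).
Local Notation K := (log_inv_gamma_const nu).

Definition log_inv_gamma_law (ka : probability (measurableTypeR R) R) :=
  forall A, measurable A -> (ka A = \int[leb]_(t in A) (q t)%:E)%E.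

Lemma log_inv_gamma_exists : exists ka, log_inv_gamma_law ka.
Proof.
apply: density_probability.
- exact: log_inv_gamma_density_ge0.
- exact: measurable_log_inv_gamma_density.
- exact: integral_log_inv_gamma_density.
Qed.

Variable ka : probability (measurableTypeR R) R.
Hypothesis kaP : log_inv_gamma_law ka.

Lemma ge0_integral_log_inv_gamma (f : R -> R) : measurable_fun setT f ->
  (forall t, 0 <= f t) ->
  (\int[ka]_t (f t)%:E = \int[leb]_t (f t * q t)%:E)%E.
Proof.
move=> mf f0.
have mfE : measurable_fun setT (EFin \o f) by exact/measurable_EFinP.
have f0E t : (0 <= (EFin \o f) t)%E by rewrite lee_fin.
exact: (integral_density (measurable_log_inv_gamma_density nu) kaP mfE f0E).
Qed.

Lemma cosh_even (t : R) : cosh (- t) = cosh t.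
Proof. by rewrite /cosh opprK addrC. Qed.

Lemma continuous_scale_expR (k a : R) : continuous (fun t : R => expR (k * t) * a).
Proof.
move=> t; apply: cvgM; last exact: cvg_cst.
apply: (continuous_comp (f := fun t => k * t) (g := expR)); last exact: continuous_expR.
by apply: cvgM; [exact: cvg_cst|exact: cvg_id].
Qed.

Lemma continuous_cosh (k : R) : continuous (fun t : R => cosh (k * t)).
Proof.
rewrite (_ : (fun t => _) = (fun t => (expR (k * t) * 1 + expR (- k * t) * 1) / 2)); last first.
  by apply/funext => t; rewrite /cosh mulNr !mulr1.
move=> t; apply: cvgM; last exact: cvg_cst.
by apply: cvgD; exact: continuous_scale_expR.
Qed.

Lemma cosh_ge0 (t : R) : 0 <= cosh t.
Proof. by rewrite divr_ge0// addr_ge0 ?expR_ge0. Qed.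

(* Symmetrizing [t] turns the Bessel integral into a two-sided Laplace one. *)
Lemma besselK_Laplace (z : R) : 0 < z ->
  (\int[leb]_t (expR (- (nu * t)) * expR (- (z * cosh t)))%:E < +oo)%E ->
  (\int[leb]_t (expR (- (nu * t)) * expR (- (z * cosh t)))%:E =
   (2 * besselK nu z)%:E)%E.
Proof.
move=> z0 fin.
pose w (t : R) := expR (- (z * cosh t)).
have cw : continuous w.
  move=> t; apply: (continuous_comp (f := fun t => - (z * cosh t)) (g := expR)); last exact: continuous_expR.
  apply: cvgN; apply: cvgM; first exact: cvg_cst.
  by have := @continuous_cosh 1 t; under eq_fun do rewrite mul1r.
pose f1 (t : R) := expR (- (nu * t)) * w t.
pose f2 (t : R) := expR (nu * t) * w t.
pose g (t : R) := w t * cosh (nu * t).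
have cf2 : continuous f2.
  move=> t; apply: cvgM; last exact: cw.
  by have := @continuous_scale_expR nu 1 t; under eq_fun do rewrite mulr1.
have mf2 : measurable_fun setT f2 by exact: continuous_measurable_fun.
have cf1 : continuous f1.
  move=> t; apply: cvgM; last exact: cw.
  by have := @continuous_scale_expR (- nu) 1 t; under eq_fun do rewrite mulr1 mulNr.
have mf1 : measurable_fun setT f1 by exact: continuous_measurable_fun.
have f20 t : (0 <= (f2 t)%:E)%E by rewrite lee_fin mulr_ge0 ?expR_ge0.
have f10 t : (0 <= (f1 t)%:E)%E by rewrite lee_fin mulr_ge0 ?expR_ge0.
have e12 : (\int[leb]_t (f1 t)%:E = \int[leb]_t (f2 t)%:E)%E.
  have mf2E : measurable_fun setT (fun t => (f2 t)%:E) by exact/measurable_EFinP.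
  rewrite -(ge0_integral_oppr mf2E f20).
  by apply: eq_integral => t _; rewrite /f1 /f2 /w mulrN cosh_even.
have cg : continuous g.
  by move=> t; apply: cvgM; [exact: cw|exact: continuous_cosh].
have g0 t : 0 <= g t by rewrite mulr_ge0 ?expR_ge0 ?cosh_ge0.
have esum : (\int[leb]_t (f1 t)%:E + \int[leb]_t (f2 t)%:E = 2%:E * \int[leb]_t (g t)%:E)%E.
  rewrite -ge0_integralD//; last 2 first.
  - exact/measurable_EFinP.
  - exact/measurable_EFinP.
  rewrite -ge0_integralZl//; last 2 first.
  - by apply/measurable_EFinP; exact: continuous_measurable_fun.
  - by move=> t _; rewrite lee_fin.
  apply: eq_integral => t _; rewrite -EFinD -EFinM; congr (_%:E).
  by rewrite /f1 /f2 /g /cosh; field.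
have ehalf : (\int[leb]_t (g t)%:E = 2%:E * \int[leb]_(t in `]0%R, +oo[) (g t)%:E)%E.
  rewrite ge0_symfun_integralT//; last first.
    by move=> t /=; rewrite /g /w mulrN !cosh_even.
  rewrite -set_itvcy integral_itv_obnd_cbnd//.
  by apply/measurable_EFinP; apply: measurable_funTS; exact: continuous_measurable_fun.
have I0 : (0 <= \int[leb]_t (f1 t)%:E)%E by exact: integral_ge0.
have fI : (\int[leb]_t (f1 t)%:E)%E \is a fin_num by rewrite ge0_fin_numE.
rewrite -[LHS](fineK fI); congr (_%:E).
move: esum; rewrite -e12 ehalf -(fineK fI) -EFinD.
have J0 : (0 <= \int[leb]_(t in `]0%R, +oo[) (g t)%:E)%E by apply: integral_ge0 => t _; rewrite lee_fin.
rewrite -/(Rintegral leb setT f1).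
have -> : besselK nu z = fine (\int[leb]_(t in `]0%R, +oo[) (g t)%:E)%E by [].
move: J0; case: (\int[leb]_(t in _) _)%E => [j| |]//= _.
  by rewrite -!EFinM => -[]; move: (Rintegral _ _ _) => I; lra.
have two : (2%:E * +oo = +oo :> \bar R)%E by rewrite mulry gtr0_sg// mul1e.
by rewrite !two.
Qed.

(** A suitable translation of [t] balances the Gaussian exponent, in [expR t], against that of the
    density, in [expR (- t)]: together they become [z * cosh t], and the integral is the Laplace
    form of [besselK]. *)
Lemma matern_mixture (ell s : R) : 0 < ell -> 0 <= s ->
  matern (Num.sqrt s) ell nu = \int[ka]_t expR (- (s * (expR t / (2 * ell ^+ 2)))).
Proof.
move=> ell0; rewrite le_eqVlt => /predU1P[<-|s0].
  rewrite /matern sqrtr0 eqxx.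
  under eq_Rintegral do rewrite mul0r oppr0 expR0.
  by rewrite bm_Rintegral_cst.
set z := Num.sqrt (2 * nu) * Num.sqrt s / ell.
have z0 : 0 < z by rewrite divr_gt0// mulr_gt0// sqrtr_gt0// mulr_gt0.
have z2 : z ^+ 2 = 2 * nu * s / ell ^+ 2.
  by rewrite /z expr_div_n exprMn !sqr_sqrtr// ?ltW// mulr_gt0.
pose f (t : R) := expR (- (s * (expR t / (2 * ell ^+ 2)))).
have bf : bounded_measurable (f : measurableTypeR R -> R).
  apply: bm_expRN => [|t]; last by rewrite mulr_ge0 ?ltW// divr_gt0 ?expR_gt0// mulr_gt0// exprn_gt0.
  by apply: measurable_funM => //; apply: measurable_funM.
have f0 t : 0 <= f t by exact: expR_ge0.
have eka : (\int[ka]_t (f t)%:E = (\int[ka]_t f t)%:E)%E by exact: bm_EFin_Rintegral.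
have mq := measurable_log_inv_gamma_density nu.
have mfq : measurable_fun setT (fun t => (f t * q t)%:E).
  by apply/measurable_EFinP; apply: measurable_funM => //; exact: (bm_measurable bf).
have fq0 t : (0 <= (f t * q t)%:E)%E by rewrite lee_fin mulr_ge0// log_inv_gamma_density_ge0.
(* Translating by [ln c] gives both [expR t] and [expR (- t)] the coefficient [z / 2]. *)
set c := 2 * nu / z.
have c0 : 0 < c by rewrite divr_gt0// mulr_gt0.
have key : (\int[ka]_t (f t)%:E = (K / c `^ nu)%:E *
    \int[leb]_t (expR (- (nu * t)) * expR (- (z * cosh t)))%:E)%E.
  rewrite ge0_integral_log_inv_gamma//; last exact: (bm_measurable bf).
  transitivity (\int[leb]_t ((K / c `^ nu)%:E * (expR (- (nu * t)) * expR (- (z * cosh t)))%:E))%E; last rewrite ge0_integralZl//.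
  - etransitivity; first exact: (esym (ge0_integral_shift (ln c) mfq fq0)).
    apply: eq_integral => t _; rewrite -EFinM; congr (_%:E).
    rewrite /f /log_inv_gamma_density opprD !expRD expRN lnK//.
    rewrite mulrDr opprD expRD.
    have -> : expR (- (nu * ln c)) = (c `^ nu)^-1 by rewrite expRN /powR gt_eqF.
    rewrite mulrCA (_ : s * _ = z / 2 * expR t); last first.
      have -> : s = z ^+ 2 * ell ^+ 2 / (2 * nu).
        by rewrite z2; field; rewrite !gt_eqF.
      by rewrite /c; field; rewrite !gt_eqF.
    rewrite (_ : nu * (expR (- t) * expR (- ln c)) = z / 2 * expR (- t)); last first.
      by rewrite [expR (- ln c)]expRN lnK// /c; field; rewrite !gt_eqF.
    rewrite (_ : z * cosh t = z / 2 * expR t + z / 2 * expR (- t)); last first.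
      by rewrite /cosh; field.
    rewrite opprD expRD [expR (- (z / 2 * expR t))]expRN; ring.
  - apply/measurable_EFinP; apply: measurable_funM.
      by do 2 apply: measurableT_comp => //; apply: measurable_funM.
    do 2 apply: measurableT_comp => //; apply: measurable_funM => //.
    apply: continuous_measurable_fun; have := @continuous_cosh 1.
    by under eq_fun do rewrite mul1r.
  - by rewrite lee_fin divr_ge0 ?powR_ge0// ltW ?log_inv_gamma_const_gt0.
have kc0 : 0 < K / c `^ nu by rewrite divr_gt0 ?log_inv_gamma_const_gt0// powR_gt0.
have L0 : (0 <= \int[leb]_t (expR (- (nu * t)) * expR (- (z * cosh t)))%:E)%E.
  by apply: integral_ge0 => t _; rewrite lee_fin mulr_ge0 ?expR_ge0.
(* Finiteness is inherited through [key]: a positive multiple of this integral is the integral of a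
   bounded function against [ka]. *)
have fin : (\int[leb]_t (expR (- (nu * t)) * expR (- (z * cosh t)))%:E < +oo)%E.
  move: key L0; rewrite eka; case: (\int[leb]_t _)%E => [j| |]//=; first by rewrite ltry.
  by rewrite mulry gtr0_sg// mul1e.
rewrite (besselK_Laplace z0 fin) eka -EFinM in key.
case: key => ->.
rewrite /matern gt_eqF ?sqrtr_gt0// -/z /log_inv_gamma_const mulrA; congr (_ * _).
have -> : 2 `^ (1 - nu) = 2 * (2 `^ nu)^-1 :> R.
  by rewrite powRB ?powRr1// implybE pnatr_eq0 orbT.
have -> : c `^ nu = 2 `^ nu * nu `^ nu / z `^ nu.
  rewrite /c powRM ?invr_ge0 ?ltW// ?mulr_gt0// powRM// ?ltW//.
  by rewrite -[z^-1]powR_inv1 ?ltW// -powRrM mulN1r powRN.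
by field; rewrite !gt_eqF ?powR_gt0 ?gamma_fun_gt0.
Qed.

End log_inv_gamma_law.

Section inv_gamma_expectation.
Context {R : realType}.
Notation leb := (@lebesgue_measure R).
Variable nu : R.
Hypothesis nu0 : 0 < nu.
Variable ka : probability (measurableTypeR R) R.
Hypothesis kaP : log_inv_gamma_law nu ka.

Lemma continuous_inv_gamma_density (x : R) : 0 < x ->
  {for x, continuous (inv_gamma_density nu nu)}.
Proof.
move=> x0; apply: cvgM.
  by apply: cvgM; [exact: cvg_cst|exact: continuous_powR_pos].
apply: (continuous_comp (f := fun v : R => - (nu / v)) (g := @expR R)); last exact: continuous_expR.
apply: cvgN; apply: cvgM; first exact: cvg_cst.
by apply: cvgV; [rewrite gt_eqF|exact: cvg_id].
Qed.

Lemma inv_gamma_density_ge0 (x : R) : 0 <= inv_gamma_density nu nu x.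
Proof.
rewrite /inv_gamma_density mulr_ge0 ?expR_ge0// mulr_ge0 ?powR_ge0//.
by rewrite divr_ge0 ?powR_ge0// ltW// gamma_fun_gt0.
Qed.

Context {d} {Omega : measurableType d} (P : probability Omega R) (V : {RV P >-> R}).
Hypothesis lawV : has_inv_gamma_law V nu nu.

(** Expectations of [V] become integrals against [ka], whatever the probability space carrying [V];
    [rho] and [rho_lower] can then be compared. *)
Lemma inv_gamma_expectation (g : R -> R) : measurable_fun setT g ->
  (forall x, 0 <= g x) -> (forall x, 0 < x -> {for x, continuous g}) ->
  (\int[P]_w (g (V w))%:E = \int[ka]_t (g (expR t))%:E)%E.
Proof.
move=> mg g0 cg.
pose I : set R := `]0, +oo[%classic.
(* The formula is a density on the positive half-line only, hence the truncation. *)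
pose dens : R -> R := inv_gamma_density nu nu \_ I.
have mI : measurable I by rewrite /I; exact: measurable_itv.
have mdens : measurable_fun setT dens.
  suff mD : measurable_fun I (inv_gamma_density nu nu).
    exact: (measurable_restrictT _ mI).1 mD.
  apply: open_continuous_measurable_fun; first by rewrite /I; exact: interval_open.
  move=> x; rewrite inE/= /I/= in_itv/= andbT => x0.
  exact: continuous_inv_gamma_density.
have dens0 x : 0 <= dens x.
  by apply: restrict_ge0 => y _; exact: inv_gamma_density_ge0.
have law A : measurable A -> (distribution P V A = \int[leb]_(x in A) (dens x)%:E)%E.
  move=> mA; rewrite lawV// integral_mkcondr; apply: eq_integral => x _.
  by rewrite /dens !patchE; case: ifPn.
have mgE : measurable_fun [set: R] (EFin \o g) by exact/measurable_EFinP.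
have gE0 x : (0 <= (EFin \o g) x)%E by rewrite lee_fin.
have mV : measurable_fun [set: Omega] (V : Omega -> measurableTypeR R).
  exact: (measurable_funPT V).
pose V' : {mfun Omega >-> measurableTypeR R} := HB.pack (V : Omega -> measurableTypeR R) (isMeasurableFun.Build _ _ _ _ _ mV).
transitivity (\int[distribution P V']_x (EFin \o g) x)%E.
  by rewrite ge0_integral_distribution.
have dlaw A : measurable A -> (distribution P V' A = \int[leb]_(x in A) (dens x)%:E)%E.
  by move=> mA; exact: law.
rewrite (integral_density mdens dlaw mgE gE0).
transitivity (\int[leb]_(x in I) (g x * inv_gamma_density nu nu x)%:E)%E.
  rewrite [RHS]integral_mkcond; apply: eq_integral => x _.
  rewrite /dens !patchE; case: ifPn => _; first by rewrite EFinM.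
  by rewrite mule0.
rewrite ge0_integral_expR_subst; last 2 first.
- by move=> x x0; apply: cvgM; [exact: cg|exact: continuous_inv_gamma_density].
- by move=> x _; rewrite mulr_ge0// inv_gamma_density_ge0.
rewrite (ge0_integral_log_inv_gamma kaP)//.
- by apply: eq_integral => t _; rewrite -mulrA inv_gamma_densityE.
- exact: measurableT_comp.
Qed.

End inv_gamma_expectation.

(** * Asymptotics *)

Section inv_sqrt_power.
Context {R : realType}.
Implicit Types (y x : R) (n : nat).

(** Multiplying by the square root and squaring leaves polynomial inequalities. The coefficient 1/2
    of [y^2] is a convenient majorant of the Taylor coefficient 3/8, valid for all [y >= 0]. *)
Lemma inv_sqrt_bounds y : 0 <= y ->
  [/\ 0 < (Num.sqrt (1 + y))^-1, (Num.sqrt (1 + y))^-1 <= 1,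
      1 - y / 2 <= (Num.sqrt (1 + y))^-1 &
      (Num.sqrt (1 + y))^-1 <= 1 - y / 2 + y ^+ 2 / 2].
Proof.
move=> y0; set s := Num.sqrt (1 + y).
have s2 : s ^+ 2 = 1 + y by rewrite sqr_sqrtr//; lra.
have s0 : 0 < s by rewrite sqrtr_gt0; lra.
have s1 : 1 <= s by rewrite -[leLHS]sqrtr1 ler_sqrt; lra.
split.
- by rewrite invr_gt0.
- by rewrite invf_le1.
- rewrite -[leRHS]mul1r ler_pdivlMr//.
  have [y2|y2] := leP y 2; last by have : (1 - y / 2) * s <= 0; nra.
  rewrite -(@ler_pXn2r _ 2)// ?nnegrE//; last by rewrite mulr_ge0 ?(ltW s0)//; lra.
  rewrite exprMn s2 expr1n; nra.
- rewrite -[leLHS]mul1r ler_pdivrMr//.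
  have w0 : 0 <= 1 - y / 2 + y ^+ 2 / 2 by nra.
  rewrite -(@ler_pXn2r _ 2)// ?nnegrE//; last by rewrite mulr_ge0// ltW.
  rewrite exprMn s2 expr1n.
  have -> : (1 - y / 2 + y ^+ 2 / 2) ^+ 2 * (1 + y) =
    1 + y ^+ 2 / 4 * (1 + 3 * y - y ^+ 2 + y ^+ 3) by field.
  rewrite lerDl mulr_ge0//; first by rewrite divr_ge0// sqr_ge0.
  have -> : 1 + 3 * y - y ^+ 2 + y ^+ 3 = 1 + y * (11 / 4 + (y - 1 / 2) ^+ 2) by field.
  by rewrite addr_ge0// mulr_ge0// addr_ge0// ?sqr_ge0.
Qed.

Variable T : nat.
(** The function [p] of the overview, in the form produced by the Gaussian integrals: one inverse
    square root per coordinate. *)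
Definition inv_sqrt_pow y := Num.sqrt (1 + y) ^- T.
Local Notation p := inv_sqrt_pow.

Lemma inv_sqrt_pow_gt0 y : 0 <= y -> 0 < p y.
Proof. by move=> y0; rewrite /p -exprVn exprn_gt0//; have [] := inv_sqrt_bounds y0. Qed.

Lemma inv_sqrt_pow_le1 y : 0 <= y -> p y <= 1.
Proof.
by move=> y0; rewrite /p -exprVn exprn_ile1//; have [/ltW] := inv_sqrt_bounds y0.
Qed.

(** Induction in the manner of Bernoulli: [(1 - u) (1 - q) >= 0] gives [u q >= u + q - 1]. *)
Lemma inv_sqrt_pow_ge y : 0 <= y -> 1 - T%:R / 2 * y <= p y.
Proof.
move=> y0; have [u0 u1 lu _] := inv_sqrt_bounds y0; rewrite /p -exprVn.
elim: T => [|n IH]; first by rewrite expr0 !mul0r subr0.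
have q1 : ((Num.sqrt (1 + y))^-1) ^+ n <= 1 by rewrite exprn_ile1// ltW.
have q0 : 0 <= ((Num.sqrt (1 + y))^-1) ^+ n by rewrite exprn_ge0// ltW.
rewrite exprS -natr1; move: u0 u1 lu q0 q1 IH; set u := (_)^-1; set q := u ^+ n => *.
have : 0 <= (1 - u) * (1 - q) by rewrite mulr_ge0//; lra.
by lra.
Qed.

(** Multiplying by one more factor [u] creates three errors: the previous one, that of [u] (at most
    [y^2 / 2]), and the cross term (at most [n y^2 / 4]). *)
Lemma inv_sqrt_pow_taylor : exists2 C, 0 <= C &
  forall y, 0 <= y -> `|p y - 1 + T%:R / 2 * y| <= C * y ^+ 2.
Proof.
rewrite /p; elim: T => [|n [C C0 IH]].
  by exists 0 => // y y0; rewrite expr0 invr1 subrr !mul0r addr0 normr0.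
exists (C + 1 / 2 + n%:R / 4); first by rewrite !addr_ge0// divr_ge0.
move=> y y0; have [u0 u1 lu uu] := inv_sqrt_bounds y0; have {IH} := IH y y0.
rewrite -!exprVn -[n.+1%:R]natr1 [(_^-1) ^+ n.+1]exprS; set u := (_)^-1 in u0 u1 lu uu *.
move=> IH.
have -> : u * u ^+ n - 1 + (n%:R + 1) / 2 * y =
  u * (u ^+ n - 1 + n%:R / 2 * y) + (u - 1 + y / 2) + n%:R / 2 * y * (1 - u) by field.
have h1 : `|u * (u ^+ n - 1 + n%:R / 2 * y)| <= C * y ^+ 2.
  by rewrite normrM (gtr0_norm u0); apply: le_trans IH; rewrite ler_piMl.
have h2 : `|u - 1 + y / 2| <= 1 / 2 * y ^+ 2 by rewrite ger0_norm; lra.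
have h3 : `|n%:R / 2 * y * (1 - u)| <= n%:R / 4 * y ^+ 2.
  rewrite ger0_norm; last by rewrite !mulr_ge0//; lra.
  have -> : n%:R / 4 * y ^+ 2 = n%:R / 2 * y * (y / 2) :> R by field.
  by rewrite ler_wpM2l ?mulr_ge0//; lra.
apply: le_trans (ler_normD _ _) _; apply: le_trans (lerD (ler_normD _ _) h3) _.
by lra.
Qed.

(** A single factor suffices: on [[0, 1]], [(1 - y / 4)^2 (1 + y) >= 1]. *)
Lemma inv_sqrt_pow_deficit y : (1 <= T)%N -> 0 <= y <= 1 -> y / 4 <= 1 - p y.
Proof.
move=> T1 /andP[y0 y1]; have [u0 u1 _ _] := inv_sqrt_bounds y0.
set u := (_)^-1 in u0 u1.
have pu : p y <= u.
  by rewrite /p -exprVn -/u -(prednK T1) exprS ler_piMr ?(ltW u0)// exprn_ile1 ?(ltW u0).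
suff : u <= 1 - y / 4 by lra.
have s2 : Num.sqrt (1 + y) ^+ 2 = 1 + y by rewrite sqr_sqrtr//; lra.
have s0 : 0 < Num.sqrt (1 + y) by rewrite sqrtr_gt0; lra.
rewrite /u -[leLHS]mul1r ler_pdivrMr// -(@ler_pXn2r _ 2)// ?nnegrE//; last first.
  by rewrite mulr_ge0 ?(ltW s0)//; lra.
by rewrite exprMn s2 expr1n; nra.
Qed.

Lemma inv_sqrt_pow_anti x y : 0 <= x -> x < y -> (1 <= T)%N -> p y < p x.
Proof.
move=> x0 xy T1; rewrite /p ltf_pV2 ?posrE ?exprn_gt0 ?sqrtr_gt0//; [|lra|lra].
rewrite ltr_pXn2r// ?nnegrE ?sqrtr_ge0//.
by rewrite ltr_sqrt; lra.
Qed.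

Lemma inv_sqrt_powM x : 0 <= x -> p (3 * x) * p x = p (4 * x + 3 * x ^+ 2).
Proof.
move=> x0; rewrite /p -invfM -exprMn -sqrtrM; last lra.
by congr (Num.sqrt _ ^- _); ring.
Qed.

(** Constant and linear Taylor terms cancel in both combinations, since [2 * 2 = 4] and [3 + 1 = 4].
    The minimum with 1 records that they are bounded for large [x]. *)
Lemma inv_sqrt_pow_second_order : exists2 C, 0 <= C & forall x, 0 <= x ->
  `|1 - 2 * p (2 * x) + p (4 * x)| <= C * Num.min 1 (x ^+ 2) /\
  `|p (4 * x) - p (3 * x) * p x| <= C * Num.min 1 (x ^+ 2).
Proof.
have [C C0 hC] := inv_sqrt_pow_taylor.
pose a : R := T%:R / 2.
have a0 : 0 <= a by rewrite divr_ge0.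
(* The Taylor errors amount to [(8 + 16) C] for the first combination and [(16 + 9 + 1) C] for the
   second, where the cross term adds [3 a^2]; the last 3 is the crude bound for large [x]. *)
exists (26 * C + 3 * a ^+ 2 + 3).
  by rewrite !addr_ge0// mulr_ge0// sqr_ge0.
move=> x x0.
have x1 : 0 <= 2 * x by lra.
have x3 : 0 <= 3 * x by lra.
have x4 : 0 <= 4 * x by lra.
have := (inv_sqrt_pow_gt0 x0, inv_sqrt_pow_le1 x0, inv_sqrt_pow_gt0 x1, inv_sqrt_pow_le1 x1,
  inv_sqrt_pow_gt0 x3, inv_sqrt_pow_le1 x3, inv_sqrt_pow_gt0 x4, inv_sqrt_pow_le1 x4).
have e1 := hC _ x0; have e2 := hC _ x1; have e3 := hC _ x3; have e4 := hC _ x4.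
have l3 := inv_sqrt_pow_ge x3.
rewrite -/a in e1 e2 e3 e4 l3.
rewrite !exprMn in e2 e3 e4.
move: e1 e2 e3 e4 l3.
move: (p x) (p (2 * x)) (p (3 * x)) (p (4 * x)) => p1 p2 p3 p4 e1 e2 e3 e4 l3.
move=> [[[[[[[p10 p11] p20] p21] p30] p31] p40] p41].
have X0 : 0 <= x ^+ 2 by exact: sqr_ge0.
have A0 : 0 <= a ^+ 2 by exact: sqr_ge0.
have b1 : `|1 - 2 * p2 + p4| <= 24 * C * x ^+ 2.
  move: e2 e4; rewrite !ler_norml => /andP[? ?] /andP[? ?]; apply/andP; split; lra.
have b2 : `|p4 - p3 * p1| <= (26 * C + 3 * a ^+ 2) * x ^+ 2.
  have -> : p4 - p3 * p1 = (p4 - 1 + a * (4 * x)) - (p3 - 1 + a * (3 * x)) - p3 * (p1 - 1 + a * x) - a * x * (1 - p3) by ring.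
  have h1 : `|p3 * (p1 - 1 + a * x)| <= C * x ^+ 2.
    by rewrite normrM (gtr0_norm p30); apply: le_trans e1; rewrite ler_piMl.
  have h2 : `|a * x * (1 - p3)| <= 3 * a ^+ 2 * x ^+ 2.
    rewrite ger0_norm; last by rewrite !mulr_ge0//; lra.
    have -> : 3 * a ^+ 2 * x ^+ 2 = a * x * (a * (3 * x)) by ring.
    by rewrite ler_wpM2l ?mulr_ge0//; lra.
  move: h1 h2 e3 e4; rewrite !ler_norml => /andP[? ?] /andP[? ?] /andP[? ?] /andP[? ?].
  by apply/andP; split; lra.
have c1 : `|1 - 2 * p2 + p4| <= 3 by rewrite ler_norml; apply/andP; split; lra.
have c2 : `|p4 - p3 * p1| <= 3.
  have : 0 <= p3 * p1 by rewrite mulr_ge0 ?ltW.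
  have : p3 * p1 <= 1 by rewrite mulr_ile1 ?(ltW p30) ?(ltW p10).
  by move: (p3 * p1) => pp *; rewrite ler_norml; apply/andP; split; lra.
have mm (z : R) : `|z| <= (26 * C + 3 * a ^+ 2) * x ^+ 2 -> `|z| <= 3 ->
    `|z| <= (26 * C + 3 * a ^+ 2 + 3) * Num.min 1 (x ^+ 2).
  move=> z1 z3; have [h|h] := leP 1 (x ^+ 2).
    by rewrite mulr1; apply: le_trans z3 _; rewrite lerDr !addr_ge0// mulr_ge0.
  apply: le_trans z1 _; rewrite ler_wpM2r// lerDl.
  by [].
split; apply: mm => //.
by apply: le_trans b1 _; rewrite ler_wpM2r//; lra.
Qed.

End inv_sqrt_power.

(** * Bounds on expectations under the mixing law *)

Section log_inv_gamma_bounds.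
Context {R : realType}.
Notation leb := (@lebesgue_measure R).
Variables (nu : R) (T : nat).
Hypothesis nu0 : 0 < nu.
Hypothesis T1 : (1 <= T)%N.
Variable ka : probability (measurableTypeR R) R.
Hypothesis kaP : log_inv_gamma_law nu ka.
Local Notation q := (log_inv_gamma_density nu).
(* locked, lest [mulr_ge0] and the like see through the constant *)
Local Notation K := (locked (log_inv_gamma_const nu)).
Local Notation p := (@inv_sqrt_pow R T).

Let K0 : 0 < K. Proof. by rewrite -lock; exact: log_inv_gamma_const_gt0. Qed.
Let qE t : q t = K * expR (- (nu * t)) * expR (- (nu * expR (- t))).
Proof. by rewrite -lock. Qed.
Let q0 t : 0 <= q t. Proof. exact: log_inv_gamma_density_ge0. Qed.
Let mq : measurable_fun setT q. Proof. exact: measurable_log_inv_gamma_density. Qed.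

Definition exp_abs_integral (b : R) : R := fine (\int[leb]_t (expR (- (b * `|t|)))%:E)%E.

Let mexp (b s : R) : measurable_fun setT (fun t : R => expR (- (b * `|t + s|))).
Proof.
do 2 apply: measurableT_comp => //; apply: measurable_funM => //.
by apply: measurableT_comp => //; exact: measurable_funD.
Qed.

Lemma integral_exp_abs_shift (b s : R) : 0 < b ->
  (\int[leb]_t (expR (- (b * `|t + s|)))%:E = (exp_abs_integral b)%:E)%E.
Proof.
move=> b0.
have m0 : measurable_fun setT (fun t : R => (expR (- (b * `|t|)))%:E).
  by apply/measurable_EFinP; have := mexp b 0; under eq_fun do rewrite addr0.
have p0 (t : R) : (0 <= (expR (- (b * `|t|)))%:E)%E by rewrite lee_fin expR_ge0.
have h := ge0_integral_shift s m0 p0.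
etransitivity; first exact: h.
rewrite /exp_abs_integral fineK// ge0_fin_numE; last exact: integral_ge0.
exact: integral_expR_abs_lty.
Qed.

(** The right-hand side is independent of the translation [s]; with [s = ln x] this yields constants
    uniform in [x]. *)
Lemma Rintegral_ka_le (f : R -> R) (C b s : R) :
  bounded_measurable (f : measurableTypeR R -> R) -> (forall t, 0 <= f t) ->
  0 < b -> 0 <= C -> (forall t, f t * q t <= C * expR (- (b * `|t + s|))) ->
  \int[ka]_t f t <= C * exp_abs_integral b.
Proof.
move=> bf f0 b0 C0 fq; rewrite -lee_fin -(bm_EFin_Rintegral ka bf).
rewrite (ge0_integral_log_inv_gamma kaP (bm_measurable bf) f0) EFinM -(integral_exp_abs_shift s b0).
have mE : measurable_fun setT (fun t : R => (expR (- (b * `|t + s|)))%:E).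
  exact/measurable_EFinP.
have pE t : setT t -> (0 <= (expR (- (b * `|t + s|)))%:E)%E.
  by move=> _; rewrite lee_fin expR_ge0.
have C0E : (0 <= C%:E)%E by rewrite lee_fin.
rewrite -(ge0_integralZl leb measurableT mE pE C0E).
apply: ge0_le_integral => //.
- by move=> t _; rewrite lee_fin mulr_ge0.
- by apply/measurable_EFinP; apply: measurable_funM => //; exact: (bm_measurable bf).
- exact: emeasurable_funM.
- by move=> t _; rewrite -EFinM lee_fin.
Qed.

Lemma Rintegral_ka_ge (f : R -> R) (k a b : R) :
  bounded_measurable (f : measurableTypeR R -> R) -> (forall t, 0 <= f t) ->
  a <= b -> 0 <= k -> (forall t, a <= t <= b -> k <= f t * q t) ->
  k * (b - a) <= \int[ka]_t f t.
Proof.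
move=> bf f0 ab k0 fk; rewrite -lee_fin -(bm_EFin_Rintegral ka bf).
rewrite (ge0_integral_log_inv_gamma kaP (bm_measurable bf) f0).
apply: ge0_integral_ge_itv => //.
  by apply: measurable_funM => //; exact: (bm_measurable bf).
by move=> t; rewrite mulr_ge0.
Qed.

(** A zero integral would force [f = 0] almost everywhere, making the whole space negligible for a
    probability. *)
Lemma Rintegral_gt0 (f : R -> R) :
  bounded_measurable (f : measurableTypeR R -> R) -> (forall t, 0 < f t) ->
  0 < \int[ka]_t f t.
Proof.
move=> bf f0.
have mf : measurable_fun setT (EFin \o f).
  by apply/measurable_EFinP; exact: (bm_measurable bf).
rewrite lt_neqAle Rintegral_ge0 ?andbT; last by move=> t _; exact: ltW.
apply/eqP => e0.
have : (\int[ka]_t `|(EFin \o f) t| = 0)%E.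
  under eq_integral => t _ do rewrite /= ger0_norm ?(ltW (f0 t))//.
  by rewrite (bm_EFin_Rintegral ka bf) -e0.
move=> /(ae_eq_integral_abs ka measurableT mf) [A [mA A0 sA]].
have AT : A = setT.
  apply/seteqP; split => // t _; apply: sA => /= /(_ I) [] ft0.
  by have := f0 t; rewrite ft0 ltxx.
by have := probability_setT ka; rewrite -AT A0 => /eqP; rewrite eq_sym onee_eq0.
Qed.

Lemma bm_inv_sqrt_pow (x : R) : 0 <= x ->
  bounded_measurable ((fun t => p (x * expR t)) : measurableTypeR R -> R).
Proof.
move=> x0.
have y0 t : 0 <= x * expR t by rewrite mulr_ge0// expR_ge0.
split; last first.
  by exists 1 => t; rewrite gtr0_norm ?inv_sqrt_pow_gt0// inv_sqrt_pow_le1.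
rewrite /inv_sqrt_pow.
have -> : (fun t : R => Num.sqrt (1 + x * expR t) ^- T) =
   (fun t => expR (- (T%:R / 2 * ln (1 + x * expR t)))).
  apply/funext => t.
  have h : 0 < 1 + x * expR t by rewrite ltr_pwDl.
  rewrite expRN -mulrA expRM_natl; congr (_ ^- _).
  move: h; set y := 1 + _ => h.
  have e : y = (expR (2^-1 * ln y)) ^+ 2 by rewrite -expRM_natl mulrA divff// mul1r lnK.
  by rewrite [in LHS]e sqrtr_sqr gtr0_norm// expR_gt0.
do 2 apply: measurableT_comp => //.
apply: measurable_funM => //; apply: measurableT_comp; first exact: measurable_ln.
by apply: measurable_funD => //; exact: measurable_funM.
Qed.

Definition deficit (x : R) := \int[ka]_t (1 - p (x * expR t)).
(** The truncation keeps this finite when [nu <= 2], where [V] has no second moment. *)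
Definition quad_trunc (x : R) := \int[ka]_t Num.min 1 ((x * expR t) ^+ 2).
Local Notation B := deficit.
Local Notation G := quad_trunc.

Lemma bm_deficit (x : R) : 0 <= x ->
  bounded_measurable ((fun t => 1 - p (x * expR t)) : measurableTypeR R -> R).
Proof. by move=> x0; apply: bmB; [exact: bm_cst|exact: bm_inv_sqrt_pow]. Qed.

Lemma deficit_integrand_ge0 (x t : R) : 0 <= x -> 0 <= 1 - p (x * expR t).
Proof. by move=> x0; rewrite subr_ge0 inv_sqrt_pow_le1// mulr_ge0// expR_ge0. Qed.

Lemma bm_quad_trunc (x : R) :
  bounded_measurable ((fun t => Num.min 1 ((x * expR t) ^+ 2)) : measurableTypeR R -> R).
Proof.
split.
  apply: measurable_minr => //; apply: measurable_funX; exact: measurable_funM.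
exists 1 => t; rewrite ger0_norm; first by rewrite ge_min lexx.
by rewrite le_min ler01 sqr_ge0.
Qed.

Lemma deficitE x : 0 <= x -> \int[ka]_t p (x * expR t) = 1 - B x.
Proof.
move=> x0; rewrite /deficit bm_RintegralB; [|exact: bm_cst|exact: bm_inv_sqrt_pow].
by rewrite bm_Rintegral_cst; ring.
Qed.

Lemma deficit_gt0 x : 0 < x -> 0 < B x.
Proof.
move=> x0; apply: Rintegral_gt0; first by apply: bm_deficit; exact: ltW.
move=> t; rewrite subr_gt0.
have <- : p 0 = 1 by rewrite /inv_sqrt_pow addr0 sqrtr1 expr1n invr1.
by apply: inv_sqrt_pow_anti => //; rewrite mulr_gt0// expR_gt0.
Qed.

Lemma expR_shift_ln (x t : R) : 0 < x -> x * expR t = expR (t + ln x).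
Proof. by move=> x0; rewrite expRD lnK// mulrC. Qed.

Lemma density_le t : q t <= K * expR (- (nu * t)).
Proof.
rewrite qE ler_piMr ?mulr_ge0 ?expR_ge0 ?(ltW K0)//.
by rewrite expR_le1 oppr_le0 mulr_ge0 ?expR_ge0// ltW.
Qed.

(** With the density bounded by [K expR (- nu t)] and [s = t + ln x], the integrand is [x^nu] times
    [min (1, expR (2 s)) expR (- nu s)], which decays at rate [nu] on the right and [2 - nu] on the
    left. *)
Lemma quad_trunc_le : nu < 2 -> exists2 C, 0 < C &
  forall x, 0 < x -> G x <= C * x `^ nu.
Proof.
move=> nu2.
pose b := Num.min nu (2 - nu).
have b0 : 0 < b by rewrite lt_min nu0 subr_gt0.
have I0 : 0 <= exp_abs_integral b.
  by apply: fine_ge0; apply: integral_ge0 => t _; rewrite lee_fin expR_ge0.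
exists (K * exp_abs_integral b + 1); first by rewrite ltr_wpDl// mulr_ge0// ltW.
move=> x x0; have xn0 : 0 <= x `^ nu by exact: powR_ge0.
apply: (@le_trans _ _ (K * x `^ nu * exp_abs_integral b)); last by move: (x `^ nu) xn0 => y; nra.
apply: (@Rintegral_ka_le _ _ _ (ln x)) => //; first exact: bm_quad_trunc.
- by move=> t; rewrite le_min ler01 sqr_ge0.
- by rewrite mulr_ge0// ltW.
move=> t; rewrite expR_shift_ln// -expRM_natl.
have xE : x `^ nu = expR (nu * ln x) by rewrite /powR gt_eqF.
have m0 : 0 <= Num.min 1 (expR (2%:R * (t + ln x))) by rewrite le_min ler01 expR_ge0.
apply: (@le_trans _ _ (Num.min 1 (expR (2%:R * (t + ln x))) * (K * expR (- (nu * t))))).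
  by rewrite ler_wpM2l// density_le.
rewrite mulrCA -mulrA ler_wpM2l ?(ltW K0)//.
have -> : expR (- (nu * t)) = expR (nu * ln x) * expR (- (nu * (t + ln x))).
  by rewrite -expRD; congr expR; ring.
rewrite xE mulrCA ler_wpM2l ?expR_ge0//.
move: (t + ln x) => s.
have [s0|s0] := leP 0 s.
  apply: (@le_trans _ _ (1 * expR (- (nu * s)))).
    by rewrite ler_wpM2r ?expR_ge0// ge_min lexx.
  by rewrite mul1r ler_expR lerN2 ger0_norm// ler_wpM2r// ge_min lexx.
apply: (@le_trans _ _ (expR (2%:R * s) * expR (- (nu * s)))).
  by rewrite ler_wpM2r ?expR_ge0// ge_min lexx orbT.
rewrite -expRD ler_expR ltr0_norm//.
have : b <= 2 - nu by rewrite ge_min lexx orbT.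
by rewrite -/b; move: (b) => b' *; nra.
Qed.

Lemma quad_trunc_le_sqr : 2 < nu -> exists2 C, 0 < C &
  forall x, 0 < x -> G x <= C * x ^+ 2.
Proof.
move=> nu2.
pose b := Num.min (nu - 2) 1.
have b0 : 0 < b by rewrite lt_min subr_gt0 nu2 ltr01.
have I0 : 0 <= exp_abs_integral b.
  by apply: fine_ge0; apply: integral_ge0 => t _; rewrite lee_fin expR_ge0.
exists (K * exp_abs_integral b + 1); first by rewrite ltr_wpDl// mulr_ge0// ltW.
move=> x x0; have xn0 : 0 <= x ^+ 2 by exact: sqr_ge0.
apply: (@le_trans _ _ (K * x ^+ 2 * exp_abs_integral b)); last by move: (x ^+ 2) xn0 => y; nra.
apply: (@Rintegral_ka_le _ _ _ 0) => //; first exact: bm_quad_trunc.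
- by move=> t; rewrite le_min ler01 sqr_ge0.
- by rewrite mulr_ge0// ltW.
move=> t; rewrite addr0.
apply: (@le_trans _ _ ((x * expR t) ^+ 2 * q t)).
  by rewrite ler_wpM2r// ge_min lexx orbT.
rewrite exprMn -expRM_natl qE.
have -> : x ^+ 2 * expR (2 * t) * (K * expR (- (nu * t)) * expR (- (nu * expR (- t)))) =
  K * x ^+ 2 * expR (2 * t - nu * t - nu * expR (- t)) by rewrite !expRD; ring.
apply: ler_wpM2l; first by rewrite mulr_ge0 ?(ltW K0).
rewrite ler_expR.
have b1 : b <= 1 by rewrite ge_min lexx orbT.
have b2 : b <= nu - 2 by rewrite ge_min lexx.
have e0 := expR_ge0 (- t); have e1 := expR_ge1Dx (- t).
rewrite -/b; move: (b) b1 b2 (expR _) e0 e1 => b' b1 b2 e e0 e1.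
have [t0|t0] := leP 0 t; first by rewrite ger0_norm//; nra.
rewrite ltr0_norm//.
have h : nu * (1 - t) <= nu * e by rewrite ler_wpM2l ?(ltW nu0).
nra.
Qed.

Lemma deficit_integrand_ge (x t : R) : 0 < x -> t + ln x <= 0 ->
  expR (t + ln x) / 4 <= 1 - p (x * expR t).
Proof.
move=> x0 tx; rewrite expR_shift_ln//; apply: inv_sqrt_pow_deficit => //.
by rewrite expR_ge0 expR_le1.
Qed.

Lemma density_ge t c : - c <= t -> K * expR (- (nu * t)) * expR (- (nu * expR c)) <= q t.
Proof.
move=> ct; rewrite qE ler_wpM2l ?mulr_ge0 ?expR_ge0 ?(ltW K0)//.
by rewrite ler_expR lerN2 ler_wpM2l ?(ltW nu0)// ler_expR lerNl.
Qed.

(** Contribution of [-1 <= t <= 0], where [V] is of order 1: the density is bounded below there and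
    the integrand is at least linear in [x]. *)
Lemma deficit_ge_lin : exists2 c, 0 < c & forall x, 0 < x <= 1 -> c * x <= B x.
Proof.
pose c := expR (-1) / 4 * (K * expR (- (nu * expR 1))).
have c0 : 0 < c by rewrite !mulr_gt0 ?expR_gt0 ?invr_gt0.
exists c => //.
move=> x /andP[x0 x1].
have -> : c * x = c * x * (0 - (-1)) by ring.
apply: Rintegral_ka_ge.
- by apply: bm_deficit; exact: ltW.
- by move=> t; apply: deficit_integrand_ge0; exact: ltW.
- by rewrite lerN10.
- by rewrite mulr_ge0 ?(ltW c0) ?(ltW x0).
move=> t /andP[t1 t0].
have lx : ln x <= 0 by exact: ln_le0.
have h1 : expR (-1) / 4 * x <= 1 - p (x * expR t).
  apply: le_trans (deficit_integrand_ge x0 _); last lra.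
  rewrite mulrAC ler_wpM2r// expRD lnK// ler_wpM2r ?ler_expR//.
  exact: ltW.
have h2 : K * expR (- (nu * expR 1)) <= q t.
  apply: le_trans (@density_ge t 1 _) => //.
  rewrite ler_wpM2r ?expR_ge0// ler_peMr ?(ltW K0)//.
  by rewrite -[leLHS]expR0 ler_expR -mulrN mulr_ge0 ?(ltW nu0)// oppr_ge0.
rewrite /c mulrAC; apply: ler_pM => //.
  by rewrite !mulr_ge0 ?expR_ge0 ?(ltW x0).
by rewrite !mulr_ge0 ?expR_ge0 ?(ltW K0).
Qed.

(** Contribution of the unit window below [- ln x], where [x V] is of order 1: the integrand is
    bounded below and the density is of order [x^nu]. *)
Lemma deficit_ge_pow : exists2 c, 0 < c & forall x, 0 < x <= 1 -> c * x `^ nu <= B x.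
Proof.
pose c := expR (-1) / 4 * (K * expR (- (nu * expR 1))).
have c0 : 0 < c by rewrite !mulr_gt0 ?expR_gt0 ?invr_gt0.
exists c => //.
move=> x /andP[x0 x1].
have lx : ln x <= 0 by exact: ln_le0.
have -> : c * x `^ nu = c * x `^ nu * (- ln x - (- ln x - 1)) by ring.
apply: Rintegral_ka_ge.
- by apply: bm_deficit; exact: ltW.
- by move=> t; apply: deficit_integrand_ge0; exact: ltW.
- by rewrite gerBl.
- by rewrite mulr_ge0 ?(ltW c0) ?powR_ge0.
move=> t /andP[t1 t0].
have h1 : expR (-1) / 4 <= 1 - p (x * expR t).
  apply: le_trans (deficit_integrand_ge x0 _); last by lra.
  by rewrite ler_wpM2r// ler_expR; lra.
have h2 : K * x `^ nu * expR (- (nu * expR 1)) <= q t.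
  apply: le_trans (@density_ge t 1 _); last by lra.
  rewrite ler_wpM2r ?expR_ge0// ler_wpM2l ?(ltW K0)// /powR gt_eqF// ler_expR.
  by rewrite -mulrN ler_wpM2l ?(ltW nu0)//; lra.
rewrite /c -mulrA; apply: ler_pM => //.
- by rewrite !mulr_ge0 ?expR_ge0 ?(ltW K0) ?powR_ge0.
by rewrite mulrAC.
Qed.

(** On [0 <= t <= - ln x] the integrand is at least [x expR t / 4] and the density at least a
    multiple of [expR (- t)]: the exponentials cancel, and the length of the interval supplies the
    logarithm. *)
Lemma deficit_ge_log : nu = 1 -> exists2 c, 0 < c &
  forall x, 0 < x <= 1 -> c * (x * - ln x) <= B x.
Proof.
move=> nu1.
exists (4^-1 * (K * expR (- (nu * expR 0)))).
  by rewrite !mulr_gt0 ?expR_gt0 ?invr_gt0.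
move=> x /andP[x0 x1].
have lx : ln x <= 0 by exact: ln_le0.
rewrite mulrA -[X in _ * X <= _]subr0.
apply: Rintegral_ka_ge.
- by apply: bm_deficit; exact: ltW.
- by move=> t; apply: deficit_integrand_ge0; exact: ltW.
- by rewrite oppr_ge0.
- by rewrite !mulr_ge0 ?expR_ge0 ?(ltW K0) ?(ltW x0) ?invr_ge0.
move=> t /andP[t1 t0].
have h1 : x * expR t / 4 <= 1 - p (x * expR t).
  rewrite {1}expR_shift_ln//; apply: deficit_integrand_ge => //; lra.
have h2 : K * expR (- t) * expR (- (nu * expR 0)) <= q t.
  apply: le_trans (@density_ge t 0 _); last by rewrite oppr0.
  by have := mul1r t; rewrite -[X in X * _]nu1 => ->.
apply: (@le_trans _ _ (x * expR t / 4 * (K * expR (- t) * expR (- (nu * expR 0))))).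
  rewrite le_eqVlt; apply/orP; left; apply/eqP.
  by rewrite [expR (- t)]expRN; field; rewrite gt_eqF// expR_gt0.
apply: ler_pM => //.
- by rewrite !mulr_ge0 ?expR_ge0 ?(ltW x0).
- by rewrite !mulr_ge0 ?expR_ge0 ?(ltW K0).
Qed.

End log_inv_gamma_bounds.

(** * Leading term of the deficit for exponents below 1 *)

Section deficit_small_nu.
Context {R : realType}.
Notation leb := (@lebesgue_measure R).
Variables (nu : R) (T : nat).
Hypothesis nu0 : 0 < nu.
Hypothesis nu1 : nu < 1.
Variable ka : probability (measurableTypeR R) R.
Hypothesis kaP : log_inv_gamma_law nu ka.
Local Notation q := (log_inv_gamma_density nu).
Local Notation K := (locked (log_inv_gamma_const nu)).
Local Notation p := (@inv_sqrt_pow R T).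
Local Notation B := (deficit T ka).

Let K0 : 0 < K. Proof. by rewrite -lock; exact: log_inv_gamma_const_gt0. Qed.
Let qE t : q t = K * expR (- (nu * t)) * expR (- (nu * expR (- t))).
Proof. by rewrite -lock. Qed.

Let b := Num.min nu (1 - nu).
Let b0 : 0 < b. Proof. by rewrite lt_min nu0 subr_gt0. Qed.
Let b_le1 : b <= nu. Proof. by rewrite ge_min lexx. Qed.
Let b_le2 : b <= 1 - nu. Proof. by rewrite ge_min lexx orbT. Qed.

(** The deficit integrand against the pure exponential tail, without the inner exponential of the
    density. It scales exactly: translating by [ln x] gives an integral [J * x^nu]. *)
Let g (x t : R) := (1 - p (x * expR t)) * expR (- (nu * t)).

Let g0 x t : 0 < x -> 0 <= g x t.
Proof. by move=> x0; rewrite mulr_ge0 ?expR_ge0// deficit_integrand_ge0// ltW. Qed.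

Let mg x : 0 < x -> measurable_fun setT (g x).
Proof.
move=> x0; apply: measurable_funM.
  exact: (bm_measurable (bm_deficit T (ltW x0))).
by do 2 apply: measurableT_comp => //; exact: measurable_funM.
Qed.

Let deficit_le x t : 0 < x -> 1 - p (x * expR t) <= T%:R / 2 * (x * expR t).
Proof.
by move=> x0; have := @inv_sqrt_pow_ge R T (x * expR t); rewrite mulr_ge0 ?expR_ge0 ?(ltW x0)// => /(_ isT); lra.
Qed.

Let J := fine (\int[leb]_t (g 1 t)%:E)%E.

(** Decay at rate [nu] on the right, and at rate [1 - nu] on the left, where the deficit is at most
    linear in [expR t]; this is where [nu < 1] enters. *)
Let JE : (\int[leb]_t (g 1 t)%:E = J%:E)%E.
Proof.
rewrite /J fineK// ge0_fin_numE; last by apply: integral_ge0 => t _; rewrite lee_fin g0.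
apply: (@integral_exp_abs_bound_lty R _ (1 + T%:R / 2) b) => //.
- exact: mg.
- by move=> t; exact: g0.
move=> t; rewrite /g.
have h1 : 1 - p (1 * expR t) <= 1.
  by rewrite lerBlDr lerDl ltW// inv_sqrt_pow_gt0// mulr_ge0// expR_ge0.
have h2 := deficit_le t ltr01; rewrite mul1r in h1 h2 *.
have T0 : 0 <= T%:R / 2 :> R by rewrite divr_ge0.
have [t0|t0] := leP 0 t.
  apply: ler_pM; rewrite ?expR_ge0//.
  - by rewrite subr_ge0 inv_sqrt_pow_le1// expR_ge0.
  - by rewrite (le_trans h1)// lerDl.
  - by rewrite ler_expR lerN2 ger0_norm// ler_wpM2r.
apply: (@le_trans _ _ (T%:R / 2 * expR t * expR (- (nu * t)))).
  by rewrite ler_wpM2r ?expR_ge0.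
rewrite -mulrA -expRD; apply: ler_pM; rewrite ?expR_ge0//; first by rewrite lerDr.
rewrite ler_expR ltr0_norm//.
by move: (b) b_le2 => b' h; nra.
Qed.

(** [B x] falls short of the exactly scaling integral [K * J * x^nu] by the integral of [d], the
    mass removed by the inner exponential of the density. That loss is linear in [x]. *)
Lemma deficit_small_nu : exists L C : R, 0 <= C /\
  forall x, 0 < x -> `|B x - L * x `^ nu| <= C * x.
Proof.
pose I := exp_abs_integral b.
have I0 : 0 <= I.
  by apply: fine_ge0; apply: integral_ge0 => t _; rewrite lee_fin expR_ge0.
have T0 : 0 <= T%:R / 2 :> R by rewrite divr_ge0.
exists (K * J), (K * (T%:R / 2) * (1 + nu) * I).
have C0 : 0 <= K * (T%:R / 2) * (1 + nu).
  by rewrite !mulr_ge0 ?(ltW K0)// addr_ge0// ltW.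
split; first by rewrite mulr_ge0.
move=> x x0.
pose d (t : R) := K * g x t * (1 - expR (- (nu * expR (- t)))).
have e1 t : 0 <= 1 - expR (- (nu * expR (- t))).
  by rewrite subr_ge0 expR_le1 oppr_le0 mulr_ge0 ?expR_ge0 ?(ltW nu0).
have d0 t : 0 <= d t by rewrite mulr_ge0// mulr_ge0 ?g0 ?(ltW K0).
have md : measurable_fun setT d.
  apply: measurable_funM; first by apply: measurable_funM => //; exact: mg.
  apply: measurable_funB => //; apply: measurableT_comp => //; apply: measurableT_comp => //.
  by apply: measurable_funM => //; do 2 apply: measurableT_comp => //.
have EB : ((B x)%:E = \int[leb]_t ((1 - p (x * expR t)) * q t)%:E)%E.
  rewrite /deficit -(bm_EFin_Rintegral ka (bm_deficit T (ltW x0))).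
  rewrite (ge0_integral_log_inv_gamma kaP (bm_measurable (bm_deficit T (ltW x0))))//.
  by move=> t; apply: deficit_integrand_ge0; exact: ltW.
have EJ : ((K * J * x `^ nu)%:E = \int[leb]_t (K * g x t)%:E)%E.
  have m1 : measurable_fun setT (fun t : R => (g 1 t)%:E) by apply/measurable_EFinP; exact: mg.
  have p1 (t : R) : (0 <= (g 1 t)%:E)%E by rewrite lee_fin g0.
  have h := ge0_integral_shift (ln x) m1 p1.
  rewrite mulrAC EFinM -JE -h.
  have m2 : measurable_fun setT (fun t : R => (g 1 (t + ln x))%:E).
    by apply/measurable_EFinP; apply: (measurableT_comp (mg ltr01)); exact: measurable_funD.
  have kx0 : (0 <= (K * x `^ nu)%:E)%E by rewrite lee_fin mulr_ge0 ?powR_ge0 ?(ltW K0).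
  rewrite -(ge0_integralZl leb measurableT m2 (fun t _ => p1 _) kx0).
  apply: eq_integral => t _; rewrite -EFinM; congr (_%:E); rewrite /g mul1r -expR_shift_ln//.
  rewrite mulrDr opprD expRD.
  have -> : expR (- (nu * ln x)) = (x `^ nu)^-1 by rewrite expRN /powR gt_eqF.
  by field; rewrite gt_eqF// powR_gt0.
have split_int : ((K * J * x `^ nu)%:E = (B x)%:E + \int[leb]_t (d t)%:E)%E.
  rewrite EB EJ -ge0_integralD//; first last.
  - exact/measurable_EFinP.
  - by move=> t _; rewrite lee_fin.
  - apply/measurable_EFinP; apply: measurable_funM.
      exact: (bm_measurable (bm_deficit T (ltW x0))).
    exact: measurable_log_inv_gamma_density.
  - move=> t _; rewrite lee_fin mulr_ge0//; first by apply: deficit_integrand_ge0; exact: ltW.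
    exact: log_inv_gamma_density_ge0.
  apply: eq_integral => t _; rewrite -EFinD; congr (_%:E); rewrite /d /g qE.
  by move: (1 - p _) (expR (- (nu * expR (- t)))) (expR (- (nu * t))) => u v w; ring.
have dle : (\int[leb]_t (d t)%:E <= (K * (T%:R / 2) * (1 + nu) * I * x)%:E)%E.
  have cx0 : (0 <= (K * (T%:R / 2) * (1 + nu) * x)%:E)%E by rewrite lee_fin mulr_ge0// ltW.
  rewrite (_ : K * (T%:R / 2) * (1 + nu) * I * x = K * (T%:R / 2) * (1 + nu) * x * I); last first.
    by move: (K) => K'; ring.
  rewrite EFinM -(integral_exp_abs_shift 0 b0).
  have mE : measurable_fun setT (fun t : R => (expR (- (b * `|t + 0|)))%:E).
    apply/measurable_EFinP; do 2 apply: measurableT_comp => //; apply: measurable_funM => //.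
    by apply: measurableT_comp => //; exact: measurable_funD.
  have pE (t : R) : setT t -> (0 <= (expR (- (b * `|t + 0|)))%:E)%E by rewrite lee_fin expR_ge0.
  rewrite -(ge0_integralZl leb measurableT mE pE cx0).
  apply: ge0_le_integral => //.
  - by move=> t _; rewrite lee_fin.
  - exact/measurable_EFinP.
  - exact: emeasurable_funM.
  - move=> t _; rewrite -EFinM lee_fin addr0 /d /g.
    have h := deficit_le t x0.
    (* For [t >= 0] the loss factor is at most [nu expR (- t)], which cancels [expR t]; for [t < 0]
       it is at most 1 and [expR ((1 - nu) t)] decays. *)
    have key : expR t * expR (- (nu * t)) * (1 - expR (- (nu * expR (- t)))) <= (1 + nu) * expR (- (b * `|t|)).
      have [t0|t0] := leP 0 t.
        have h1 : 1 - expR (- (nu * expR (- t))) <= nu * expR (- t).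
          by have := expR_ge1Dx (- (nu * expR (- t))); lra.
        apply: (@le_trans _ _ (expR t * expR (- (nu * t)) * (nu * expR (- t)))).
          by rewrite ler_wpM2l// mulr_ge0 ?expR_ge0.
        have -> : expR t * expR (- (nu * t)) * (nu * expR (- t)) = nu * expR (- (nu * t)).
          by rewrite [expR (- t)]expRN; field; rewrite gt_eqF// expR_gt0.
        apply: ler_pM; rewrite ?expR_ge0 ?(ltW nu0)//; first by rewrite lerDr.
        by rewrite ler_expR lerN2 ger0_norm// ler_wpM2r.
      have h1 : 1 - expR (- (nu * expR (- t))) <= 1 by rewrite lerBlDr lerDl expR_ge0.
      apply: (@le_trans _ _ (expR t * expR (- (nu * t)) * 1)).
        by rewrite ler_wpM2l// mulr_ge0 ?expR_ge0.
      rewrite mulr1 -expRD -[leLHS]mul1r; apply: ler_pM; rewrite ?expR_ge0//; first by rewrite lerDl ltW.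
      rewrite ler_expR ltr0_norm//.
      by move: (b) b_le2 => b' h'; nra.
    apply: (@le_trans _ _ (K * (T%:R / 2 * (x * expR t) * expR (- (nu * t))) * (1 - expR (- (nu * expR (- t)))))).
      apply: ler_wpM2r => //; apply: ler_wpM2l; first exact: ltW.
      by apply: ler_wpM2r => //; exact: expR_ge0.
    have -> : K * (T%:R / 2 * (x * expR t) * expR (- (nu * t))) * (1 - expR (- (nu * expR (- t)))) =
       K * (T%:R / 2) * x * (expR t * expR (- (nu * t)) * (1 - expR (- (nu * expR (- t))))).
      by move: (K) (1 - _) (expR (- (nu * t))) (expR t) => K' u v w; ring.
    have -> : K * (T%:R / 2) * (1 + nu) * x * expR (- (b * `|t|)) =
       K * (T%:R / 2) * x * ((1 + nu) * expR (- (b * `|t|))).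
      by move: (K) (expR _) => K' w; ring.
    by apply: ler_wpM2l => //; rewrite !mulr_ge0// ltW.
have D0 : (0 <= \int[leb]_t (d t)%:E)%E by apply: integral_ge0 => t _; rewrite lee_fin.
move: split_int dle D0; case: (\int[leb]_t (d t)%:E)%E => [D| |]//=.
rewrite -EFinD !lee_fin => -[] -> h1 h2.
by rewrite opprD addrA subrr add0r normrN ger0_norm.
Qed.

End deficit_small_nu.

(** * One-sided limits and rates at 0 *)

Section right_limits.
Context {R : realType}.
Implicit Types (f g w : R -> R) (l C : R).

Lemma asymp_sim_cvg f g l : l != 0 -> f @ 0^'+ --> l -> g @ 0^'+ --> l -> asymp_sim f g.
Proof.
move=> l0 fl gl; rewrite /asymp_sim -(divff l0).
by apply: cvgM => //; exact: cvgV.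
Qed.

(** The range [r <= 1 / 4] guarantees [4 r^2 <= 1], needed by the lower bounds on [B (4 r^2)], and
    [4 r^2 <= r], needed in the logarithmic case. *)
Lemma rate_bigO f w l C : (forall r, 0 < r <= 1 / 4 -> `|f r - l| <= C * w r) ->
  (fun r => f r - l) =O_ (0^'+) w.
Proof.
move=> fw; apply/eqO_exP; exists (`|C| + 1); first by rewrite ltr_pwDr.
near=> r.
have r4 : 0 < r <= 1 / 4.
  by apply/andP; split; near: r; [exact: nbhs_right_gt|apply: nbhs_right_le; rewrite divr_gt0].
apply: (le_trans (fw r r4)); rewrite (le_trans (ler_norm _))// normrM.
by rewrite ler_wpM2r// lerDl.
Unshelve. all: by end_near. Qed.

Lemma rate_cvg f w l C : (forall r, 0 < r <= 1 / 4 -> `|f r - l| <= C * w r) ->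
  w @ 0^'+ --> (0 : R) -> f @ 0^'+ --> l.
Proof.
move=> fw w0; apply/cvgrPdistC_le => e e0.
have : (fun r => C * w r) @ 0^'+ --> (0 : R).
  by rewrite -[X in _ --> X](mulr0 C); apply: cvgM => //; exact: cvg_cst.
move=> /cvgrPdist_le/(_ e e0) we; near=> r.
have r4 : 0 < r <= 1 / 4.
  by apply/andP; split; near: r; [exact: nbhs_right_gt|apply: nbhs_right_le; rewrite divr_gt0].
apply: (le_trans (fw r r4)); apply: (le_trans (ler_norm _)).
by rewrite -normrN -sub0r; near: r.
Unshelve. all: by end_near. Qed.

Lemma log2_inv_cvg0 : (fun r : R => `|log2 r|^-1) @ 0^'+ --> (0 : R).
Proof.
apply/cvgrPdist_le => e e0; near=> r.
rewrite sub0r normrN ger0_norm ?invr_ge0//.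
have ln2 : 0 < ln (2 : R) by rewrite ln_gt0// ltr1n.
have h : ln r <= - (ln 2 / e) by near: r; apply: cvgrNy_le; exact: lnNy.
have h2 : e^-1 <= `|log2 r|.
  rewrite /log2 normrM (gtr0_norm (_ : 0 < (ln 2)^-1)) ?invr_gt0// ler_pdivlMr//.
  rewrite ler0_norm ?(le_trans h) ?oppr_le0 ?divr_ge0 ?(ltW ln2) ?(ltW e0)//.
  by rewrite mulrC lerNr.
rewrite invf_ple ?posrE// (lt_le_trans _ h2)// invr_gt0//.
Unshelve. all: by end_near. Qed.

Lemma sqr_cvg0 : (fun r : R => r ^+ 2) @ 0^'+ --> (0 : R).
Proof.
suff : (fun r : R => r ^+ 2) @ 0^'+ --> (0 ^+ 2 : R) by rewrite expr0n.
by apply: cvg_at_right_filter; apply: exprn_continuous.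
Qed.

Lemma one_sub_cvg k a w : w @ 0^'+ --> (0 : R) -> (fun r => k * (1 - a * w r)) @ 0^'+ --> k.
Proof.
move=> w0; rewrite -[X in _ --> X]mulr1; apply: cvgM; first exact: cvg_cst.
rewrite -[X in _ --> X]subr0; apply: cvgB; first exact: cvg_cst.
by rewrite -[X in _ --> X](mulr0 a); apply: cvgM => //; exact: cvg_cst.
Qed.

End right_limits.

(** * Bounds and rates for the two correlations *)

Section correlation_asymptotics.
Context {R : realType}.
Variables (nu : R) (T : nat).
Hypothesis nu0 : 0 < nu.
Hypothesis T1 : (1 <= T)%N.
Variable ka : probability (measurableTypeR R) R.
Hypothesis kaP : log_inv_gamma_law nu ka.
Local Notation p := (@inv_sqrt_pow R T).
Local Notation B := (deficit T ka).
Local Notation G := (quad_trunc ka).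

(* With [x = r ^+ 2], [mixing_corr] is rho and [mixing_corr_lower] is rho tilde. *)
Definition mixing_corr (x : R) :=
  (\int[ka]_t p (2 * x * expR t) - \int[ka]_t (p (3 * x * expR t) * p (x * expR t)))
  / (1 - \int[ka]_t p (4 * x * expR t)).

Definition mixing_corr_lower (x : R) :=
  (\int[ka]_t p (2 * x * expR t) - \int[ka]_t p (4 * x * expR t))
  / (1 - \int[ka]_t p (4 * x * expR t)).

Let bm c x : 0 <= c -> 0 <= x ->
  bounded_measurable ((fun t => p (c * x * expR t)) : measurableTypeR R -> R).
Proof. by move=> c0 x0; apply: bm_inv_sqrt_pow; rewrite mulr_ge0. Qed.

Let bm3 x : 0 <= x -> bounded_measurable
  ((fun t => p (3 * x * expR t) * p (x * expR t)) : measurableTypeR R -> R).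
Proof. by move=> x0; apply: bmM; [exact: bm|exact: bm_inv_sqrt_pow]. Qed.

Let B4gt0 x : 0 < x -> 0 < B (4 * x).
Proof. by move=> x0; apply: deficit_gt0 => //; rewrite mulr_gt0. Qed.

Let MB c x : 0 <= c -> 0 <= x -> \int[ka]_t p (c * x * expR t) = 1 - B (c * x).
Proof. by move=> c0 x0; rewrite deficitE// mulr_ge0. Qed.

Lemma mixing_corr_lowerE x : 0 < x -> mixing_corr_lower x = (B (4 * x) - B (2 * x)) / B (4 * x).
Proof.
by move=> /ltW x0; rewrite /mixing_corr_lower !MB//; congr (_ / _); ring.
Qed.

Lemma mixing_corr_subE x : 0 < x -> mixing_corr x - mixing_corr_lower x =
  (\int[ka]_t (p (4 * x * expR t) - p (3 * x * expR t) * p (x * expR t))) / B (4 * x).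
Proof.
move=> x0; have x0' := ltW x0; rewrite /mixing_corr /mixing_corr_lower -mulrBl.
rewrite bm_RintegralB; [|exact: bm|exact: bm3].
by rewrite [in X in _ / X = _]MB//; congr (_ / _); ring.
Qed.

Lemma mixing_corr_gt x : 0 < x -> mixing_corr_lower x < mixing_corr x.
Proof.
move=> x0; have x0' := ltW x0; rewrite -subr_gt0 mixing_corr_subE// divr_gt0 ?B4gt0//.
apply: Rintegral_gt0; first by apply: bmB; [exact: bm|exact: bm3].
move=> t; have y0 : 0 < x * expR t by rewrite mulr_gt0 ?expR_gt0.
rewrite -!mulrA inv_sqrt_powM ?(ltW y0)// subr_gt0.
by apply: inv_sqrt_pow_anti => //; [rewrite mulr_ge0 ?(ltW y0)|rewrite ltrDl mulr_gt0 ?exprn_gt0].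
Qed.

Let norm_Rint_le (f : R -> R) C x : 0 <= x ->
  bounded_measurable (f : measurableTypeR R -> R) ->
  (forall t, `|f t| <= C * Num.min 1 ((x * expR t) ^+ 2)) ->
  `|\int[ka]_t f t| <= C * G x.
Proof.
move=> x0 bf fC.
have bG := bm_quad_trunc x.
rewrite /G -bm_RintegralZ// ler_norml -mulN1r -bm_RintegralZ; last first.
  by apply: bmM => //; exact: bm_cst.
apply/andP; split; apply: bm_le_Rintegral => //.
- by apply: bmM; [exact: bm_cst|apply: bmM => //; exact: bm_cst].
- by move=> t; rewrite mulN1r; have := fC t; rewrite ler_norml => /andP[].
- by apply: bmM => //; exact: bm_cst.
- by move=> t; rewrite (le_trans (ler_norm _)).
Qed.

Lemma mixing_corr_bounds : exists2 C, 0 <= C & forall x, 0 < x ->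
  `|mixing_corr_lower x - 1 / 2| <= C * (G x / B (4 * x)) /\
  `|mixing_corr x - mixing_corr_lower x| <= C * (G x / B (4 * x)).
Proof.
have [C C0 hC] := @inv_sqrt_pow_second_order R T; exists C => // x x0.
have x0' := ltW x0; have b0 := B4gt0 x0.
have y0 t : 0 <= x * expR t by rewrite mulr_ge0 ?expR_ge0.
rewrite mulrA; split; last first.
  rewrite mixing_corr_subE// normrM normfV (gtr0_norm b0) ler_wpM2r ?invr_ge0 ?(ltW b0)//.
  apply: norm_Rint_le => //; first by apply: bmB; [exact: bm|exact: bm3].
  by move=> t; rewrite -!mulrA; have [] := hC _ (y0 t).
have D1 : `|\int[ka]_t (1 - 2 * p (2 * x * expR t) + p (4 * x * expR t))| <= C * G x.
  apply: norm_Rint_le => //; last by move=> t; rewrite -!mulrA; have [] := hC _ (y0 t).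
  apply: bmD; last exact: bm.
  by apply: bmB; [exact: bm_cst|apply: bmM; [exact: bm_cst|exact: bm]].
rewrite mixing_corr_lowerE//.
(* In terms of deficits, the integral on the right is [2 B(2x) - B(4x)]. *)
have -> : (B (4 * x) - B (2 * x)) / B (4 * x) - 1 / 2 =
   - (\int[ka]_t (1 - 2 * p (2 * x * expR t) + p (4 * x * expR t))) / 2 / B (4 * x).
  rewrite bm_RintegralD; [|by apply: bmB; [exact: bm_cst|apply: bmM; [exact: bm_cst|exact: bm]]|exact: bm].
  rewrite bm_RintegralB; [|exact: bm_cst|by apply: bmM; [exact: bm_cst|exact: bm]].
  rewrite bm_RintegralZ; last exact: bm.
  rewrite bm_Rintegral_cst !MB//; field; exact: lt0r_neq0.
rewrite normrM normfV (gtr0_norm b0) ler_wpM2r ?invr_ge0 ?(ltW b0)//.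
rewrite normrM normrN normfV (ger0_norm (_ : 0 <= 2))// ler_pdivrMr//.
by apply: (le_trans D1); rewrite ler_peMr ?(le_trans _ D1)// ler1n.
Qed.

(** One ratio controls both correlations; the triangle inequality through [mixing_corr_lower]
    accounts for the factor 2. *)
Lemma mixing_corr_rate w C :
  (forall r, 0 < r <= 1 / 4 -> G (r ^+ 2) / B (4 * r ^+ 2) <= C * w r) ->
  exists C', (forall r, 0 < r <= 1 / 4 -> `|mixing_corr_lower (r ^+ 2) - 1 / 2| <= C' * w r) /\
    (forall r, 0 < r <= 1 / 4 -> `|mixing_corr (r ^+ 2) - 1 / 2| <= C' * w r).
Proof.
move=> hw; have [D D0 hD] := mixing_corr_bounds.
exists (2 * D * C); split => r r4; have [r0 _] := andP r4.
  have [h1 h2] := hD _ (exprn_gt0 2 r0); have h3 := ler_wpM2l D0 (hw r r4).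
  apply: (le_trans h1); apply: (le_trans h3).
  (* No sign is assumed for [C] or [w]; the bound itself shows that the right-hand side is
     nonnegative, so it may be doubled. *)
  have := le_trans (normr_ge0 _) (le_trans h1 h3).
  by rewrite !mulrA; lra.
have [h1 h2] := hD _ (exprn_gt0 2 r0); have h3 := ler_wpM2l D0 (hw r r4).
rewrite (_ : mixing_corr _ - _ = (mixing_corr (r ^+ 2) - mixing_corr_lower (r ^+ 2)) +
  (mixing_corr_lower (r ^+ 2) - 1 / 2)); last by ring.
apply: (le_trans (ler_normD _ _)).
apply: (le_trans (lerD (le_trans h2 h3) (le_trans h1 h3))).
by rewrite !mulrA; lra.
Qed.

Let sqr_le (r : R) : 0 < r <= 1 / 4 -> 0 < 4 * r ^+ 2 <= 1.
Proof. 
move=> /andP[r0 r4]; have := exprn_gt0 2 r0.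
have : r ^+ 2 <= (1 / 4) ^+ 2 by rewrite ler_pXn2r// nnegrE ?(ltW r0)// divr_ge0.
by rewrite expr2 => h1 h2; apply/andP; split; lra.
 Qed.

Let powR_sqr (r a : R) : 0 < r -> (r ^+ 2) `^ a = r `^ (2 * a).
Proof. by move=> r0; rewrite -powR_mulrn ?(ltW r0)// -powRrM. Qed.

(** Numerator of order [x^nu], denominator at least of order [x], with [x = r^2]. The resulting rate
    tends to 0 once [nu > 1]. *)
Lemma quad_trunc_ratio_pow : nu < 2 -> exists C, forall r, 0 < r <= 1 / 4 ->
  G (r ^+ 2) / B (4 * r ^+ 2) <= C * r `^ (2 * (nu - 1)).
Proof.
move=> nu2; have [C C0 hG] := quad_trunc_le nu0 kaP nu2.
have [c c0 hB] := deficit_ge_lin nu0 T1 kaP.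
exists (C / (c * 4)) => r r4; have [r0 _] := andP r4.
have h1 := hG _ (exprn_gt0 2 r0); have h2 := hB _ (sqr_le r4).
have b0 := B4gt0 (exprn_gt0 2 r0).
rewrite ler_pdivrMr//; apply: (le_trans h1).
have e : (r ^+ 2) `^ nu = r `^ (2 * (nu - 1)) * r ^+ 2.
  rewrite powR_sqr// -powR_mulrn ?(ltW r0)// -powRD; last by rewrite (gt_eqF r0) implybT.
  by congr (_ `^ _); ring.
rewrite e; apply: (@le_trans _ _ (C / (c * 4) * r `^ (2 * (nu - 1)) * (c * (4 * r ^+ 2)))).
  by rewrite le_eqVlt; apply/orP; left; apply/eqP; field; rewrite gt_eqF.
by rewrite ler_wpM2l// mulr_ge0 ?powR_ge0// divr_ge0 ?(ltW C0)// mulr_ge0// ltW.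
Qed.

Lemma quad_trunc_ratio_log : nu = 1 -> exists C, forall r, 0 < r <= 1 / 4 ->
  G (r ^+ 2) / B (4 * r ^+ 2) <= C * `|log2 r|^-1.
Proof.
move=> nu1; have nu2 : nu < 2 by rewrite nu1 ltr1n.
have [C C0 hG] := quad_trunc_le nu0 kaP nu2.
have [c c0 hB] := deficit_ge_log nu0 T1 kaP nu1.
have ln2 : 0 < ln (2 : R) by rewrite ln_gt0// ltr1n.
exists (C / (c * 4) / ln 2) => r r4; have [r0 r4'] := andP r4.
have h1 := hG _ (exprn_gt0 2 r0); have h2 := hB _ (sqr_le r4).
have b0 := B4gt0 (exprn_gt0 2 r0).
have l0 : 0 < - ln r by rewrite oppr_gt0 ln_lt0// r0 (le_lt_trans r4')//; lra.
(* Trades the logarithm of the argument of [B] for that of [r], using [4 r^2 <= r]. *)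
have l4 : - ln r <= - ln (4 * r ^+ 2).
  
  rewrite lerN2 ler_ln ?posrE ?mulr_gt0 ?exprn_gt0//.
  by rewrite expr2 mulrA ler_piMl ?(ltW r0)//; lra.
have elog : `|log2 r|^-1 = ln 2 / - ln r.
  rewrite /log2 normrM normfV (gtr0_norm ln2) ltr0_norm -?oppr_gt0//.
  by rewrite invfM invrK mulrC.
rewrite elog ler_pdivrMr//; apply: (le_trans h1).
rewrite nu1 powRr1 ?exprn_ge0 ?(ltW r0)//.
apply: (@le_trans _ _ (C / (c * 4) / ln 2 * (ln 2 / - ln r) * (c * (4 * r ^+ 2 * - ln r)))).
  rewrite le_eqVlt; apply/orP; left; apply/eqP; field.
  by rewrite (gt_eqF ln2) (gt_eqF c0) -oppr_eq0 (gt_eqF l0).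
rewrite ler_wpM2l//; first by rewrite mulr_ge0 ?divr_ge0 ?mulr_ge0 ?(ltW C0) ?(ltW c0) ?(ltW ln2) ?(ltW l0).
apply: (le_trans _ h2); rewrite !ler_wpM2l ?(ltW c0)//.
by rewrite mulr_ge0// exprn_ge0// ltW.
Qed.

Lemma quad_trunc_ratio_sqr : 2 < nu -> exists C, forall r, 0 < r <= 1 / 4 ->
  G (r ^+ 2) / B (4 * r ^+ 2) <= C * r ^+ 2.
Proof.
move=> nu2; have [C C0 hG] := quad_trunc_le_sqr nu0 kaP nu2.
have [c c0 hB] := deficit_ge_lin nu0 T1 kaP.
exists (C / (c * 4)) => r r4; have [r0 _] := andP r4.
have h1 := hG _ (exprn_gt0 2 r0); have h2 := hB _ (sqr_le r4).
have b0 := B4gt0 (exprn_gt0 2 r0).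
rewrite ler_pdivrMr//; apply: (le_trans h1).
apply: (@le_trans _ _ (C / (c * 4) * r ^+ 2 * (c * (4 * r ^+ 2)))).
  by rewrite le_eqVlt; apply/orP; left; apply/eqP; field; rewrite gt_eqF.
by rewrite ler_wpM2l// mulr_ge0 ?exprn_ge0 ?(ltW r0)// divr_ge0 ?(ltW C0)// mulr_ge0// ltW.
Qed.

(** Since [2^(-nu) (4x)^nu = (2x)^nu], the leading terms of [B (4 * x)] and [B (2 * x)] cancel and
    an error linear in [x] remains. It is divided by the lower bound of order [x^nu] from
    [deficit_ge_pow], so that the sign of [L] never matters. *)
Lemma mixing_corr_lower_small_nu : nu < 1 -> exists C, forall r, 0 < r <= 1 / 4 ->
  `|mixing_corr_lower (r ^+ 2) - (1 - 2 `^ (- nu))| <= C * r `^ (2 * (1 - nu)).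
Proof.
move=> nu1; have [L [C [C0 hL]]] := deficit_small_nu T nu0 nu1 kaP.
have [c c0 hB] := deficit_ge_pow nu0 T1 kaP.
(* The two remainders add up to [6 C x], for which 8 leaves room; [c * 4^nu] comes from the lower
   bound at [4 x]. *)
exists (C * 8 / (c * 4 `^ nu)) => r r4; have [r0 _] := andP r4.
have x0 := exprn_gt0 2 r0; set x := r ^+ 2 in x0 *.
have b0 := B4gt0 x0; have h2 := hB _ (sqr_le r4); rewrite -/x in h2.
rewrite mixing_corr_lowerE//.
have two_gt : 0 < 2 `^ nu :> R by rewrite powR_gt0.
have p1 : 2 `^ (- nu) <= 1 :> R.
  by rewrite -[leRHS](powRr0 (2 : R)) ler_powR ?ler1n// oppr_le0 ltW.
have -> : (B (4 * x) - B (2 * x)) / B (4 * x) - (1 - 2 `^ (- nu)) =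
  (2 `^ (- nu) * (B (4 * x) - L * (4 * x) `^ nu) - (B (2 * x) - L * (2 * x) `^ nu)) / B (4 * x).
  have -> : (4 * x) `^ nu = 2 `^ nu * (2 * x) `^ nu.
    have -> : 4 * x = 2 * (2 * x) by ring.
    by rewrite [LHS]powRM// mulr_ge0// ltW.
  rewrite powRN; field; by rewrite !gt_eqF.
rewrite normrM normfV (gtr0_norm b0) ler_pdivrMr//.
apply: (@le_trans _ _ (C * (4 * x) + C * (2 * x))).
  rewrite (le_trans (ler_normB _ _))// lerD ?hL ?mulr_gt0//.
  rewrite normrM ger0_norm ?powR_ge0// (le_trans _ (hL _ _)) ?mulr_gt0//.
  by rewrite ler_piMl.
apply: (@le_trans _ _ (C * 8 / (c * 4 `^ nu) * r `^ (2 * (1 - nu)) * (c * (4 * x) `^ nu))).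
  have -> : C * 8 / (c * 4 `^ nu) * r `^ (2 * (1 - nu)) * (c * (4 * x) `^ nu) =
     C * 8 * (r `^ (2 * (1 - nu)) * x `^ nu).
    rewrite powRM ?(ltW x0)//; field; rewrite !gt_eqF//= powR_gt0//.
  rewrite /x powR_sqr// -powRD; last by rewrite (gt_eqF r0) implybT.
  rewrite (_ : 2 * (1 - nu) + 2 * nu = 2%:R); last by ring.
  rewrite powR_mulrn ?(ltW r0)// -/x.
  have := mulr_ge0 C0 (ltW x0); lra.
rewrite ler_wpM2l// mulr_ge0 ?powR_ge0// divr_ge0 ?mulr_ge0 ?powR_ge0 ?(ltW c0)//.
Qed.

End correlation_asymptotics.

Lemma inv_sqrt_pow_powR {R : realType} (T : nat) (y : R) : 0 <= y ->
  (1 + y) `^ (- (T%:R / 2)) = inv_sqrt_pow T y.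
Proof.
move=> y0; have h : 0 <= 1 + y by rewrite addr_ge0.
by rewrite /inv_sqrt_pow powRN -powR12_sqrt// -powR_mulrn ?powR_ge0// -powRrM mulrC.
Qed.

Section rho_lower_mixing.
Context {R : realType} (nu : R) (T : nat).
Hypothesis nu0 : 0 < nu.
Variable ka : probability (measurableTypeR R) R.
Hypothesis kaP : log_inv_gamma_law nu ka.
Context {d} {Omega : measurableType d} (P : probability Omega R) (V : {RV P >-> R}).
Hypothesis lawV : has_inv_gamma_law V nu nu.

Lemma rho_lower_mixing r : rho_lower V T r = mixing_corr_lower T ka (r ^+ 2).
Proof.
suff E (c : R) : 0 <= c ->
    fine ('E_P[(fun w => (1 + c * r ^+ 2 * V w) `^ (- (T%:R / 2)))%R])%E =
    \int[ka]_t inv_sqrt_pow T (c * r ^+ 2 * expR t).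
  by rewrite /rho_lower /mixing_corr_lower !E.
move=> c0; have cr0 : 0 <= c * r ^+ 2 by rewrite mulr_ge0// sqr_ge0.
rewrite unlock.
have := @inv_gamma_expectation _ _ nu0 _ kaP _ _ _ _ lawV
  (fun v => (1 + c * r ^+ 2 * v) `^ (- (T%:R / 2))) => -> //.
- rewrite /Rintegral; congr fine; apply: eq_integral => t _.
  by rewrite inv_sqrt_pow_powR// mulr_ge0// expR_ge0.
- apply: (measurableT_comp (@measurable_powR R _)).
  by apply: measurable_funD => //; exact: measurable_funM.
- by move=> x; exact: powR_ge0.
- move=> x x0.
  apply: (@continuous_comp _ _ _ (fun v : R => 1 + c * r ^+ 2 * v) (@powR R ^~ (- (T%:R / 2)))).
    by apply: cvgD; [exact: cvg_cst|apply: cvgM; [exact: cvg_cst|exact: cvg_id]].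
  by apply: continuous_powR_pos; rewrite ltr_pwDl// mulr_ge0// ltW.
Qed.

End rho_lower_mixing.

Lemma half_neq0 (R : realType) : 1 / 2 != 0 :> R. Proof. by rewrite mul1r invr_eq0. Qed.

(* [rho] is the shared-endpoint correlation as a function of r = sigma_x / ell:
   the first conjunct determines it, as it is required of every realization. *)
Theorem mainTheorem10 (R : realType) (T : nat) (nu : R)
    (hT : (1 <= T)%N) (hnu : 0 < nu) :
  exists rho : R -> R,
    (forall (ell sigma_u sigma_x : R)
        (d : measure_display) (Omega : measurableType d)
        (P : probability Omega R)
        (U : T.-tuple R * T.-tuple R -> Omega -> R)
        (m : T.-tuple R * T.-tuple R -> R)
        (piX : probability (T.-tuple R) R) (mu : 'I_T -> R),
      0 < ell -> 0 < sigma_u -> 0 < sigma_x ->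
      gaussian_process P U m (@matern_kernel R T sigma_u ell nu) ->
      measurable_fun setT
        (fun p : Omega * (T.-tuple R * T.-tuple R) => U p.2 p.1) ->
      (forall x y, 'E_P[skew_field U x y]%E = 0%E) ->
      isotropic_gaussian piX mu (sigma_x ^+ 2) ->
      shared_endpoint_correlation P piX (skew_field U) = rho (sigma_x / ell)) /\
    forall (d : measure_display) (Omega : measurableType d)
      (P : probability Omega R) (V : {RV P >-> R}),
      has_inv_gamma_law V nu nu ->
      let rhot := rho_lower V T in
      [/\ forall r : R, 0 < r -> rhot r < rho r,
        nu < 1 ->
          asymp_sim rhot (fun r : R =>
            (1 - 2 `^ (- nu)) *
            (1 - (2 `^ (1 - nu) - 1) / (2 `^ nu - 1) * gamma_fun nu
                 * (2 * nu) `^ (1 - nu) * r `^ (2 * (1 - nu)))) /\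
          (fun r : R => rhot r - (1 - 2 `^ (- nu)))
            =O_ (0^'+) (fun r : R => r `^ (2 * (1 - nu))),
        nu = 1 ->
          asymp_sim rhot (fun r : R => 1 / 2 * (1 - 1 / 2 * `|log2 r|^-1)) /\
          (fun r : R => rhot r - 1 / 2) =O_ (0^'+) (fun r : R => `|log2 r|^-1),
        1 < nu < 2 ->
          asymp_sim rhot (fun r : R =>
            1 / 2 *
            (1 - (2 * nu) `^ (nu - 1) / gamma_fun nu * (2 `^ (nu - 1) - 1)
                 * ((nu * (T%:R - 2) + 2) / T%:R) * r `^ (2 * (nu - 1)))) /\
          (fun r : R => rhot r - 1 / 2)
            =O_ (0^'+) (fun r : R => r `^ (2 * (nu - 1))) &
        (1 <= nu < 2 -> asymp_sim rho rhot) /\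
        (2 < nu ->
          asymp_sim rho (fun r : R =>
            1 / 2 * (1 - (T%:R - 1) / 2 * (nu / (nu - 2)) * r ^+ 2)) /\
          (fun r : R => rho r - 1 / 2) =O_ (0^'+) (fun r : R => r ^+ 2))].
Proof.
have [ka kaP] := log_inv_gamma_exists hnu.
(* [ka] is built from its density before any realization of the field is given, so the witness
   depends on [r], [nu] and [T] alone. *)
exists (fun r => mixing_corr T ka (r ^+ 2)); split.
  move=> ell su sx d Omega P U m piX mu ell0 su0 sx0 gp mU meanF iso.
  have mix := fun q (q0 : 0 <= q) => matern_mixture hnu kaP ell0 q0.
  rewrite /shared_endpoint_correlation.
  rewrite (integral_cond_covariance_matern gp meanF ell0 mU iso mix).
  rewrite (total_variance_matern gp meanF ell0 mU iso mix) /mixing_corr /inv_sqrt_pow.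
  (* The common factor [2 * su ^+ 2] of covariance and variance is nonzero and cancels. *)
  by rewrite -mulf_div divff ?mul1r// mulf_neq0// expf_neq0// gt_eqF.
move=> d Omega P V lawV rhot.
have rhotE : rhot = fun r => mixing_corr_lower T ka (r ^+ 2).
  by apply/funext => r; exact: (rho_lower_mixing T hnu kaP lawV).
rewrite {}rhotE; clear rhot.
have mid_small : 1 < nu -> (fun r : R => r `^ (2 * (nu - 1))) @ 0^'+ --> (0 : R).
  by move=> nu1; apply: powR_cvg0; rewrite mulr_gt0// subr_gt0.
split.
- by move=> r r0; apply: (mixing_corr_gt hT ka); exact: exprn_gt0.
- move=> nu1; have [C hC] := mixing_corr_lower_small_nu hnu hT kaP nu1.
  have w0 : (fun r : R => r `^ (2 * (1 - nu))) @ 0^'+ --> (0 : R).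
    by apply: powR_cvg0; rewrite mulr_gt0// subr_gt0.
  split; last exact: rate_bigO hC.
  apply: (asymp_sim_cvg _ (rate_cvg hC w0) (@one_sub_cvg _ _ _ _ w0)).
  by rewrite subr_eq0 gt_eqF// /powR gt_eqF// expR_lt1 mulNr oppr_lt0 mulr_gt0 ?ln_gt0 ?ltr1n.
- move=> nu1; have [C hC] := quad_trunc_ratio_log hnu hT kaP nu1.
  have [C' [hC' _]] := mixing_corr_rate hT hC.
  split; last exact: rate_bigO hC'.
  exact: (asymp_sim_cvg (half_neq0 R) (rate_cvg hC' log2_inv_cvg0) (@one_sub_cvg _ _ _ _ log2_inv_cvg0)).
- move=> /andP[nu1 nu2]; have [C hC] := quad_trunc_ratio_pow hnu hT kaP nu2.
  have [C' [hC' _]] := mixing_corr_rate hT hC.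
  split; last exact: rate_bigO hC'.
  apply: (asymp_sim_cvg (half_neq0 R) (rate_cvg hC' (mid_small nu1)) (@one_sub_cvg _ _ _ _ (mid_small nu1))).
split.
  (* The two cases differ by the rate, logarithmic at [nu = 1] and a power above; in each, both
     correlations tend to 1/2. *)
  move=> /andP[]; rewrite le_eqVlt => /orP[/eqP nu1 _|nu1 nu2].
    have [C hC] := quad_trunc_ratio_log hnu hT kaP (esym nu1).
    have [C' [h1 h2]] := mixing_corr_rate hT hC.
    exact: (asymp_sim_cvg (half_neq0 R) (rate_cvg h2 log2_inv_cvg0) (rate_cvg h1 log2_inv_cvg0)).
  have [C hC] := quad_trunc_ratio_pow hnu hT kaP nu2.
  have [C' [h1 h2]] := mixing_corr_rate hT hC.
  exact: (asymp_sim_cvg (half_neq0 R) (rate_cvg h2 (mid_small nu1)) (rate_cvg h1 (mid_small nu1))).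
move=> nu2; have [C hC] := quad_trunc_ratio_sqr hnu hT kaP nu2.
have [C' [_ hC']] := mixing_corr_rate hT hC.
split; last exact: rate_bigO hC'.
apply: (asymp_sim_cvg (half_neq0 R) (rate_cvg hC' sqr_cvg0) (@one_sub_cvg _ _ _ _ sqr_cvg0)).
Qed.
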